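(* For each $\alpha<\omega_1$, $T_\alpha$ is a reflexive Banach space with an unconditional basis and with no subspace isomorphic to $\ell^p$, $1\le p<\infty$, or $c_0$. Moreover $\mathcal O^{\omega^\alpha}\left(\epsilon,(t^\alpha_n),B_{(T_\alpha)^*}\right)\neq\emptyset$ for all $0<\epsilon<1$.
   Context: **Families $\mathcal F_\alpha$.** $\mathcal F_0=\{\{n\}:n\in\mathbb N\}\cup\{\emptyset\}$ and $\mathcal F_1=\{F\subset\mathbb N:\min F\ge\operatorname{card}F\}\cup\{\emptyset\}$ (finite sets). For $1<\alpha<\omega_1$, let $\alpha_i=\alpha-1$ for all $i$ if $\alpha$ is a successor and let $(\alpha_i)$ be a fixed sequence of ordinals with $\alpha_i\uparrow\alpha$ if $\alpha$ is a limit ordinal; then $$\mathcal F_\alpha=\bigcup_{n\ge1}\Big\{\bigcup_{i=1}^nF_i: F_i\in\mathcal F_{\alpha_i}\text{ for }i\le n,\ n\le F_1<F_2<\dots<F_n\Big\},$$ where $n\le F_1<\dots<F_n$ means $n\le\min F_i$ for all nonempty $F_i$, and $\max F_i<\min F_j$ whenever $i<j$ and $F_i,F_j$ are nonempty. $\mathcal F_\alpha$ is given the topology of pointwise convergence of indicator functions on $\mathbb N$, and $x_n^\alpha\in C(\mathcal F_\alpha)$ is $x^\alpha_n(F)=1$ if $n\in F$ and $0$ otherwise. **The spaces $T_\alpha$.** Let $(t_n^\alpha)$ be the unit vector basis of the space of finitely supported real sequences. For $x=\sum a_nt^\alpha_n$ put $\|x\|_0=\|\sum a_nx^\alpha_n\|_{C(\mathcal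 F_\alpha)}$ and $$\|x\|_{m+1}=\max\Big\{\|x\|_m,\ \tfrac12\max_{\{p_1<\dots<p_k\}\in\mathcal F_1}\sum_{i=1}^k\Big\|\sum_{n=p_i}^{p_{i+1}-1}a_nt^\alpha_n\Big\|_m\Big\},$$ where $k$ is the cardinality of $\{p_i\}$ and $p_{k+1}=\infty$. Let $\|x\|=\lim_m\|x\|_m$, and let $T_\alpha$ be the completion of $\operatorname{span}\{t^\alpha_n\}$ under $\|\cdot\|$. $B_{(T_\alpha)^*}$ is the dual unit ball with the $w^*$ topology, on which the $t^\alpha_n$ act as continuous functions. **Oscillation sets.** For a Polish space $K$, a pointwise convergent sequence $(f_n)$ of continuous real-valued functions on $K$ and $\epsilon>0$, put $A^+_{n,m}=\{k\in K: f_n(k)-f_m(k)>\epsilon\}$ and $A^-_{n,m}=\{k\in K: f_n(k)-f_m(k)<-\epsilon\}$. Let $\mathcal O^0(\epsilon,(f_n),K)=K$. Let $\mathcal O^{\alpha+1}(\epsilon,(f_n),K)$ be the set of $k\in\mathcal O^{\alpha}(\epsilon,(f_n),K)$ such that for every neighborhood $\mathcal N$ of $k$ there is $N\in\mathbb N$ such that for all $n\ge N$ there is $M\in\mathbb N$ with $\bigcap_{m\ge M}A^+_{n,m}\cap\mathcal O^\alpha(\epsilon,(f_n),K)\cap\mathcal N\ne\emptyset$ or $\bigcap_{m\ge M}A^-_{n,m}\cap\mathcal O^\alpha(\epsilon,(f_n),K)\cap\mathcal N\ne\emptyset$. For a limit ordinal $\beta$, $\mathcal O^\beta=\bigcap_{\alpha<\beta}\mathcal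 O^\alpha$. *)

(* Defs.v *)
From HB Require Import structures.
From mathcomp Require Import all_boot all_order all_algebra finmap.
From mathcomp Require Import all_classical all_reals all_analysis wochoice.
From mathcomp Require Import ring lra zify.

Set Implicit Arguments.
Unset Strict Implicit.
Unset Printing Implicit Defensive.

Import Order.TTheory GRing.Theory Num.Theory.
Import numFieldNormedType.Exports.

Local Open Scope classical_set_scope.
Local Open Scope ring_scope.

(* A representation of the set omega_1 of countable ordinals, which these axioms
   determine up to a unique order isomorphism. The bottom element is the ordinal 0. *)
Record omega1 := Omega1 {
  omega1_disp : Order.disp_t;
  omega1_sort :> bOrderType omega1_disp;
  omega1_wf : well_founded (fun a b : omega1_sort => (a < b)%O);
  omega1_countable : forall b : omega1_sort, countable [set a : omega1_sort | (a < b)%O];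
  omega1_uncountable : ~ countable [set: omega1_sort] }.

Section Ordinals.
Variable W : omega1.
Implicit Types (a b c : W) (A : set W).

Definition oleast A : W :=
  xget Order.bottom [set a | A a /\ forall b, A b -> (a <= b)%O].

Definition osup A : W := oleast [set b | forall a, A a -> (a <= b)%O].

Definition ozero : W := Order.bottom.
Definition osucc a : W := oleast [set b | (a < b)%O].
Definition oone : W := osucc ozero.
Definition oomega : W := osup (range (fun n => iter n osucc ozero)).

Definition olimit a := a <> ozero /\ ~ exists b, a = osucc b.

(* Transfinite recursion with value z at 0 and step function s at successors; at
   a limit ordinal, l is applied to the set of all the earlier values. *)
Definition orec (T : Type) (z : T) (s : T -> T) (l : set T -> T) : W -> T :=
  Fix (@omega1_wf W) (fun=> T) (fun b rec =>
    if pselect (b = ozero) then z else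
    match pselect (exists c, (c < b)%O /\ b = osucc c) with
    | left h => s (rec (projT1 (cid h)) (proj1 (projT2 (cid h))))
    | right _ => l [set x | exists c (h : (c < b)%O), x = rec c h]
    end).

Definition oadd a : W -> W := orec a osucc osup.
Definition omul a : W -> W := orec ozero (fun c => oadd c a) osup.
Definition oexp a : W -> W := orec oone (fun c => omul c a) osup.

Lemma oleastP A a : A a -> A (oleast A) /\ forall b, A b -> (oleast A <= b)%O.
Proof.
move=> Aa; rewrite /oleast.
suff [m Pm] : exists m, A m /\ forall b, A b -> (m <= b)%O.
  exact: (@xgetPex _ _ [set a | A a /\ forall b, A b -> (a <= b)%O] (ex_intro _ m Pm)).
elim/(well_founded_ind (@omega1_wf W)): a Aa => a IH Aa.
have [[b [Ab ba]]|H] := pselect (exists b, A b /\ (b < a)%O); first exact: IH ba Ab.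
exists a; split=> // b Ab; rewrite leNgt; apply/negP => ba.
by apply: H; exists b.
Qed.

(* No countable set of countable ordinals is cofinal in omega_1. *)
Lemma countable_bounded A : countable A -> exists b, forall a, A a -> (a < b)%O.
Proof.
move=> cA; apply: contrapT => H; apply: (@omega1_uncountable W).
have -> : [set: W] = \bigcup_(i in [set: bool])
    (if i then \bigcup_(a in A) [set b : W | (b < a)%O] else A).
  apply/seteqP; split=> // b _; apply: contrapT => nb; apply: H.
  exists b => a Aa; rewrite ltNge le_eqVlt; apply/negP => /orP[/eqP ba|ba].
    by apply: nb; exists false; rewrite // ba.
  by apply: nb; exists true => //; exists a.
apply: bigcup_countable => [|[] _]; [exact: countableP| |by []].
by apply: bigcup_countable => // a _; exact: omega1_countable.
Qed.

Lemma osuccP a : (a < osucc a)%O /\ forall b, (a < b)%O -> (osucc a <= b)%O.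
Proof.
have [b ab] := countable_bounded (countable1 a).
exact: (oleastP (ab a erefl)).
Qed.

Lemma osupP A : countable A ->
  (forall a, A a -> (a <= osup A)%O) /\
  forall b, (forall a, A a -> (a <= b)%O) -> (osup A <= b)%O.
Proof.
move=> /countable_bounded[b Ab].
by apply: (@oleastP [set b | forall a, A a -> (a <= b)%O] b) => a /Ab/ltW.
Qed.

Lemma osucc_inj : injective osucc.
Proof.
move=> a b ab; apply/eqP; rewrite eq_le; apply/andP; split; rewrite leNgt; apply/negP.
  move=> /(proj2 (osuccP b)); rewrite -ab leNgt.
  by rewrite (proj1 (osuccP a)).
move=> /(proj2 (osuccP a)); rewrite ab leNgt.
by rewrite (proj1 (osuccP b)).
Qed.

Section OrecEquations.
Variables (T : Type) (z : T) (s : T -> T) (l : set T -> T).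

Lemma orecE b : orec z s l b =
  if pselect (b = ozero) then z else
  match pselect (exists c, (c < b)%O /\ b = osucc c) with
  | left h => s (orec z s l (projT1 (cid h)))
  | right _ => l [set orec z s l c | c in [set c | (c < b)%O]]
  end.
Proof.
rewrite {1}/orec Fix_eq; last first.
  move=> c f g fg; have -> // : f = g.
  by apply: functional_extensionality_dep => x; apply: functional_extensionality_dep.
case: pselect => //= b0; case: pselect => // h; congr l.
by apply/seteqP; split=> x [c] => [[h' ->]|h' <-]; exists c => //; exists h'.
Qed.

Lemma orec0 : orec z s l ozero = z.
Proof. by rewrite orecE; case: pselect. Qed.

Lemma orecS c : orec z s l (osucc c) = s (orec z s l c).
Proof.
rewrite orecE; case: pselect => [c0|_] /=.
  by have := proj1 (osuccP c); rewrite c0 ltNge le0x.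
case: pselect => [h|[]]; last by exists c; split=> //; exact: (proj1 (osuccP c)).
by case: (cid h) => d /= [_ /osucc_inj ->].
Qed.

Lemma orec_limit b : olimit b ->
  orec z s l b = l [set orec z s l c | c in [set c | (c < b)%O]].
Proof.
move=> [b0 bS]; rewrite orecE; case: (pselect (b = ozero)) => //= _.
case: pselect => [h|//]; exfalso.
by case: h => c [_ bc]; case: bS; exists c.
Qed.

End OrecEquations.

(* fs a lists the ordinals a_i attached to a > 1. At a limit ordinal the
   convergence of the a_i to a is monotone, but need not be strictly monotone. *)
Definition fundamental_sequences (fs : W -> nat -> W) :=
  forall a, (oone < a)%O ->
    (forall b, a = osucc b -> forall i, fs a i = b) /\
    (olimit a ->
       [/\ forall i j, (i <= j)%N -> (fs a i <= fs a j)%O,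
           forall i, (fs a i < a)%O &
           forall b, (b < a)%O -> exists i, (b < fs a i)%O]).

(* Throughout, i : nat stands for the positive integer i.+1, both as an element
   of a finite set of positive integers and as the index of a sequence. *)
Definition admissible (F : {fset nat}) := forall i, i \in F -> (#|` F| <= i.+1)%N.

Inductive schreier (fs : W -> nat -> W) : W -> {fset nat} -> Prop :=
| Schreier0_empty : schreier fs ozero fset0
| Schreier0_single i : schreier fs ozero [fset i]%fset
| Schreier1 F : admissible F -> schreier fs oone F
| Schreier_union a n (F : nat -> {fset nat}) :
    (oone < a)%O -> (1 <= n)%N ->
    (forall j, (j < n)%N -> schreier fs (fs a j) (F j)) ->
    (forall j i, (j < n)%N -> i \in F j -> (n <= i.+1)%N) ->
    (forall j j' i i', (j < j')%N -> (j' < n)%N ->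
       i \in F j -> i' \in F j' -> (i < i')%N) ->
    schreier fs a (\bigcup_(j <- iota 0 n) F j)%fset.

End Ordinals.

Arguments oomega {W}.

Section Norm.
Variables (R : realType) (W : omega1) (fs : W -> nat -> W) (alpha : W).
Implicit Types (a : nat -> R) (P : {fset nat}).

(* Norm of \sum_i a i * x_i in C(F_alpha), for a finitely supported:
   the function x_i maps F to 1 if i \in F and to 0 otherwise. *)
Definition tnorm0 a : R := sup [set `|\sum_(i <- F) a i| | F in schreier fs alpha].

(* The i-th interval [p_i, p_{i+1}) of the list P = {p_0 < ... < p_{k-1}}, p_k = oo. *)
Definition block P (i : nat) : set nat :=
  let p := nth 0%N (sort leq P) in
  [set n | (p i <= n)%N && ((i.+1 < #|` P|)%N ==> (n < p i.+1)%N)].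

Definition trunc (B : set nat) a : nat -> R := fun n => if n \in B then a n else 0.

Fixpoint tnorm_ (m : nat) a : R :=
  if m is m'.+1 then
    Num.max (tnorm_ m' a)
      (2^-1 * sup [set \sum_(i < #|` P|) tnorm_ m' (trunc (block P i) a)
                  | P in admissible])
  else tnorm0 a.

Definition tnorm a : R := limn (fun m => tnorm_ m a).

(* X with the sequence t is a realization of T_alpha: the span of t is a dense
   isometric copy of the finitely supported sequences. As X is complete, this
   determines X and t up to a unique isometric isomorphism. *)
Definition is_T (X : completeNormedModType R) (t : nat -> X) :=
  (forall (a : nat -> R) (N : nat),
     `|\sum_(i < N) a i *: t i| = tnorm (fun i => if (i < N)%N then a i else 0)) /\
  closure [set x | exists (a : nat -> R) N, x = \sum_(i < N) a i *: t i] = [set: X].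

End Norm.

Section Banach.
Variables (R : realType) (X : completeNormedModType R).

Definition dual_space : set (X -> R) := [set f : X -> R | scalar f /\ continuous f].

Definition dual_norm (f : X -> R) : R := sup [set `|f x| | x in [set x : X | `|x| <= 1]].

(* {ptws X -> R} carries the topology of pointwise convergence, whose trace on
   the dual space is the w^* topology. *)
Definition dual_ball : set {ptws X -> R} :=
  [set f : X -> R | dual_space f /\ dual_norm f <= 1].

Definition reflexive_space :=
  forall Phi : (X -> R) -> R,
    (forall (k : R) (f g : X -> R), dual_space f -> dual_space g ->
       Phi (fun x => k * f x + g x) = k * Phi f + Phi g) ->
    (exists C : R, forall f, dual_space f -> `|Phi f| <= C * dual_norm f) ->
    exists x : X, forall f, dual_space f -> Phi f = f x.

Definition schauder_basis (e : nat -> X) :=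
  forall x : X, exists! a : nat -> R, series (fun n => a n *: e n) @ \oo --> x.

Definition unconditional_basis (e : nat -> X) :=
  schauder_basis e /\
  forall a : nat -> R, cvgn (series (fun n => a n *: e n)) ->
  forall sigma : nat -> nat, bijective sigma ->
    cvgn (series (fun n => a (sigma n) *: e (sigma n))).

Definition closed_subspace (Y : set X) :=
  [/\ closed Y, Y 0 & forall (k : R) (x y : X), Y x -> Y y -> Y (k *: x + y)].

(* Y is isomorphic to the linear space S of sequences normed by N. *)
Definition isomorphic (S : set (nat -> R)) (N : (nat -> R) -> R) (Y : set X) :=
  exists T : (nat -> R) -> X,
    [/\ forall (k : R) (a b : nat -> R), S a -> S b ->
          T (fun n => k * a n + b n) = k *: T a + T b,
        T @` S = Y &
        exists c C : R, [/\ 0 < c, 0 < C &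
          forall a, S a -> c * N a <= `|T a| <= C * N a]].

Definition has_subspace_isomorphic (S : set (nat -> R)) (N : (nat -> R) -> R) :=
  exists Y : set X, closed_subspace Y /\ isomorphic S N Y.

End Banach.

Arguments dual_space {R} X.
Arguments dual_ball {R} X.

Definition ell (R : realType) (p : R) : set (nat -> R) :=
  [set a | cvgn (series (fun n => `|a n| `^ p))].

Definition ell_norm (R : realType) (p : R) (a : nat -> R) : R :=
  limn (series (fun n => `|a n| `^ p)) `^ p^-1.

Definition c0 (R : realType) : set (nat -> R) := [set a | a @ \oo --> (0 : R)].

Definition c0_norm (R : realType) (a : nat -> R) : R := sup (range (fun n => `|a n|)).

Section Oscillation.
Variables (R : realType) (E : topologicalType) (eps : R) (f : nat -> E -> R).

Definition osc_plus (n m : nat) : set E := [set k | f n k - f m k > eps].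
Definition osc_minus (n m : nat) : set E := [set k | f n k - f m k < - eps].

Definition osc_derived (O : set E) : set E :=
  [set k | O k /\ forall U, nbhs k U ->
    exists N, forall n, (N <= n)%N -> exists M,
      (\bigcap_(m in [set m | (M <= m)%N]) osc_plus n m `&` O `&` U) !=set0 \/
      (\bigcap_(m in [set m | (M <= m)%N]) osc_minus n m `&` O `&` U) !=set0].

(* For K a subset of E with the induced topology: the neighborhoods in K are the
   traces of those in E, and the successive sets are contained in K. *)
Definition osc (W : omega1) (K : set E) : W -> set E :=
  orec K osc_derived (fun S => \bigcap_(A in S) A).

End Oscillation.

(* Existence of omega_1 (as the elements with countable initial segment of a
   well-ordering of the power set of nat) and of the spaces T_alpha. *)

Module Existence.

Definition wo : rel (set nat) := projT1 (cid (let (r, h) := well_ordering_principle (set nat) in ex_intro (fun r => well_order r) r h)).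

Lemma wo_min (A : set (set nat)) : A !=set0 ->
  exists z, A z /\ forall y, A y -> wo z y.
Proof.
move=> [x Ax]; rewrite /wo; case: cid => r /= /(_ [pred x | `[< A x >]]) [].
  by exists x; apply/asboolP.
move=> z [[/asboolP Az h] _]; exists z; split=> // y Ay.
by apply: h; apply/asboolP.
Qed.

Lemma wo_uniq (A : set (set nat)) z z' : A z -> A z' ->
  (forall y, A y -> wo z y) -> (forall y, A y -> wo z' y) -> z = z'.
Proof.
move=> Az Az'; rewrite /wo; case: cid => r /= /(_ [pred x | `[< A x >]]) [].
  by exists z; apply/asboolP.
move=> t [_ ht] h h'.
have <- : t = z.
  by apply: ht; split; [apply/asboolP|move=> y /asboolP /h].
by apply: ht; split; [apply/asboolP|move=> y /asboolP /h'].
Qed.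

Lemma wo_total x y : wo x y \/ wo y x.
Proof.
have [|z [[->|->] h]] := @wo_min [set x; y]; first by exists x; left.
  by left; apply: h; right.
by right; apply: h; left.
Qed.

Lemma wo_refl x : wo x x. Proof. by case: (wo_total x x). Qed.

Lemma wo_anti x y : wo x y -> wo y x -> x = y.
Proof.
move=> xy yx; apply: (@wo_uniq [set x; y]); [by left|by right| |];
  by move=> z [->|->] //; exact: wo_refl.
Qed.

Lemma wo_trans y x z : wo x y -> wo y z -> wo x z.
Proof.
move=> xy yz; have [|t [[[]|] -> h]] := @wo_min [set x; y; z].
- by exists x; left; left.
- by apply: h; right.
- have <- : y = x; last exact: yz.
  by apply: wo_anti => //; apply: h; left; left.
- have zx : wo z x by apply: h; left; left.
  have zy : wo z y by apply: h; left; right.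
  have yE := wo_anti yz zy; subst z; have xE := wo_anti xy zx; subst y; exact: xy.
Qed.

Definition seg x : set (set nat) := [set y | wo y x /\ y <> x].
Definition small : {pred set nat} := [pred x | `[< countable (seg x) >]].

Record W := MkW { wval : set nat; _ : wval \in small }.
HB.instance Definition _ := [isSub for wval].
HB.instance Definition _ := [Choice of W by <:].

Definition leW (x y : W) : bool := wo (wval x) (wval y).
Lemma leW_refl : reflexive leW. Proof. by move=> x; exact: wo_refl. Qed.
Lemma leW_anti : antisymmetric leW.
Proof. by move=> x y /andP[h1 h2]; apply/val_inj; exact: wo_anti. Qed.
Lemma leW_trans : transitive leW. Proof. by move=> y x z; exact: wo_trans. Qed.
Lemma leW_total : total leW.
Proof. by move=> x y; apply/orP; exact: wo_total. Qed.

HB.instance Definition _ := Order.Le_isPOrder.Build Order.default_display W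
  leW_refl leW_anti leW_trans.
HB.instance Definition _ := Order.POrder_isTotal.Build Order.default_display W leW_total.

Lemma bottom_ex : exists z : W, forall y : W, leW z y.
Proof.
have [|z [_ h]] := @wo_min setT; first by exists set0.
have sz : z \in small.
  apply/asboolP; have -> : seg z = set0; last exact: countable0.
  apply/seteqP; split=> // y [yz ny]; apply: ny.
  by apply: wo_anti => //; exact: h.
by exists (MkW sz) => y; exact: h.
Qed.

HB.instance Definition _ := Order.hasBottom.Build Order.default_display W
  (projT2 (cid bottom_ex)).

Lemma W_wf : well_founded (fun a b : W => (a < b)%O).
Proof.
move=> a; apply: contrapT => na.
pose A : set (set nat) := [set v | exists2 x : W, ~ Acc (fun a b : W => (a < b)%O) x & wval x = v].
have [|_ [[z nz <-] h]] := @wo_min A; first by exists (wval a), a.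
apply: nz; constructor => y yz; apply: contrapT => ny.
have zy : (z <= y)%O by apply: h; exists y.
by move: yz; rewrite ltNge zy.
Qed.

Lemma W_countable (b : W) : countable [set a : W | (a < b)%O].
Proof.
have /asboolP sb := valP b.
rewrite -(eq_countable (@inj_card_eq _ _ _ wval _)); last first.
  by move=> x y _ _ /val_inj.
apply: sub_countable sb; apply: subset_card_le => _ [x /= + <-].
rewrite lt_neqAle => /andP[/eqP xb xb']; split=> //.
by move=> /val_inj.
Qed.

Lemma set_nat_uncountable : ~ countable [set: set nat].
Proof.
move=> /countable_injP[f /= fi].
pose D : set nat := [set n | exists2 A, f A = n & ~ A n].
have nD : ~ D (f D).
  move=> [A fA nA]; have E : A = D by apply: fi; rewrite ?inE //; exact: Logic.I.
  by apply: (nA); rewrite {1}E; exists A.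
by apply: (nD); exists D.
Qed.

Lemma W_uncountable : ~ countable [set: W].
Proof.
move=> cW.
have cs : countable [set x | x \in small].
  have -> : [set x | x \in small] = wval @` setT.
    apply/seteqP; split=> [x sx|_ [x _ <-]]; last exact: valP.
    by exists (MkW sx).
  exact: sub_countable (card_image_le _ _) cW.
have [H|/existsNP[x0 nx0]] := pselect (forall x, x \in small).
  by apply: set_nat_uncountable; apply: sub_countable cs; apply: subset_card_le => x _; exact: H.
have [|x [/= nx h]] := @wo_min [set x | x \notin small]; first by exists x0; apply/negP.
move: nx => /negP; apply; apply/asboolP.
apply: sub_countable cs; apply: subset_card_le => y [yx nyx] /=.
apply: contrapT => /negP ny; apply: nyx; apply: wo_anti => //; exact: h.
Qed.

Lemma omega1_exists : exists W : omega1, True.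
Proof.
by exists (Omega1 W_wf W_countable W_uncountable).
Qed.

Section Seminorms.
Variable R : realType.
Implicit Types (a b : nat -> R) (p : (nat -> R) -> R).

Definition cut N a : nat -> R := fun i => if (i < N)%N then a i else 0.
Definition supp N a := forall i, (N <= i)%N -> a i = 0.

Record good p : Prop := Good {
  good_ge0 : forall N a, supp N a -> 0 <= p a;
  good_l1 : forall N a, supp N a -> p a <= \sum_(i < N) `|a i|;
  goodD : forall N a b, supp N a -> supp N b -> p (fun i => a i + b i) <= p a + p b;
  goodZ : forall N (k : R) a, supp N a -> p (fun i => k * a i) <= `|k| * p a;
  good_cut : forall N M a, supp N a -> p (cut M a) <= p a }.

Lemma supp_cut N a : supp N (cut N a).
Proof. by move=> i Ni; rewrite /cut ltnNge Ni. Qed.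

Lemma supp_cut2 N M a : supp N a -> supp N (cut M a).
Proof. by move=> h i Ni; rewrite /cut h // if_same. Qed.

Lemma suppD N a b : supp N a -> supp N b -> supp N (fun i => a i + b i).
Proof. by move=> ha hb i Ni; rewrite ha // hb // addr0. Qed.

Lemma suppZ N k a : supp N a -> supp N (fun i => k * a i).
Proof. by move=> ha i Ni; rewrite ha // mulr0. Qed.

Lemma supp_trunc N B a : supp N a -> supp N (trunc B a).
Proof. by move=> h i Ni; rewrite /trunc h // if_same. Qed.

Lemma sup_leE (I : Type) (A : set I) (f : I -> R) C :
  A !=set0 -> (forall x, A x -> f x <= C) -> sup [set f x | x in A] <= C.
Proof.
move=> [x0 Ax0] h; apply: ge_sup; first by exists (f x0), x0.
by move=> _ [x Ax <-]; exact: h.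
Qed.

Lemma le_supE (I : Type) (A : set I) (f : I -> R) C x :
  (forall x, A x -> f x <= C) -> A x -> f x <= sup [set f x | x in A].
Proof.
move=> h Ax; apply: ub_le_sup; last by exists x.
by exists C => _ [y Ay <-]; exact: h.
Qed.

Lemma good_sup (I : Type) (A : set I) (h : I -> (nat -> R) -> R) :
  A !=set0 ->
  (forall x N a, A x -> supp N a -> 0 <= h x a <= \sum_(i < N) `|a i|) ->
  (forall x N a b, A x -> supp N a -> supp N b ->
     h x (fun i => a i + b i) <= h x a + h x b) ->
  (forall x N (k : R) a, A x -> supp N a -> h x (fun i => k * a i) <= `|k| * h x a) ->
  (forall x N M a, A x -> supp N a -> exists2 y, A y & h x (cut M a) <= h y a) ->
  good (fun a => sup [set h x a | x in A]).
Proof.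
move=> A0 h1 hD hZ hT.
have le N a x : supp N a -> A x -> h x a <= sup [set h x a | x in A].
  move=> sa; apply: (@le_supE _ _ (h^~ a) (\sum_(i < N) `|a i|)) => y Ay.
  by have /andP[] := h1 y N a Ay sa.
split.
- move=> N a sa; have [x Ax] := A0.
  by apply: le_trans (le N a x sa Ax); have /andP[] := h1 x N a Ax sa.
- by move=> N a sa; apply: sup_leE => // x Ax; have /andP[] := h1 x N a Ax sa.
- move=> N a b sa sb; apply: sup_leE => // x Ax; apply: le_trans (hD x N a b Ax sa sb) _.
  by apply: lerD; exact: (le N).
- move=> N k a sa; apply: sup_leE => // x Ax; apply: le_trans (hZ x N k a Ax sa) _.
  by apply: ler_wpM2l => //; exact: (le N).
- move=> N M a sa; apply: sup_leE => // x Ax; have [y Ay] := hT x N M a Ax sa.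
  by move=> /le_trans; apply; exact: (le N).
Qed.

Lemma l1_ge0 N a : 0 <= \sum_(i < N) `|a i|.
Proof. by apply: sumr_ge0. Qed.

Lemma good_max p q : good p -> good q -> good (fun a => Num.max (p a) (q a)).
Proof.
move=> [p0 p1 pD pZ pT] [q0 q1 qD qZ qT]; split.
- by move=> N a sa; rewrite le_max (p0 N).
- by move=> N a sa; rewrite ge_max p1 // q1.
- move=> N a b sa sb; rewrite ge_max; apply/andP; split.
    by apply: le_trans (pD N _ _ sa sb) _; apply: lerD; rewrite le_max lexx.
  by apply: le_trans (qD N _ _ sa sb) _; apply: lerD; rewrite le_max lexx orbT.
- move=> N k a sa; rewrite ge_max; apply/andP; split.
    by apply: le_trans (pZ N _ _ sa) _; apply: ler_wpM2l => //; rewrite le_max lexx.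
  by apply: le_trans (qZ N _ _ sa) _; apply: ler_wpM2l => //; rewrite le_max lexx orbT.
- move=> N M a sa; rewrite ge_max !le_max (pT N) //= (qT N) //= orbT //.
Qed.

Lemma good_half p : good p -> good (fun a => 2^-1 * p a).
Proof.
move=> [p0 p1 pD pZ pT]; split.
- by move=> N a sa; rewrite mulr_ge0 // (p0 N).
- move=> N a sa; have := p1 N a sa; have := p0 N a sa; lra.
- by move=> N a b sa sb; have := pD N a b sa sb; lra.
- by move=> N k a sa; rewrite mulrCA; apply: ler_wpM2l => //; exact: (pZ N).
- by move=> N M a sa; apply: ler_wpM2l => //; exact: (pT N).
Qed.

Lemma block_uniq (P : {fset nat}) i j n :
  (i < j)%N -> (j < #|` P|)%N -> block P i n -> block P j n -> False.
Proof.
move=> ij jP /andP[_]; rewrite (leq_ltn_trans ij jP) /= => h1 /andP[h2 _].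
have : (nth 0 (sort leq P) i.+1 <= nth 0 (sort leq P) j)%N.
  apply: (@sorted_leq_nth _ leq leq_trans leqnn) => //.
  - exact: (sort_sorted leq_total).
  - by rewrite inE size_sort (leq_ltn_trans ij jP).
  - by rewrite inE size_sort.
move=> h; move: (leq_trans h1 h); rewrite ltnNge.
by rewrite h2.
Qed.

Lemma sum_trunc (P : {fset nat}) a n :
  \sum_(i < #|` P|) `|trunc (block P i) a n| <= `|a n|.
Proof.
have [[i Pi]|H] := pselect (exists i : 'I_(#|` P|), block P i n).
  rewrite (bigD1 i) //= big1 ?addr0.
    by rewrite /trunc; case: ifP; rewrite ?normr0.
  move=> j ji; rewrite /trunc; case: ifPn; rewrite ?normr0 // => /set_mem Pj; exfalso.
  case: (ltngtP i j) => [ij|ij|/val_inj ij]; last by rewrite ij eqxx in ji.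
    exact: (block_uniq ij _ Pi Pj).
  exact: (block_uniq ij _ Pj Pi).
rewrite big1 // => i _; rewrite /trunc; case: ifPn; rewrite ?normr0 // => /set_mem Pi.
by exfalso; apply: H; exists i.
Qed.

Lemma good_step p : good p ->
  good (fun a => sup [set \sum_(i < #|` P|) p (trunc (block P i) a) | P in admissible]).
Proof.
move=> [p0 p1 pD pZ pT].
apply: (@good_sup _ admissible
  (fun P a => \sum_(i < #|` P|) p (trunc (block P i) a))).
- by exists fset0 => i; rewrite inE.
- move=> P N a _ sa; apply/andP; split.
    by apply: sumr_ge0 => i _; apply: (p0 N); exact: supp_trunc.
  apply: (@le_trans _ _ (\sum_(i < #|` P|) \sum_(n < N) `|trunc (block P i) a n|)).
    by apply: ler_sum => i _; apply: p1; exact: supp_trunc.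
  by rewrite exchange_big /=; apply: ler_sum => n _; exact: sum_trunc.
- move=> P N a b _ sa sb; rewrite -big_split /=; apply: ler_sum => i _.
  have -> : trunc (block P i) (fun i => a i + b i) =
     (fun n => trunc (block P i) a n + trunc (block P i) b n).
    by apply/funext => n; rewrite /trunc; case: ifP; rewrite // addr0.
  by apply: (pD N); exact: supp_trunc.
- move=> P N k a _ sa; rewrite mulr_sumr; apply: ler_sum => i _.
  have -> : trunc (block P i) (fun i => k * a i) = (fun n => k * trunc (block P i) a n).
    by apply/funext => n; rewrite /trunc; case: ifP; rewrite // mulr0.
  by apply: (pZ N); exact: supp_trunc.
- move=> P N M a aP sa; exists P => //; apply: ler_sum => i _.
  have -> : trunc (block P i) (cut M a) = cut M (trunc (block P i) a).
    by apply/funext => n; rewrite /trunc /cut; do 2 case: ifP.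
  by apply: (pT N); exact: supp_trunc.
Qed.

End Seminorms.

Section Schreier.
Variables (R : realType) (W : omega1) (fs : W -> nat -> W).
Hypothesis hfs : fundamental_sequences fs.

Lemma fs_lt a i : (oone W < a)%O -> (fs a i < a)%O.
Proof.
move=> a1; have [h1 h2] := hfs a1.
have [[b ab]|H] := pselect (exists b, a = osucc b).
  by rewrite (h1 b ab) ab; exact: (proj1 (osuccP b)).
have la : olimit a.
  split=> // a0; move: a1; rewrite a0 ltNge.
  by rewrite (le0x (oone W)).
by have [] := h2 la.
Qed.

Lemma ocases a : [\/ a = ozero W, a = oone W | (oone W < a)%O].
Proof.
have [->|a0] := eqVneq a (ozero W); first by constructor 1.
have : (oone W <= a)%O by apply: (proj2 (osuccP (ozero W))); rewrite lt0x.
by rewrite le_eqVlt => /orP[/eqP <-|?]; [constructor 2 | constructor 3].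
Qed.

Lemma schreier_bigcup1 a F : (oone W < a)%O -> schreier fs (fs a 0) F -> schreier fs a F.
Proof.
move=> a1 h; have -> : F = (\bigcup_(j <- iota 0 1) (fun _ : nat => F) j)%fset.
  by rewrite big_cons big_nil fsetU0.
apply: Schreier_union => //; first by case.
by move=> j j' i i' jj' j'1; lia.
Qed.

Lemma schreier_empty a : schreier fs a fset0.
Proof.
elim/(well_founded_ind (@omega1_wf W)): a => a IH.
case: (ocases a) => [->|->|a1]; first exact: Schreier0_empty.
  by apply: Schreier1 => i; rewrite inE.
by apply: schreier_bigcup1 => //; apply: IH; exact: fs_lt.
Qed.

Lemma schreier_single a i : schreier fs a [fset i]%fset.
Proof.
elim/(well_founded_ind (@omega1_wf W)): a => a IH.
case: (ocases a) => [->|->|a1]; first exact: Schreier0_single.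
  by apply: Schreier1 => j _; rewrite cardfs1.
by apply: schreier_bigcup1 => //; apply: IH; exact: fs_lt.
Qed.

Definition fcut M (F : {fset nat}) : {fset nat} := [fset i in F | (i < M)%N]%fset.

Lemma in_fcut M F i : (i \in fcut M F) = (i \in F) && (i < M)%N.
Proof. by rewrite !inE. Qed.

Lemma schreier_cut a F M : schreier fs a F -> schreier fs a (fcut M F).
Proof.
elim=> {a F} [|i|F aF|a n F a1 n1 _ IH h1 h2].
- have -> : fcut M fset0 = fset0 by apply/fsetP => i; rewrite !inE.
  exact: Schreier0_empty.
- case: (ltnP i M) => iM.
    have -> : fcut M [fset i]%fset = [fset i]%fset; last exact: Schreier0_single.
    by apply/fsetP => j; rewrite !inE; case: eqP => // ->.
  have -> : fcut M [fset i]%fset = fset0; last exact: Schreier0_empty.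
  by apply/fsetP => j; rewrite !inE; case: eqP => // ->; rewrite ltnNge iM.
- apply: Schreier1 => i; rewrite in_fcut => /andP[iF _].
  apply: leq_trans (aF i iF); apply: fsubset_leq_card.
  by apply/fsubsetP => j; rewrite in_fcut => /andP[].
- have -> : fcut M (\bigcup_(j <- iota 0 n) F j)%fset =
            (\bigcup_(j <- iota 0 n) (fun j => fcut M (F j)) j)%fset.
    apply/fsetP => i; rewrite in_fcut; apply/andP/bigfcupP => [[/bigfcupP[j jn ij] iM]|[j jn]].
      by exists j => //; rewrite in_fcut ij.
    by rewrite in_fcut => /andP[ij iM]; split=> //; apply/bigfcupP; exists j.
  apply: Schreier_union => //.
    by move=> j i jn; rewrite in_fcut => /andP[ij _]; exact: (h1 j).
  by move=> j j' i i' jj' j'n; rewrite !in_fcut => /andP[ij _] /andP[ij' _]; exact: (h2 j j').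
Qed.

Lemma fset_sum_le N (F : {fset nat}) (a : nat -> R) : supp N a ->
  \sum_(i <- F) `|a i| <= \sum_(i < N) `|a i|.
Proof.
move=> sa; rewrite -(big_mkord xpredT (fun i => `|a i|)).
rewrite (bigID (fun i => (i < N)%N)) /= [X in _ + X]big1 ?addr0; last first.
  by move=> i; rewrite -leqNgt => Ni; rewrite sa // normr0.
rewrite -big_filter; set s := [seq _ <- _ | _].
have us : uniq s by rewrite filter_uniq // fset_uniq.
rewrite [X in _ <= X](bigID (mem s)) /= -[X in _ <= X + _]big_filter.
have /(perm_big _) -> /= : perm_eq s [seq i <- index_iota 0 N | i \in s].
  apply: uniq_perm => //; first by rewrite filter_uniq // iota_uniq.
  by move=> i; rewrite !mem_filter mem_index_iota /=; case: (i < N)%N; rewrite ?andbF ?andbT.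
by rewrite lerDl sumr_ge0.
Qed.

Variable alpha : W.

Lemma good_tnorm0 : good (@tnorm0 R W fs alpha).
Proof.
apply: (@good_sup R _ (schreier fs alpha) (fun F a => `|\sum_(i <- F) a i|)).
- by exists fset0; exact: schreier_empty.
- move=> F N a _ sa; rewrite normr_ge0 /=; apply: le_trans (ler_norm_sum _ _ _) _.
  exact: fset_sum_le.
- by move=> F N a b _ _ _; rewrite big_split /=; exact: ler_normD.
- by move=> F N k a _ _; rewrite -mulr_sumr normrM.
- move=> F N M a sF sa; exists (fcut M F); first exact: schreier_cut.
  rewrite le_eqVlt; apply/orP; left; apply/eqP; congr `|_|.
  rewrite /cut -big_mkcond /= -big_filter; apply: perm_big; apply: uniq_perm.
  - by rewrite filter_uniq // fset_uniq.
  - exact: fset_uniq.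
  - by move=> i; rewrite mem_filter in_fcut andbC.
Qed.

Lemma good_tnorm_ m : good (@tnorm_ R W fs alpha m).
Proof.
elim: m => [|m IH]; first exact: good_tnorm0.
by apply: good_max => //; apply: good_half; exact: good_step.
Qed.

Lemma tnorm_cvg N (a : nat -> R) : supp N a ->
  (forall m, tnorm_ fs alpha m a <= tnorm fs alpha a) /\
  (forall C, (forall m, tnorm_ fs alpha m a <= C) -> tnorm fs alpha a <= C).
Proof.
move=> sa.
have nd : nondecreasing_seq (fun m => tnorm_ fs alpha m a).
  by apply/nondecreasing_seqP => m /=; rewrite le_max lexx.
have cv : cvgn (fun m => tnorm_ fs alpha m a).
  apply: nondecreasing_is_cvgn => //; exists (\sum_(i < N) `|a i|) => _ [m _ <-].
  exact: (good_l1 (good_tnorm_ m)).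
split=> [m|C hC]; first exact: nondecreasing_cvgn_le.
by apply: limr_le => //; near=> m; exact: hC.
Unshelve. all: by end_near. Qed.

Lemma good_tnorm : good (@tnorm R W fs alpha).
Proof.
split.
- move=> N a sa; apply: le_trans (proj1 (tnorm_cvg sa) 0%N).
  exact: (good_ge0 (good_tnorm_ 0) sa).
- by move=> N a sa; apply: (proj2 (tnorm_cvg sa)) => m; exact: (good_l1 (good_tnorm_ m)).
- move=> N a b sa sb; apply: (proj2 (tnorm_cvg (suppD sa sb))) => m.
  apply: le_trans (goodD (good_tnorm_ m) sa sb) _.
  by apply: lerD; [exact: (proj1 (tnorm_cvg sa))|exact: (proj1 (tnorm_cvg sb))].
- move=> N k a sa; apply: (proj2 (tnorm_cvg (suppZ k sa))) => m.
  apply: le_trans (goodZ (good_tnorm_ m) k sa) _.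
  by apply: ler_wpM2l => //; exact: (proj1 (tnorm_cvg sa)).
- move=> N M a sa; apply: (proj2 (tnorm_cvg (supp_cut2 M sa))) => m.
  apply: le_trans (good_cut (good_tnorm_ m) M sa) _.
  exact: (proj1 (tnorm_cvg sa)).
Qed.

Lemma tnorm_coord N (a : nat -> R) i : supp N a -> `|a i| <= tnorm fs alpha a.
Proof.
move=> sa; apply: le_trans (proj1 (tnorm_cvg sa) 0%N).
have := @le_supE R _ (schreier fs alpha) (fun F => `|\sum_(i <- F) a i|)
   (\sum_(i < N) `|a i|) [fset i]%fset.
rewrite big_seq_fset1; apply; last exact: schreier_single.
by move=> F _; apply: le_trans (ler_norm_sum _ _ _) _; exact: fset_sum_le.
Qed.

End Schreier.

Record fsnorm (R : realType) := FsNorm {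
  fsnorm_fun :> (nat -> R) -> R;
  fsnorm_good : good fsnorm_fun;
  fsnorm_coord : forall N (a : nat -> R) i, supp N a -> `|a i| <= fsnorm_fun a }.

Section Completion.
Variables (R : realType) (q : fsnorm R).
Implicit Types a b : nat -> R^o.

Let gq := fsnorm_good q.

Definition tl N a : nat -> R^o := fun i => if (i < N)%N then 0 else a i.
Definition inX a := forall e, 0 < e -> exists N, forall M, q (cut M (tl N a)) <= e.

Let qD M a b : q (cut M (a + b)) <= q (cut M a) + q (cut M b).
Proof.
have -> : cut M (a + b) = (fun i => cut M a i + cut M b i).
  by apply/funext => i; rewrite /cut; case: ifP; rewrite ?addr0.
by apply: (goodD gq); exact: supp_cut.
Qed.

Let qZ M k a : q (cut M (k *: a)) <= `|k| * q (cut M a).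
Proof.
have -> : cut M (k *: a) = (fun i => k * cut M a i).
  by apply/funext => i; rewrite /cut; case: ifP; rewrite ?mulr0.
by apply: (goodZ gq); exact: supp_cut.
Qed.

Let qN M a : q (cut M (- a)) <= q (cut M a).
Proof. by rewrite -scaleN1r; have := qZ M (- 1) a; rewrite normrN normr1 mul1r. Qed.

Let qB M a b : q (cut M (a - b)) <= q (cut M a) + q (cut M b).
Proof. by apply: le_trans (qD _ _ _) _; rewrite lerD2l qN. Qed.

Let q0 M a : 0 <= q (cut M a).
Proof. by apply: (good_ge0 gq (supp_cut _)). Qed.

Let qcut N M a : q (cut M (cut N a)) <= q (cut M a).
Proof.
have -> : cut M (cut N a) = cut N (cut M a).
  by apply/funext => i; rewrite /cut; do 2 case: ifP.
exact: (good_cut gq N (supp_cut _)).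
Qed.

Let qcut' N M a : q (cut M (cut N a)) <= q (cut N a).
Proof. exact: (good_cut gq M (supp_cut _)). Qed.

Let tlE N a : tl N a = a - cut N a.
Proof.
by apply/funext => i; rewrite /tl /cut !fctE; case: ifP; rewrite ?subrr ?subr0.
Qed.

Let q_tl N M a : q (cut M (tl N a)) <= 2 * q (cut M a).
Proof. by rewrite tlE; apply: le_trans (qB _ _ _) _; have := qcut N M a; lra. Qed.

Let inX_ge a : inX a -> forall e, 0 < e ->
  exists N, forall N' M, (N <= N')%N -> q (cut M (tl N' a)) <= e.
Proof.
move=> h e e0; have [|N hN] := h (e / 2); first by lra.
exists N => N' M NN'.
have -> : tl N' a = tl N' (tl N a).
  apply/funext => i; rewrite /tl; case: ifPn => //; rewrite -leqNgt => h'.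
  by rewrite ltnNge (leq_trans NN' h').
by apply: le_trans (q_tl _ _ _) _; have := hN M; lra.
Qed.

Definition inXp : {pred nat -> R^o} := [pred a | `[< inX a >]].

Let tlD N a b : tl N (a + b) = tl N a + tl N b.
Proof. by apply/funext => i; rewrite /tl !fctE; case: ifP; rewrite ?addr0. Qed.
Let tlZ N k a : tl N (k *: a) = k *: tl N a.
Proof. by apply/funext => i; rewrite /tl !fctE; case: ifP; rewrite ?scaler0. Qed.

Lemma inX_submod : submod_closed inXp.
Proof.
split.
  apply/asboolP => e e0; exists 0%N => M.
  have -> : tl 0 0 = 0 *: (0 : nat -> R^o) by rewrite scale0r; apply/funext.
  by apply: le_trans (qZ _ _ _) _; rewrite normr0 mul0r ltW.
move=> k a b /asboolP ha /asboolP hb; apply/asboolP => e e0.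
have k0 : 0 < 1 + `|k| by have := normr_ge0 k; lra.
have e1 : 0 < e / 2 / (1 + `|k|) by rewrite divr_gt0 // divr_gt0.
have [N1 h1] := inX_ge ha e1; have e2 : 0 < e / 2 by lra.
have [N2 h2] := inX_ge hb e2.
exists (maxn N1 N2) => M; rewrite tlD tlZ; apply: le_trans (qD _ _ _) _.
have {}h1 := h1 (maxn N1 N2) M (leq_maxl _ _).
have {}h2 := h2 (maxn N1 N2) M (leq_maxr _ _).
suff : q (cut M (k *: tl (maxn N1 N2) a)) <= e / 2 by lra.
apply: le_trans (qZ _ _ _) _; apply: (@le_trans _ _ ((1 + `|k|) * (e / 2 / (1 + `|k|)))).
  apply: ler_pM => //; lra.
by rewrite mulrC divfK // gt_eqF.
Qed.

HB.instance Definition _ := GRing.isSubmodClosed.Build R (nat -> R^o) inXp inX_submod.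

Record seqspace := SeqSpace { seqval : nat -> R^o; _ : seqval \in inXp }.

HB.instance Definition _ := [isSub for seqval].
HB.instance Definition _ := [Choice of seqspace by <:].
HB.instance Definition _ := [SubChoice_isSubLmodule of seqspace by <:].

Implicit Types x y : seqspace.

Definition seqnorm x : R := sup (range (fun M => q (cut M (seqval x)))).

Let seqP x : inX (seqval x).
Proof. by case: x => a /= /asboolP. Qed.

Let seq_bounded x : exists C, forall M, q (cut M (seqval x)) <= C.
Proof.
have [N hN] := seqP x (e := 1) ltr01.
exists (1 + q (cut N (seqval x))) => M.
have E : seqval x = tl N (seqval x) + cut N (seqval x) by rewrite tlE subrK.
rewrite {1}E; apply: le_trans (qD _ _ _) _.
by apply: lerD; [exact: hN | exact: qcut'].
Qed.

Lemma le_seqnorm x M : q (cut M (seqval x)) <= seqnorm x.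
Proof.
have [C hC] := seq_bounded x.
by apply: (@le_supE R _ setT (fun M => q (cut M (seqval x))) C).
Qed.

Lemma seqnorm_le x C : (forall M, q (cut M (seqval x)) <= C) -> seqnorm x <= C.
Proof. by move=> h; apply: sup_leE => //; exists 0%N. Qed.

Lemma seqnormD x y : seqnorm (x + y) <= seqnorm x + seqnorm y.
Proof.
apply: seqnorm_le => M; apply: le_trans (qD M (seqval x) (seqval y)) _.
by apply: lerD; exact: le_seqnorm.
Qed.

Let seqnormZ_le k x : seqnorm (k *: x) <= `|k| * seqnorm x.
Proof.
apply: seqnorm_le => M; apply: le_trans (qZ M k (seqval x)) _.
by apply: ler_wpM2l => //; exact: le_seqnorm.
Qed.

Let seqnorm_ge0 x : 0 <= seqnorm x.
Proof. by apply: le_trans (le_seqnorm x 0). Qed.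

Lemma seqnormZ k x : seqnorm (k *: x) = `|k| * seqnorm x.
Proof.
apply/eqP; rewrite eq_le seqnormZ_le /=.
have [->|k0] := eqVneq k 0; first by rewrite normr0 mul0r.
rewrite -{1}(scalerK k0 x).
apply: le_trans (ler_wpM2l (normr_ge0 k) (seqnormZ_le k^-1 (k *: x))) _.
by rewrite mulrA -normrM divff // normr1 mul1r.
Qed.

Let coord_le x i : `|seqval x i| <= seqnorm x.
Proof.
apply: le_trans (le_seqnorm x i.+1).
have -> : seqval x i = cut i.+1 (seqval x) i by rewrite /cut leqnn.
by apply: (@fsnorm_coord R q i.+1); exact: supp_cut.
Qed.

Lemma seqnorm_eq0 x : seqnorm x = 0 -> x = 0.
Proof.
move=> x0; apply/val_inj/funext => i; apply/normr0_eq0/eqP.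
by rewrite eq_le normr_ge0 andbT -x0; exact: coord_le.
Qed.

HB.instance Definition _ :=
  Lmodule_isNormed.Build R seqspace seqnormD seqnormZ seqnorm_eq0.

Lemma seqspace_complete (F : set_system seqspace) : ProperFilter F -> cauchy F -> cvg F.
Proof.
move=> FF /cauchyP Fc.
have Fx e : 0 < e -> exists x, F [set y | seqnorm (x - y) <= e].
  move=> e0; have [x hx] := Fc e e0; exists x.
  apply: filterS hx => y; rewrite -ball_normE /ball_ /= => h; exact: ltW.
have cvgi i : cvg ((fun x => seqval x i : R^o) @ F).
  apply/cauchy_cvgP/cauchy_exP => e e0.
  have [|x hx] := Fx (e / 2); first by lra.
  exists (seqval x i).
  suff : F [set y | `|seqval x i - seqval y i| < e] by [].
  apply: filterS hx => y /= h.
  apply: le_lt_trans (coord_le (x - y) i) _; lra.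
pose a : nat -> R^o := fun i => lim ((fun x => seqval x i : R^o) @ F).
have near_a e x : 0 < e -> F [set y | seqnorm (x - y) <= e] ->
    forall M, q (cut M (a - seqval x)) <= 2 * e.
  move=> e0 hx M.
  have e1 : 0 < e / M.+1%:R by rewrite divr_gt0 // ltr0n.
  have : F [set y | forall i : 'I_M, `|a i - seqval y i| <= e / M.+1%:R].
    apply: filter_forall => i.
    by have /cvgrPdist_le/(_ _ e1) := cvgi i.
  move=> /(filterI hx)/filter_ex[y [/= h1 h2]].
  have -> : a - seqval x = (a - seqval y) - (seqval (x - y)).
    have -> : seqval (x - y) = seqval x - seqval y by [].
    by rewrite opprB addrA subrK.
  apply: le_trans (qB _ _ _) _.
  suff : q (cut M (a - seqval y)) <= e by have := le_seqnorm (x - y) M; lra.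
  apply: le_trans (good_l1 gq (supp_cut _)) _.
  apply: (@le_trans _ _ (\sum_(i < M) e / M.+1%:R)).
    by apply: ler_sum => i _; rewrite /cut ltn_ord; exact: h2.
  rewrite sumr_const card_ord -[_ *+ M]mulr_natr -mulrA ger_pMr // mulrC ler_pdivrMr ?ltr0n //.
  by rewrite mul1r ler_nat.
have aX : a \in inXp.
  apply/asboolP => e e0; have [|x hx] := Fx (e / 5); first by lra.
  have hM := near_a _ x _ hx.
  have [|N hN] := seqP x (e := e / 5); first by lra.
  exists N => M; rewrite -(subrK (seqval x) a) tlD; apply: le_trans (qD _ _ _) _.
  have e5 : 0 < e / 5 by lra.
  have := hM e5 M; have := hN M; have := q_tl N M (a - seqval x); lra.
pose x0 := SeqSpace aX.
apply/cvg_ex; exists x0; apply/cvgrPdist_le => e e0.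
have e5 : 0 < e / 3 by lra.
have [x hx] := Fx _ e5; have hM := near_a _ x e5 hx.
apply: filterS hx => y /= h.
rewrite -[x0 - y](subrKA x); apply: le_trans (seqnormD _ _) _.
have : seqnorm (x0 - x) <= 2 * (e / 3) by apply: seqnorm_le => M; exact: hM.
lra.
Qed.

HB.instance Definition _ := Uniform_isComplete.Build seqspace seqspace_complete.

End Completion.

Lemma seqspace_dense (R : realType) (q : fsnorm R) :
  exists t : nat -> seqspace q,
  (forall (a : nat -> R) (N : nat), `|\sum_(i < N) a i *: t i| = q (cut N a)) /\
  closure [set x | exists (a : nat -> R) N, x = \sum_(i < N) a i *: t i]
    = [set: seqspace q].
Proof.
pose u n : nat -> R^o := fun i => (i == n)%:R.
have uX n : u n \in inXp q.
  apply/asboolP => e e0; exists n.+1 => M.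
  have s0 : supp 0 (cut M (tl n.+1 (u n))).
    move=> i _; rewrite /cut /tl /u; case: ifP => // _; case: ltnP => // ni.
    by rewrite gtn_eqF.
  by apply: le_trans (good_l1 (fsnorm_good q) s0) _; rewrite big_ord0 ltW.
pose t n := SeqSpace (uX n).
have sv (a : nat -> R) N : seqval (\sum_(i < N) a i *: t i) = cut N a.
  elim: N => [|N IH]; first by rewrite big_ord0; apply/funext.
  rewrite big_ord_recr.
  transitivity (seqval (\sum_(i < N) a i *: t i) + a N *: u N); first by [].
  rewrite IH; apply/funext => i; rewrite /cut /u !fctE ltnS.
  case: (ltngtP i N) => [iN|iN|->] /=.
  - by rewrite scaler0 addr0.
  - by rewrite scaler0 addr0.
  - by rewrite add0r /GRing.scale /= mulr1.
have cc M N (a : nat -> R) : q (cut M (cut N a)) <= q (cut N a).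
  exact: (good_cut (fsnorm_good q) M (@supp_cut _ N a)).
exists t; split=> [a N|].
  have nE : `|\sum_(i < N) a i *: t i| = seqnorm (\sum_(i < N) a i *: t i) by [].
  rewrite nE; apply/eqP; rewrite eq_le; apply/andP; split.
    by apply: seqnorm_le => M; rewrite sv; exact: cc.
  have := le_seqnorm (\sum_(i < N) a i *: t i) N; rewrite sv.
  have -> // : cut N (cut N a) = cut N a.
  by apply/funext => i; rewrite /cut; case: (i < N)%N.
apply/seteqP; split=> // x _ U /nbhs_ballP[e /= e0 eU].
have [|N hN] := (asboolW (valP x) : inX q (seqval x)) (e / 2); first by lra.
exists (\sum_(i < N) seqval x i *: t i); split; first by exists (seqval x), N.
apply: eU; rewrite -ball_normE /ball_ /=.
set y := \sum_(i < N) _.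
have nE : `|x - y| = seqnorm (x - y) by [].
have : seqnorm (x - y) <= e / 2; last by rewrite nE; lra.
apply: seqnorm_le => M.
have -> : seqval (x - y) = tl N (seqval x); last exact: hN.
have -> : seqval (x - y) = seqval x - seqval y by [].
rewrite sv; apply/funext => i; rewrite !fctE /tl /cut.
by case: ifP; rewrite ?subrr ?subr0.
Qed.

Lemma is_T_exists (R : realType) (W : omega1) (fs : W -> nat -> W)
    (hfs : fundamental_sequences fs) (alpha : W) :
  exists (X : completeNormedModType R) (t : nat -> X), is_T fs alpha t.
Proof.
pose q := FsNorm (good_tnorm R hfs alpha) (tnorm_coord hfs alpha).
exists (seqspace q).
exact: (seqspace_dense q).
Qed.

End Existence.

(* Main.v *)
Require Import Defs.
From mathcomp Require Import all_boot all_order all_algebra finmap.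
From mathcomp Require Import all_classical all_reals all_analysis.
From mathcomp Require Import ring lra zify.

(** The norm of [T_alpha] combines the recursion of Tsirelson's space with the norm of
    [C(F_alpha)], and the theorem rests on two properties of successive vectors.

    - Lower estimate ([successive_lower]): if [n] vectors with successive supports start far
      enough to the right, their sum has at least half the sum of their norms.
    - Small convex combinations ([far_small]): a convex set of vectors of bounded norm that
      contains vectors supported arbitrarily far to the right contains vectors of arbitrarily
      small norm, again arbitrarily far to the right.

    The second property has two sources.  For the norm of [C(F_alpha)] it holds since [F_alpha]
    is a countable compact space of finite sets, and is proved by induction on [alpha] in
    [far_small_schreier].  For the recursive part it is the argument by which Figiel and Johnson
    show that Tsirelson's space has no copy of [ell 1]: take a vector [x], and the average [y]
    of very many vectors after it; an admissible family that sees [x] has too few blocks to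
    cut many of the vectors in [y], so [(x + y) / 2] has norm at most 7/8 of the bound of the
    set ([far_contract]).  One iterates.

    As the families [F_alpha] are hereditary, erasing coordinates does not increase the norm, and
    the [t n] form an unconditional basis.  By the lower estimate this basis is boundedly complete,
    and by the second property it is shrinking, since a functional that does not tend to 0 on the
    tails is bounded below on a convex set of bounded vectors arbitrarily far away.  By James'
    argument the space is reflexive ([space_reflexive]).  In a copy of [c0] or [ell p], [p > 1],
    the images of the unit vectors are almost successive along a subsequence, and sums of
    [k] of them have norm [o(k)], against the lower estimate ([sublinear_absurd]).  In a copy of
    [ell 1] two convex combinations of images of unit vectors with disjoint indices would be
    arbitrarily close, by the second property ([ell1_absurd]).

    For the oscillation index, each [F] in [F_alpha] gives the functional of norm at most 1 that
    adds up the coordinates in [F].  The functionals of [F `|` [fset n]] tend to that of [F] while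
    [t n] jumps by 1, so [F] survives one derivative more than these sets do for large [n]; the
    families are built so that the empty set survives [w^alpha] derivatives ([osc_schreier]). *)

Set Implicit Arguments.
Unset Strict Implicit.
Unset Printing Implicit Defensive.

Import Order.TTheory GRing.Theory Num.Theory.
Import numFieldNormedType.Exports.
Import Existence.

Local Open Scope classical_set_scope.
Local Open Scope ring_scope.

(** * Schreier families *)

Section SchreierFamilies.
Variables (W : omega1) (fs : W -> nat -> W).
Hypothesis hfs : fundamental_sequences fs.
Implicit Types (a : W) (F : {fset nat}).

Lemma schreier_filter a F (p : pred nat) :
  schreier fs a F -> schreier fs a [fset i in F | p i]%fset.
Proof.
elim=> {a F} [|i|F aF|a n F a1 n1 _ IH h1 h2].
- have -> : [fset i in fset0 | p i]%fset = fset0 by apply/fsetP => i; rewrite !inE.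
  exact: Schreier0_empty.
- case: (boolP (p i)) => pi.
    have -> : [fset j in [fset i] | p j]%fset = [fset i]%fset; last exact: Schreier0_single.
    by apply/fsetP => j; rewrite !inE; case: eqP => // ->.
  have -> : [fset j in [fset i] | p j]%fset = fset0; last exact: Schreier0_empty.
  by apply/fsetP => j; rewrite !inE; case: eqP => // ->; rewrite (negbTE pi).
- apply: Schreier1 => i; rewrite !inE => /andP[iF _].
  apply: leq_trans (aF i iF); apply: fsubset_leq_card.
  by apply/fsubsetP => j; rewrite !inE => /andP[].
- have -> : [fset i in (\bigcup_(j <- iota 0 n) F j) | p i]%fset =
            (\bigcup_(j <- iota 0 n) (fun j => [fset i in F j | p i]) j)%fset.
    apply/fsetP => i; rewrite !inE; apply/andP/bigfcupP => [[/bigfcupP[j jn ij] iM]|[j jn]].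
      by exists j => //; rewrite !inE ij.
    by rewrite !inE => /andP[ij iM]; split=> //; apply/bigfcupP; exists j.
  apply: Schreier_union => //.
    by move=> j i jn; rewrite !inE => /andP[ij _]; exact: (h1 j).
  by move=> j j' i i' jj' j'n; rewrite !inE => /andP[ij _] /andP[ij' _]; exact: (h2 j j').
Qed.

(** The sequence [0, 0, ...] is attached to the ordinal 1: then [F_1] is obtained from [F_0]
    by the rule that gives all later families ([schreier_inv], [schreier_build]). *)
Definition fs1 a : nat -> W := if a == oone W then fun=> ozero W else fs a.

Lemma oone_gt0 : (ozero W < oone W)%O. Proof. exact: (proj1 (osuccP _)). Qed.

Lemma fs1_lt a j : (ozero W < a)%O -> (fs1 a j < a)%O.
Proof.
move=> a0; rewrite /fs1; case: eqVneq => [->|a1]; first exact: oone_gt0.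
apply: (fs_lt hfs); rewrite lt_neqAle eq_sym a1 /=.
exact: (proj2 (osuccP (ozero W))).
Qed.

Lemma schreier0_inv F : schreier fs (ozero W) F -> F = fset0 \/ exists i, F = [fset i]%fset.
Proof.
move E : (ozero W) => a aF; case: aF E => {a F}.
- by left.
- by move=> i _; right; exists i.
- by move=> F _ E; have := oone_gt0; rewrite -{1}E E ltxx.
- move=> a n F a1 _ _ _ _ E; move: a1; rewrite -E => /(lt_trans oone_gt0).
  by rewrite ltxx.
Qed.

Definition successive n (G : nat -> {fset nat}) :=
  (forall j i, (j < n)%N -> i \in G j -> (n <= i.+1)%N) /\
  (forall j j' i i', (j < j')%N -> (j' < n)%N -> i \in G j -> i' \in G j' -> (i < i')%N).

Lemma schreier_inv a F : (ozero W < a)%O -> schreier fs a F ->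
  exists n G, [/\ forall j, (j < n)%N -> schreier fs (fs1 a j) (G j),
    successive n G & F = (\bigcup_(j <- iota 0 n) G j)%fset].
Proof.
move=> + aF; case: aF => {a F}.
- by rewrite ltxx.
- by move=> i; rewrite ltxx.
- move=> F aF _; pose s := sort leq F.
  have ss : sorted leq s by exact: (sort_sorted leq_total).
  have us : uniq s by rewrite sort_uniq fset_uniq.
  have szs : size s = #|` F| by rewrite size_sort.
  have ms i : (i \in s) = (i \in F) by rewrite mem_sort.
  exists #|` F|, (fun j => [fset nth 0%N s j]%fset); split.
  + by move=> j _; rewrite /fs1 eqxx; exact: Schreier0_single.
  + split=> [j i jn|j j' i i' jj' jn]; rewrite !inE => /eqP ->.
      by apply: aF; rewrite -ms mem_nth // szs.
    move=> /eqP ->; rewrite ltn_neqAle nth_uniq ?szs //; last exact: ltn_trans jn.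
    rewrite (ltn_eqF jj') /=.
    apply: (@sorted_leq_nth _ leq leq_trans leqnn) => //; last exact: ltnW.
      by rewrite inE szs (ltn_trans jj').
    by rewrite inE szs.
  + apply/fsetP => i; rewrite -ms; apply/idP/bigfcupP => [h|[j]].
      exists (index i s); rewrite ?andbT ?mem_iota ?inE ?nth_index //=.
      by rewrite -szs index_mem.
    rewrite andbT mem_iota /= add0n -szs => h; rewrite !inE => /eqP ->.
    exact: mem_nth.
- move=> a n F a1 n1 hF h1 h2 _; exists n, F; split=> //.
  by move=> j jn; rewrite /fs1 (gt_eqF a1); exact: hF.
Qed.

Lemma schreier_build a n (G : nat -> {fset nat}) : (ozero W < a)%O ->
  (forall j, (j < n)%N -> schreier fs (fs1 a j) (G j)) -> successive n G ->
  schreier fs a (\bigcup_(j <- iota 0 n) G j)%fset.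
Proof.
move=> a0; case: n => [|n] hG [h1 h2].
  by rewrite big_nil; exact: (schreier_empty hfs).
have [a1|a1] := eqVneq a (oone W); last first.
  apply: Schreier_union => //.
    by rewrite lt_neqAle eq_sym a1; exact: (proj2 (osuccP (ozero W))).
  by move=> j jn; have := hG j jn; rewrite /fs1 (negbTE a1).
subst a; apply: Schreier1 => i /bigfcupP[j]; rewrite andbT mem_iota /= add0n => jn ij.
apply: leq_trans (h1 j i jn ij).
have : forall m, (m <= n.+1)%N -> (#|` \bigcup_(j <- iota 0 m) G j|%fset <= m)%N.
  elim=> [_|m IH mn]; first by rewrite big_nil cardfs0.
  rewrite -addn1 iotaD big_cat /= big_seq1 add0n.
  apply: leq_trans (leq_card_fsetU _ _) _; apply: leq_add; first exact: (IH (ltnW mn)).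
  have := hG m mn; rewrite /fs1 eqxx => /schreier0_inv[->|[i' ->]].
    by rewrite cardfs0.
  by rewrite cardfs1.
exact.
Qed.

(** The families need not increase with the ordinal, but those attached to [a] are contained
    in [F_a] from some point of [nat] on. *)
Lemma schreier_tail a j F : (ozero W < a)%O -> schreier fs (fs1 a j) F ->
  (forall i, i \in F -> (j <= i)%N) -> schreier fs a F.
Proof.
move=> a0 hF hj.
have -> : F = (\bigcup_(k <- iota 0 j.+1) (fun k => if k == j then F else fset0) k)%fset.
  apply/fsetP => i; apply/idP/bigfcupP => [iF|[k _]]; last by case: eqP.
  by exists j; rewrite ?eqxx // andbT mem_iota /= add0n.
apply: schreier_build => // [k kj|].
  by case: eqP => [->|_] //; exact: (schreier_empty hfs).
split=> [k i kj|k k' i i' kk' k'j]; first by case: eqP => // _ iF; rewrite ltnS hj.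
by case: eqP => [kE|//]; move: kk' k'j; rewrite kE; lia.
Qed.

End SchreierFamilies.

(** * Convex sets of vectors escaping to infinity *)

Section FarConvex.
Variable R : realType.
Implicit Types (a b : nat -> R) (C : set (nat -> R)) (F : {fset nat}).

Definition supported N M a := forall i, ~~ ((N <= i) && (i < M))%N -> a i = 0.

Definition convex_set C := forall a b (l : R), 0 <= l <= 1 -> C a -> C b ->
  C (fun i => l * a i + (1 - l) * b i).

Definition far C := forall N, exists M a, C a /\ supported N M a.

Definition fsum F a : R := \sum_(i <- F) a i.

Lemma supportedW N M N' M' a :
  (N' <= N)%N -> (M <= M')%N -> supported N M a -> supported N' M' a.
Proof. by move=> NN MM h i hi; apply: h; lia. Qed.

Lemma supported_supp N M a : supported N M a -> supp M a.
Proof. by move=> h i Mi; apply: h; lia. Qed.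

Lemma far_sub C C' : (forall a, C a -> C' a) -> far C -> far C'.
Proof. by move=> CC h N; have [M [a [Ca sa]]] := h N; exists M, a; split=> //; exact: CC. Qed.

Lemma convexI C C' : convex_set C -> convex_set C' -> convex_set (C `&` C').
Proof. by move=> h h' a b l l01 [Ca C'a] [Cb C'b]; split; [exact: h|exact: h']. Qed.

(** The next vector may depend on the point where its support is allowed to start, for instance
    by being small in terms of that point. *)
Lemma choose_successive (Q : nat -> nat -> (nat -> R) -> Prop) :
  (forall N, exists M a, (N < M)%N /\ Q N M a) ->
  forall N, exists (p : nat -> nat) (w : nat -> nat -> R),
    p 0%N = N /\ forall i, (p i < p i.+1)%N /\ Q (p i) (p i.+1) (w i).
Proof.
move=> h N; have /choice[g hg] : forall N, exists z : nat * (nat -> R), (N < z.1)%N /\ Q N z.1 z.2.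
  by move=> n; have [M [a ?]] := h n; exists (M, a).
exists (fun i => iter i (fun n => (g n).1) N), (fun i => (g (iter i (fun n => (g n).1) N)).2).
by split=> // i /=; exact: hg.
Qed.

Lemma increasing_leq (p : nat -> nat) : (forall i, (p i < p i.+1)%N) ->
  forall i j, (i <= j)%N -> (p i <= p j)%N.
Proof.
move=> h i j; elim: j => [|j IH]; first by rewrite leqn0 => /eqP ->.
by rewrite leq_eqVlt => /orP[/eqP ->//|/IH/leq_trans]; apply; apply: ltnW.
Qed.

Definition average n (w : nat -> nat -> R) : nat -> R :=
  fun i => (\sum_(j < n.+1) w j i) / n.+1%:R.

Lemma convex_average C w n : convex_set C -> (forall j, C (w j)) -> C (average n w).
Proof.
move=> cC hw; elim: n => [|n IH].
  have -> : average 0 w = w 0%N; last exact: hw.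
  by apply/funext => i; rewrite /average big_ord1 divr1.
pose l : R := n.+1%:R / n.+2%:R.
have -> : average n.+1 w = (fun i => l * average n w i + (1 - l) * w n.+1 i).
  apply/funext => i; rewrite /average big_ord_recr /=.
  have n1 : n.+1%:R != 0 :> R by rewrite pnatr_eq0.
  have n2 : n.+1%:R + 1 != 0 :> R by rewrite natr1 pnatr_eq0.
  rewrite /l -[n.+2%:R]natr1.
  set S := \sum_(j < _) _; move: n1 n2; move: (n.+1%:R) => x n1 n2.
  by field; rewrite n1 n2.
apply: cC => //; rewrite /l divr_ge0 //= ler_pdivrMr ?ltr0n // mul1r ler_nat.
exact: leqnSn.
Qed.

(** Only the first nonzero term can exceed [e], so an average of many terms is about [e]. *)
Lemma sum_first_large (x : nat -> R) n (K e : R) : 0 <= e ->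
  (forall i, `|x i| <= K) ->
  (forall i j, (i < j)%N -> x i != 0 -> `|x j| <= e) ->
  `|\sum_(i < n) x i| <= K + n%:R * e.
Proof.
move=> e0 hK he; have K0 : 0 <= K by apply: le_trans (hK 0%N).
have [[i0 xi0]|H] := pselect (exists i, x i != 0); last first.
  rewrite big1; last by move=> i _; apply/eqP; apply: contrapT => xi; apply: H; exists i; apply/negP.
  by rewrite normr0 addr_ge0 // mulr_ge0.
have [i xi imin] := ex_minnP (ex_intro (fun i => x i != 0) i0 xi0).
apply: le_trans (ler_norm_sum _ _ _) _.
apply: (@le_trans _ _ (\sum_(j < n) ((if j == i :> nat then K else 0) + e))).
  apply: ler_sum => j _; case: (ltngtP j i) => [ji|ij|->].
  - have /eqP -> : x j == 0 by apply/negPn/negP => /imin; rewrite leqNgt ji.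
    by rewrite normr0 add0r.
  - by rewrite add0r; exact: he xi.
  - by apply: le_trans (hK i) _; rewrite lerDl.
rewrite big_split /= sumr_const card_ord mulr_natl lerD2r.
case: (ltnP i n) => iN.
  rewrite (bigD1 (Ordinal iN)) //= eqxx big1 ?addr0 // => j ji.
  by case: eqP => // E; case/eqP: ji; apply/val_inj.
rewrite big1 // => j _; case: eqP => // E.
by move: (ltn_ord j); rewrite E ltnNge iN.
Qed.

Lemma fsum_average F n w : fsum F (average n w) = (\sum_(j < n.+1) fsum F (w j)) / n.+1%:R.
Proof. by rewrite /fsum /average -mulr_suml exchange_big. Qed.

Lemma supported_average n p w : (forall i, (p i < p i.+1)%N) ->
  (forall i, supported (p i) (p i.+1) (w i)) -> supported (p 0%N) (p n.+1) (average n w).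
Proof.
move=> hp hw i hi; rewrite /average big1 ?mul0r // => j _; apply: hw.
have := increasing_leq hp (leq0n j); have := increasing_leq hp (ltn_ord j); lia.
Qed.

Lemma fsum_eq0 F a : (forall i, i \in F -> a i = 0) -> fsum F a = 0.
Proof. by move=> h; rewrite /fsum big_seq big1. Qed.

Lemma fsumU F G a : [disjoint F & G]%fset -> fsum (F `|` G)%fset a = fsum F a + fsum G a.
Proof.
move=> /fdisjointP dis; rewrite /fsum -big_cat /=; apply: perm_big; apply: uniq_perm.
- exact: fset_uniq.
- rewrite cat_uniq !fset_uniq /= andbT; apply/hasPn => i iG; apply/negP => iF.
  by have := dis i iF; rewrite iG.
- by move=> i; rewrite mem_cat in_fsetU.
Qed.

Lemma nat_upper_bound (x : R) : exists n, x <= n%:R.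
Proof.
exists (Num.bound `|x|); apply: le_trans (ler_norm x) (ltW _).
exact: archi_boundP.
Qed.

Lemma convex_fsum (Fam : {fset nat} -> Prop) (e : R) :
  convex_set [set a | forall F, Fam F -> `|fsum F a| <= e].
Proof.
move=> a b l /andP[l0 l1] ha hb F hF.
rewrite /fsum big_split /= -!mulr_sumr; apply: le_trans (ler_normD _ _) _.
rewrite !normrM (ger0_norm l0) (@ger0_norm _ (1 - l)) ?subr_ge0 //.
have := ha F hF; have := hb F hF; rewrite /fsum => h1 h2.
have := ler_wpM2l l0 h2; have l1' : 0 <= 1 - l by rewrite subr_ge0.
have := ler_wpM2l l1' h1; lra.
Qed.

Lemma convex_supported N : convex_set [set a | forall i, (i < N)%N -> a i = 0].
Proof. by move=> a b l _ ha hb i iN; rewrite ha // hb // !mulr0 addr0. Qed.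

Lemma far_supported C N : far C -> far (C `&` [set a | forall i, (i < N)%N -> a i = 0]).
Proof.
move=> h N'; have [M [a [Ca sa]]] := h (maxn N N').
exists M, a; split; first split=> //= i iN; first by apply: sa; lia.
by apply: supportedW sa; rewrite ?leq_maxr.
Qed.

End FarConvex.

Section Null.
Variables (R : realType) (W : omega1) (fs : W -> nat -> W).
Hypothesis hfs : fundamental_sequences fs.
Implicit Types (a : nat -> R) (C : set (nat -> R)).

Lemma fsum_bigcup n (G : nat -> {fset nat}) a (e : R) : successive n G ->
  (forall j, (j < n)%N -> `|fsum (G j) a| <= e) ->
  `|fsum (\bigcup_(j <- iota 0 n) G j)%fset a| <= n%:R * e.
Proof.
move=> [_ hG] he.
have : forall m, (m <= n)%N -> `|fsum (\bigcup_(j <- iota 0 m) G j)%fset a| <= m%:R * e.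
  elim=> [_|m IH mn]; first by rewrite big_nil fsum_eq0 ?normr0 ?mul0r // => i; rewrite inE.
  rewrite -addn1 iotaD big_cat /= big_seq1 add0n natrD mulrDl mul1r.
  set U := (\bigcup_(j <- iota 0 m) G j)%fset.
  have dis : [disjoint U & G m]%fset.
    apply/fdisjointP => i /bigfcupP[j]; rewrite andbT mem_iota /= add0n => jm ij.
    apply/negP => im; have := hG j m i i jm mn ij im; by rewrite ltnn.
  rewrite fsumU //.
  by apply: le_trans (ler_normD _ _) _; apply: lerD; [exact: IH (ltnW mn)|exact: he].
exact.
Qed.

Lemma fsum_tail (F : {fset nat}) N a : (forall i, (i < N)%N -> a i = 0) ->
  fsum F a = fsum [fset i in F | (N <= i)%N]%fset a.
Proof.
move=> ha; rewrite /fsum.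
rewrite (bigID (fun i => (N <= i)%N)) /= [X in _ + X]big1 ?addr0; last first.
  by move=> i; rewrite -ltnNge; exact: ha.
rewrite -big_filter; apply: perm_big; apply: uniq_perm.
- by rewrite filter_uniq // fset_uniq.
- exact: fset_uniq.
- by move=> i; rewrite mem_filter !inE andbC.
Qed.

(** The functionals [fsum F], for [F] in a Schreier family, are uniformly small at some
    points of a convex set that escapes to infinity and on which they are bounded: these
    functionals form a countable compact space on which a bounded sequence of successive
    vectors tends to 0 pointwise, hence weakly.  The direct argument is an induction on [b].
    On vectors with successive supports, [F] is a union of [n] sets from smaller families
    with [n <= min F + 1], so [n] is controlled by the end of the first support that [F]
    meets; the later vectors are chosen so small on the smaller families that their
    contribution to an average is negligible. *)
Lemma far_small_schreier (b : W) C (K e : R) : convex_set C -> far C ->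
  (forall a, C a -> forall F, schreier fs b F -> `|fsum F a| <= K) -> 0 < e ->
  far (C `&` [set a | forall F, schreier fs b F -> `|fsum F a| <= e]).
Proof.
elim/(well_founded_ind (@omega1_wf W)): b C K e => b IH C K e cC fC hK e0.
have e2 : 0 < e / 2 by rewrite divr_gt0.
have finite_family (d : R) m : 0 < d -> (ozero W < b)%O ->
    far (C `&` [set a | forall j, (j < m)%N ->
      forall F, schreier fs (fs1 fs b j) F -> `|fsum F a| <= d]).
  move=> d0 b0; elim: m => [|m IHm]; first by apply: far_sub fC => a Ca; split.
  set C1 := C `&` _ in IHm.
  pose C2 := C1 `&` [set a | forall i, (i < m)%N -> a i = 0].
  have cC1 : convex_set C1.
    apply: convexI => // a1 a2 l l01 h1 h2 j jm; apply: convex_fsum => //; [exact: h1|exact: h2].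
  have cC2 : convex_set C2 by apply: convexI => //; exact: convex_supported.
  have fC2 : far C2 by exact: far_supported.
  have hK2 a : C2 a -> forall F, schreier fs (fs1 fs b m) F -> `|fsum F a| <= K.
    (* Only the part of [F] beyond [m] matters, and that part belongs to [F_b]. *)
    move=> [[Ca _] am] F hF; rewrite (fsum_tail F am); apply: hK => //.
    apply: (schreier_tail hfs (j := m)) => //; first exact: schreier_filter.
    by move=> i; rewrite !inE => /andP[].
  have := IH _ (fs1_lt hfs m b0) C2 K d cC2 fC2 hK2 d0.
  apply: far_sub => a [[[Ca h1] _] h2]; split=> // j.
  by rewrite ltnS leq_eqVlt => /orP[/eqP ->|]; [exact: h2|exact: h1].
pose Q N M a := [/\ C a, supported N M a & (ozero W < b)%O -> forall j, (j < N)%N ->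
  forall F, schreier fs (fs1 fs b j) F -> `|fsum F a| <= e / 2 / N.+1%:R].
have hQ N : exists M a, (N < M)%N /\ Q N M a.
  have d0 : 0 < e / 2 / N.+1%:R by rewrite divr_gt0 // ltr0n.
  have [b0|b0] := boolP (ozero W < b)%O.
    have [M [a [[Ca ha] sa]]] := finite_family _ N d0 b0 N.
    exists (maxn M N.+1), a; split; first by rewrite leq_maxr.
    by split=> //; apply: supportedW sa; rewrite ?leq_maxl.
  have [M [a [Ca sa]]] := fC N; exists (maxn M N.+1), a; split; first by rewrite leq_maxr.
  by split; [|apply: supportedW sa; rewrite ?leq_maxl|rewrite (negbTE b0)].
move=> N; have [p [w [pN hp]]] := choose_successive hQ N.
have pinc i : (p i < p i.+1)%N by have [] := hp i.
have Cw i : C (w i) by have [_ []] := hp i.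
have sw i : supported (p i) (p i.+1) (w i) by have [_ []] := hp i.
have [n hn] := nat_upper_bound (K / (e / 2)).
exists (p n.+1), (average n w); split; last by rewrite -pN; exact: supported_average.
split; first exact: convex_average.
move=> F hF; rewrite fsum_average normrM (ger0_norm (_ : 0 <= n.+1%:R^-1)) ?invr_ge0 //.
rewrite ler_pdivrMr ?ltr0n //.
have hx : forall i j, (i < j)%N -> fsum F (w i) != 0 -> `|fsum F (w j)| <= e / 2.
  move=> i j ij xi.
  have [k kF [kp wk]] : exists2 k, k \in F & (p i <= k < p i.+1)%N /\ w i k != 0.
    apply: contrapT => H; move/eqP: xi; apply; apply: fsum_eq0 => k kF.
    apply: contrapT => /eqP wk; apply: H; exists k => //; split=> //.
    by apply/negPn/negP => /sw; apply/eqP.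
  have pij : (p i.+1 <= p j)%N by exact: increasing_leq.
  have [b0|b0] := boolP (ozero W < b)%O; last first.
    have E : b = ozero W by apply/eqP; rewrite eq_le le0x andbT leNgt.
    move: hF kF; rewrite E => /schreier0_inv[->|[l ->]]; rewrite !inE // => /eqP kl; subst l.
    rewrite fsum_eq0 ?normr0 ?ltW // => l; rewrite inE => /eqP ->.
    by apply: sw; lia.
  have [m [G [hG sG FE]]] := schreier_inv b0 hF.
  have mk : (m <= k.+1)%N.
    move: kF; rewrite FE => /bigfcupP[l]; rewrite andbT mem_iota /= add0n => lm kl.
    by case: sG => h _; exact: h lm kl.
  rewrite FE; apply: le_trans (fsum_bigcup sG (e := e / 2 / (p j).+1%:R) _) _.
    move=> l lm; have [_ [_ _ h]] := hp j; apply: (h b0 l) => //; last exact: hG.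
    by lia.
  rewrite mulrA ler_pdivrMr ?ltr0n // mulrC ler_pM2l // ler_nat; lia.
apply: le_trans (sum_first_large n.+1 (ltW e2) (fun i => hK _ (Cw i) F hF) hx) _.
suff : K <= n.+1%:R * (e / 2) by lra.
by rewrite -ler_pdivrMr //; apply: le_trans hn _; rewrite ler_nat.
Qed.

End Null.

(** * The norm on finitely supported vectors *)

Section TNorm.
Variables (R : realType) (W : omega1) (fs : W -> nat -> W).
Hypothesis hfs : fundamental_sequences fs.
Variable alpha : W.
Implicit Types (a b : nat -> R) (C : set (nat -> R)) (P : {fset nat}) (B : set nat).

Local Notation q_ := (@tnorm_ R W fs alpha).
Local Notation q := (@tnorm R W fs alpha).

Let gq := @good_tnorm R W fs hfs alpha.
Let gq_ := @good_tnorm_ R W fs hfs alpha.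

Lemma tnorm_ge m N a : supp N a -> q_ m a <= q a.
Proof. by move=> sa; exact: (proj1 (tnorm_cvg hfs alpha sa)). Qed.

Lemma fsum_bounded N a : supp N a ->
  forall F, schreier fs alpha F -> `|fsum F a| <= \sum_(i < N) `|a i|.
Proof.
by move=> sa F _; apply: le_trans (ler_norm_sum _ _ _) _; exact: fset_sum_le.
Qed.

Lemma fsum_le_tnorm0 N a F : supp N a -> schreier fs alpha F ->
  `|fsum F a| <= tnorm0 fs alpha a.
Proof.
move=> sa hF.
exact: (@le_supE R _ (schreier fs alpha) (fun F => `|fsum F a|) _ F (fsum_bounded sa) hF).
Qed.

Lemma fsum_le_tnorm N a F : supp N a -> schreier fs alpha F -> `|fsum F a| <= q a.
Proof. by move=> sa hF; apply: le_trans (fsum_le_tnorm0 sa hF) (tnorm_ge 0 sa). Qed.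

Lemma tnorm0_le a (B : R) : (forall F, schreier fs alpha F -> `|fsum F a| <= B) ->
  tnorm0 fs alpha a <= B.
Proof.
move=> h; apply: (@sup_leE R _ (schreier fs alpha) (fun F => `|fsum F a|)) => //.
by exists fset0; exact: (schreier_empty hfs).
Qed.

Lemma block_sum_le m N a P : supp N a ->
  \sum_(i < #|` P|) q_ m (trunc (block P i) a) <= \sum_(n < N) `|a n|.
Proof.
move=> sa.
apply: (@le_trans _ _ (\sum_(i < #|` P|) \sum_(n < N) `|trunc (block P i) a n|)).
  by apply: ler_sum => i _; apply: (good_l1 (gq_ m)); exact: supp_trunc.
by rewrite exchange_big /=; apply: ler_sum => n _; exact: sum_trunc.
Qed.

(** The norm is a fixed point of the recursion that defines it; this and [tnorm_le] are the
    two halves of the implicit equation. *)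
Lemma tnorm_step N a P : supp N a -> admissible P ->
  2^-1 * \sum_(i < #|` P|) q (trunc (block P i) a) <= q a.
Proof.
move=> sa aP.
have hm m : 2^-1 * \sum_(i < #|` P|) q_ m (trunc (block P i) a) <= q a.
  apply: le_trans (tnorm_ge m.+1 sa); rewrite /= le_max; apply/orP; right.
  apply: ler_wpM2l => //.
  apply: (@le_supE R _ admissible
    (fun P => \sum_(i < #|` P|) q_ m (trunc (block P i) a)) (\sum_(n < N) `|a n|)) => //.
  by move=> P' _; exact: block_sum_le.
rewrite mulrC -ler_pdivlMr ?invr_gt0 //.
have cv : (fun m => \sum_(i < #|` P|) q_ m (trunc (block P i) a)) @ \oo -->
   \sum_(i < #|` P|) q (trunc (block P i) a).
  apply: (@cvg_big R^o); first by move=> x; apply: cvgD; [exact: cvg_fst|exact: cvg_snd].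
  move=> i _.
  have si : supp N (trunc (block P i) a) by exact: supp_trunc.
  apply: nondecreasing_is_cvgn; first by apply/nondecreasing_seqP => m /=; rewrite le_max lexx.
  by exists (q (trunc (block P i) a)) => _ [m _ <-]; exact: tnorm_ge si.
rewrite -(cvg_lim _ cv) //; apply: limr_le; first by apply/cvg_ex; eexists; exact: cv.
by near=> m; have := hm m; rewrite ler_pdivlMr ?invr_gt0 // mulrC.
Unshelve. all: by end_near. Qed.

Lemma tnorm_le N a (B : R) : supp N a ->
  (forall F, schreier fs alpha F -> `|fsum F a| <= B) ->
  (forall P, admissible P -> 2^-1 * \sum_(i < #|` P|) q (trunc (block P i) a) <= B) ->
  q a <= B.
Proof.
move=> sa h0 h1; apply: (proj2 (tnorm_cvg hfs alpha sa)).
elim=> [|m IH] /=; first exact: tnorm0_le.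
rewrite ge_max IH /= mulrC -ler_pdivlMr ?invr_gt0 //.
apply: (@sup_leE R _ admissible
    (fun P => \sum_(i < #|` P|) q_ m (trunc (block P i) a))).
  by exists fset0 => i; rewrite inE.
move=> P aP; rewrite ler_pdivlMr ?invr_gt0 // mulrC; apply: le_trans (h1 P aP).
by apply: ler_wpM2l => //; apply: ler_sum => i _; apply: tnorm_ge; exact: supp_trunc sa.
Qed.

Lemma trunc_comm B B' a : trunc B (trunc B' a) = trunc B' (trunc B a).
Proof. by apply/funext => i; rewrite /trunc; do 2 case: ifP. Qed.

Lemma truncE (p : pred nat) a i : trunc [set m | p m] a i = if p i then a i else 0.
Proof.
by rewrite /trunc; congr (if _ then _ else _); apply/idP/idP => [/set_mem|]; last exact: mem_set.
Qed.

Lemma fsum_trunc F B a : fsum F (trunc B a) = fsum [fset i in F | i \in B]%fset a.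
Proof.
rewrite /fsum /trunc -big_mkcond -big_filter; apply: perm_big; apply: uniq_perm.
- by rewrite filter_uniq // fset_uniq.
- exact: fset_uniq.
- by move=> i; rewrite mem_filter !inE andbC.
Qed.

(** Each [F_alpha] is hereditary, so erasing coordinates does not increase the norm. *)
Lemma tnorm_trunc N B a : supp N a -> q (trunc B a) <= q a.
Proof.
move=> sa; have sB b : supp N b -> supp N (trunc B b) by exact: supp_trunc.
apply: (proj2 (tnorm_cvg hfs alpha (sB _ sa))) => m.
apply: le_trans (tnorm_ge m sa).
elim: m a sa => [|m IH] a sa /=.
  apply: tnorm0_le => F hF; rewrite fsum_trunc; apply: (fsum_le_tnorm0 sa).
  exact: schreier_filter.
rewrite ge_max !le_max IH //=; apply/orP; right; apply: ler_wpM2l => //.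
apply: (@sup_leE R _ admissible
    (fun P => \sum_(i < #|` P|) q_ m (trunc (block P i) (trunc B a)))).
  by exists fset0 => i; rewrite inE.
move=> P aP; apply: (@le_trans _ _ (\sum_(i < #|` P|) q_ m (trunc (block P i) a))).
  by apply: ler_sum => i _; rewrite trunc_comm; apply: IH; exact: supp_trunc.
apply: (@le_supE R _ admissible
    (fun P => \sum_(i < #|` P|) q_ m (trunc (block P i) a)) (\sum_(n < N) `|a n|)) => //.
by move=> P' _; exact: block_sum_le.
Qed.

Definition fin a := exists N, supp N a.

Lemma fin_tnormD a b : fin a -> fin b -> q (fun i => a i + b i) <= q a + q b.
Proof.
move=> [N sa] [M sb]; apply: (goodD gq (N := maxn N M)) => i hi.
  by apply: sa; apply: leq_trans hi; rewrite leq_maxl.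
by apply: sb; apply: leq_trans hi; rewrite leq_maxr.
Qed.

Lemma fin_tnormZ (k : R) a : fin a -> q (fun i => k * a i) <= `|k| * q a.
Proof. by move=> [N sa]; exact: (goodZ gq k sa). Qed.

Lemma finD a b : fin a -> fin b -> fin (fun i => a i + b i).
Proof.
move=> [N sa] [M sb]; exists (maxn N M) => i hi.
by rewrite sa ?sb ?addr0 //; apply: leq_trans hi; rewrite ?leq_maxr ?leq_maxl.
Qed.

Lemma finZ (k : R) a : fin a -> fin (fun i => k * a i).
Proof. by move=> [N sa]; exists N => i hi; rewrite sa // mulr0. Qed.

Lemma fin_trunc B a : fin a -> fin (trunc B a).
Proof. by move=> [N sa]; exists N; exact: supp_trunc. Qed.

Lemma fin_sum n (w : nat -> nat -> R) : (forall j, fin (w j)) ->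
  fin (fun i => \sum_(j < n) w j i).
Proof.
move=> hw; elim: n => [|n IH]; first by exists 0%N => i _; rewrite big_ord0.
have -> : (fun i => \sum_(j < n.+1) w j i) = (fun i => \sum_(j < n) w j i + w n i).
  by apply/funext => i; rewrite big_ord_recr.
exact: finD.
Qed.

Lemma fin_tnorm_sum n (w : nat -> nat -> R) : (forall j, fin (w j)) ->
  q (fun i => \sum_(j < n) w j i) <= \sum_(j < n) q (w j).
Proof.
move=> hw; elim: n => [|n IH].
  rewrite big_ord0; have s0 : supp 0 (fun i : nat => \sum_(j < 0) w j i).
    by move=> i _; rewrite big_ord0.
  by apply: le_trans (good_l1 gq s0) _; rewrite big_ord0.
have -> : (fun i => \sum_(j < n.+1) w j i) = (fun i => \sum_(j < n) w j i + w n i).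
  by apply/funext => i; rewrite big_ord_recr.
rewrite big_ord_recr /=; apply: le_trans (fin_tnormD (fin_sum n hw) (hw n)) _.
by rewrite lerD2r.
Qed.

Lemma convex_tnorm (e : R) : convex_set [set a | fin a /\ q a <= e].
Proof.
move=> a b l /andP[l0 l1] [fa ha] [fb hb]; split; first by apply: finD; exact: finZ.
apply: le_trans (fin_tnormD (finZ l fa) (finZ (1 - l) fb)) _.
have l1' : 0 <= 1 - l by rewrite subr_ge0.
have := fin_tnormZ l fa; have := fin_tnormZ (1 - l) fb; rewrite !ger0_norm //.
have := ler_wpM2l l0 ha; have := ler_wpM2l l1' hb; lra.
Qed.

(** Blocks are intervals: one that starts before [p] and reaches [p, p') contains [p]. *)
Lemma trunc_block_eq0 P i p p' a : (i < #|` P|)%N -> supported p p' a ->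
  ~ block P i p -> ~ (p <= nth 0%N (sort leq P) i < p')%N -> trunc (block P i) a = (fun=> 0).
Proof.
move=> iP sa h1 h2; apply/funext => n; rewrite /trunc; case: ifPn => // /set_mem hn.
apply: sa; apply/negP => /andP[pn np'].
move: hn => /andP[/= hn1 hn2].
case: (ltnP (nth 0%N (sort leq P) i) p) => hp; last first.
  by apply: h2; rewrite hp /=; exact: leq_ltn_trans hn1 np'.
apply: h1; rewrite /block /= (ltnW hp) /=; apply/implyP => iP'.
by apply: leq_ltn_trans pn _; move: hn2; rewrite iP'.
Qed.

(** A vector meets a block only if the block contains the start [p j] of its interval or
    starts inside of that interval.  Each [p j] lies in at most one block, and each block
    starts in at most one interval, so at most [n + #|P|] pairs meet. *)
Lemma block_count P (p : nat -> nat) (w : nat -> nat -> R) (s : R) n : 0 <= s ->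
  (forall j, (p j < p j.+1)%N) -> (forall j, supported (p j) (p j.+1) (w j)) ->
  (forall j, q (w j) <= s) ->
  \sum_(i < #|` P|) \sum_(j < n) q (trunc (block P i) (w j)) <= (n%:R + (#|` P|)%:R) * s.
Proof.
move=> s0 hp sw hw; pose m i := nth 0%N (sort leq P) i.
apply: (@le_trans _ _ (\sum_(i < #|` P|) \sum_(j < n)
   (`|trunc (block P i) (fun=> 1 : R) (p j)| * s + (p j <= m i < p j.+1)%N%:R * s))).
  apply: ler_sum => i _; apply: ler_sum => j _.
  have swj : supp (p j.+1) (w j) by exact: supported_supp (sw j).
  have [/mem_set hb|hb] := pselect (block P i (p j)).
    rewrite {2}/trunc hb normr1 mul1r; apply: le_trans (tnorm_trunc _ swj) _.
    by apply: le_trans (hw j) _; rewrite lerDl mulr_ge0.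
  have [hb'|hb'] := boolP (p j <= m i < p j.+1)%N.
    rewrite mul1r; apply: le_trans (tnorm_trunc _ swj) _.
    by apply: le_trans (hw j) _; rewrite lerDr mulr_ge0.
  rewrite (trunc_block_eq0 (ltn_ord i) (sw j) hb (negP hb')).
  apply: le_trans (good_l1 gq (_ : supp 0 (fun=> 0))) _; first by [].
  by rewrite big_ord0 addr_ge0 // mulr_ge0.
under eq_bigr do rewrite big_split.
rewrite big_split /= mulrDl; apply: lerD.
  rewrite exchange_big /= mulr_natl -[n in X in _ <= X]card_ord -sumr_const.
  apply: ler_sum => j _; rewrite -mulr_suml ler_piMl //.
  by apply: le_trans (sum_trunc P (fun=> 1) (p j)) _; rewrite normr1.
rewrite mulr_natl -[#|` P| in X in _ <= X]card_ord -sumr_const.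
apply: ler_sum => i _; rewrite -mulr_suml ler_piMl //.
have [[j hj]|H] := pselect (exists j : 'I_n, (p j <= m i < p j.+1)%N).
  rewrite (bigD1 j) //= hj big1 ?addr0 // => j' jj'.
  case: (boolP (p j' <= m i < p j'.+1)%N) => // hj'; exfalso.
  case: (ltngtP j j') => [h|h|/val_inj E]; last by rewrite E eqxx in jj'.
    by have := increasing_leq hp h; lia.
  by have := increasing_leq hp h; lia.
rewrite big1 // => j _; case: (boolP (p j <= m i < p j.+1)%N) => // hj.
by exfalso; apply: H; exists j.
Qed.

End TNorm.

(** * Small vectors in convex sets *)

Section Averaging.
Variables (R : realType) (W : omega1) (fs : W -> nat -> W).
Hypothesis hfs : fundamental_sequences fs.
Variable alpha : W.
Implicit Types (a b : nat -> R) (C : set (nat -> R)) (P : {fset nat}).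

Local Notation q := (@tnorm R W fs alpha).

(** Let [x] and then [w 0, ..., w r] be successive elements of [C] on which the functionals
    of [F_alpha] are small, with [r] large in terms of the support of [x], and let [y] be the
    average of the [w j].  The norm of [(x + y) / 2] comes from an admissible set [P].  If [P]
    starts after [x], the blocks only see [y / 2].  Otherwise [P] has few elements, so the
    blocks cut only a few of the [w j]; each of the others lies in a single block, where it
    contributes at most [s] instead of the [2 * s] that an admissible family could give. *)
Lemma far_contract C (s : R) : convex_set C -> far C -> 0 < s ->
  (forall a, C a -> fin a /\ q a <= s) -> far (C `&` [set a | fin a /\ q a <= 7 / 8 * s]).
Proof.
move=> cC fC s0 hC; have s80 : 0 < s / 8 by rewrite divr_gt0.
pose C1 := C `&` [set a | forall F, schreier fs alpha F -> `|fsum F a| <= s / 8].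
have cC1 : convex_set C1 by apply: convexI => //; exact: convex_fsum.
have fC1 : far C1.
  apply: (far_small_schreier hfs (K := s)) => // a Ca F hF.
  by have [[N sa] qa] := hC a Ca; apply: le_trans (fsum_le_tnorm hfs sa hF) qa.
move=> N; have [M [x [C1x sx]]] := fC1 N.
pose Q N M a := C1 a /\ supported N M a.
have hQ n : exists m a, (n < m)%N /\ Q n m a.
  have [m [a [Ca sa]]] := fC1 n; exists (maxn m n.+1), a; split; first by rewrite leq_maxr.
  by split=> //; apply: supportedW sa; rewrite ?leq_maxl.
have [p [w [pM hp]]] := choose_successive hQ (maxn N M).
have pinc i : (p i < p i.+1)%N by have [] := hp i.
have C1w i : C1 (w i) by have [_ []] := hp i.
have sw i : supported (p i) (p i.+1) (w i) by have [_ []] := hp i.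
have fw i : fin (w i) by have [] := hC _ (proj1 (C1w i)).
have qw i : q (w i) <= s by have [] := hC _ (proj1 (C1w i)).
pose r := (2 * M)%N; pose y := average r w.
have C1y : C1 y by exact: convex_average.
have [fy qy] := hC _ (proj1 C1y); have [fx qx] := hC _ (proj1 C1x).
pose a : nat -> R := fun i => 2^-1 * x i + (1 - 2^-1) * y i.
have C1a : C1 a by apply: cC1 => //; lra.
have [fa qa] := hC _ (proj1 C1a); have [M' sa] := fa.
have sy : supported (p 0%N) (p r.+1) y by exact: supported_average.
exists (p r.+1), a; split; last first.
  move=> i hi; rewrite /a sx; last first.
    have := increasing_leq pinc (leq0n r.+1); rewrite pM; lia.
  by rewrite sy ?mulr0 ?addr0 // pM; lia.
split; first exact: (proj1 C1a).
split=> //; apply: (tnorm_le hfs sa).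
  by move=> F hF; apply: le_trans (proj2 C1a F hF) _; lra.
move=> P aP.
have half : 1 - 2^-1 = 2^-1 :> R by lra.
have ta i : q (trunc (block P i) a) <= 2^-1 * q (trunc (block P i) x) + 2^-1 * q (trunc (block P i) y).
  have -> : trunc (block P i) a =
     (fun n => 2^-1 * trunc (block P i) x n + 2^-1 * trunc (block P i) y n).
    by apply/funext => n; rewrite /trunc /a half; case: ifP; rewrite ?mulr0 ?addr0.
  have fxi := fin_trunc (block P i) fx; have fyi := fin_trunc (block P i) fy.
  apply: le_trans (fin_tnormD hfs alpha (finZ _ fxi) (finZ _ fyi)) _.
  by apply: lerD; apply: le_trans (fin_tnormZ hfs alpha _ _) _ => //; rewrite ger0_norm ?invr_ge0.
have step b : fin b -> q b <= s -> \sum_(i < #|` P|) q (trunc (block P i) b) <= 2 * s.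
  by move=> [n sb] qb; have := tnorm_step hfs alpha sb aP; lra.
apply: (@le_trans _ _ (2^-1 * (2^-1 * \sum_(i < #|` P|) q (trunc (block P i) x) +
   2^-1 * \sum_(i < #|` P|) q (trunc (block P i) y)))).
  apply: ler_wpM2l; first by rewrite invr_ge0.
  by rewrite !mulr_sumr -big_split /=; apply: ler_sum => i _; exact: ta.
have [[n nP nM]|H] := pselect (exists2 n, n \in P & (n < M)%N).
  have kM : (#|` P| <= M)%N by apply: leq_trans (aP n nP) _.
  (* [P] has at most [M] elements, while [y] is an average of more than [2 M] vectors. *)
  suff : \sum_(i < #|` P|) q (trunc (block P i) y) <= 3 / 2 * s.
    have := step x fx qx; lra.
  apply: (@le_trans _ _ (r.+1%:R^-1 * \sum_(i < #|` P|) \sum_(j < r.+1) q (trunc (block P i) (w j)))).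
    rewrite mulr_sumr; apply: ler_sum => i _.
    have -> : trunc (block P i) y =
       (fun n => r.+1%:R^-1 * \sum_(j < r.+1) trunc (block P i) (w j) n).
      apply/funext => m; rewrite /y /average /trunc mulrC; case: ifP => // _.
      by rewrite big1 ?mulr0.
    have ftw j := fin_trunc (block P i) (fw j).
    apply: le_trans (fin_tnormZ hfs alpha _ (fin_sum _ ftw)) _.
    rewrite ger0_norm ?invr_ge0 //; apply: ler_wpM2l; first by rewrite invr_ge0.
    exact: (fin_tnorm_sum hfs alpha r.+1 ftw).
  rewrite mulrC ler_pdivrMr ?ltr0n //.
  apply: le_trans (block_count hfs P r.+1 (ltW s0) pinc sw qw) _.
  rewrite mulrAC; apply: ler_wpM2r; first exact: ltW.
  have : (#|` P|)%:R * 2 <= r.+1%:R :> R by rewrite -natrM ler_nat /r; lia.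
  lra.
rewrite [X in 2^-1 * X + _]big1; first by have := step y fy qy; lra.
move=> i _; suff -> : trunc (block P i) x = (fun=> 0).
  have s00 : supp 0 (fun=> 0 : R) by [].
  apply/eqP; rewrite eq_le (good_ge0 (good_tnorm R hfs alpha) s00) andbT.
  by apply: le_trans (good_l1 (good_tnorm R hfs alpha) s00) _; rewrite big_ord0.
apply/funext => n; rewrite /trunc; case: ifPn => // /set_mem /andP[/= pn _].
apply: sx; apply/negP => /andP[_ nM]; apply: H.
exists (nth 0%N (sort leq P) i); last exact: leq_ltn_trans nM.
by rewrite -(mem_sort leq) mem_nth // size_sort.
Qed.

(** In other words, bounded successive vectors never dominate the unit vectors of [ell 1] on
    positive combinations: a convex set that escapes to infinity cannot stay away from 0. *)
Lemma far_small C (s d : R) : convex_set C -> far C -> 0 < d ->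
  (forall a, C a -> fin a /\ q a <= s) -> far (C `&` [set a | fin a /\ q a <= d]).
Proof.
move=> cC fC d0 hC; pose s' := Num.max s 1.
have s'0 : 0 < s' by rewrite lt_max ltr01 orbT.
have hn n : far (C `&` [set a | fin a /\ q a <= (7 / 8) ^+ n * s']).
  elim: n => [|n IH].
    apply: far_sub fC => a Ca; split=> //; have [fa qa] := hC a Ca; split=> //.
    by rewrite expr0 mul1r le_max qa.
  have := @far_contract (C `&` [set a | fin a /\ q a <= (7 / 8) ^+ n * s']) ((7 / 8) ^+ n * s').
  move=> /(_ (convexI cC (@convex_tnorm _ _ _ hfs _ _)) IH) h.
  have : far ((C `&` [set a | fin a /\ q a <= (7 / 8) ^+ n * s']) `&`
     [set a | fin a /\ q a <= 7 / 8 * ((7 / 8) ^+ n * s')]).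
    apply: h; first by rewrite mulr_gt0 // exprn_gt0 //; lra.
    by move=> a [_ ?].
  by apply: far_sub => a [[Ca _] ha]; split=> //; rewrite exprS -mulrA.
have [n nd] : exists n, (7 / 8) ^+ n * s' <= d :> R.
  have cv : (fun n => geometric s' (7 / 8) n) @ \oo --> (0 : R).
    by apply: cvg_geometric; rewrite ger0_norm; lra.
  have /cvgrPdist_le/(_ d d0) [n _ hn'] := cv; exists n.
  have := hn' n (leqnn n); rewrite sub0r normrN /geometric /= mulrC ger0_norm //.
  by rewrite mulr_ge0 ?exprn_ge0 ?ltW //; lra.
apply: far_sub (hn n) => a [Ca [fa qa]]; split=> //; split=> //; exact: le_trans nd.
Qed.

End Averaging.

(** * The basis of the space *)

Section Space.
Variables (R : realType) (W : omega1) (fs : W -> nat -> W).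
Hypothesis hfs : fundamental_sequences fs.
Variable alpha : W.
Variables (X : completeNormedModType R) (t : nat -> X).
Hypothesis hT : is_T fs alpha t.
Implicit Types (a b : nat -> R) (x y : X).

Local Notation q := (@tnorm R W fs alpha).

Definition psum N a : X := \sum_(i < N) a i *: t i.

Lemma norm_psum N a : `|psum N a| = q (cut N a).
Proof. exact: (proj1 hT). Qed.

Lemma psum_cut N M a : (N <= M)%N -> psum M (cut N a) = psum N a.
Proof.
move=> NM; rewrite /psum (big_ord_widen M (fun i => a i *: t i) NM).
rewrite [RHS]big_mkcond; apply: eq_bigr => i _.
by rewrite /cut; case: ifP; rewrite ?scale0r.
Qed.

Lemma psum_linear N (k : R) a b : psum N (fun i => k * a i + b i) = k *: psum N a + psum N b.
Proof.
rewrite /psum scaler_sumr -big_split; apply: eq_bigr => i _.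
by rewrite scalerDl scalerA.
Qed.

Lemma psumZ N (k : R) a : psum N (fun i => k * a i) = k *: psum N a.
Proof. by rewrite /psum scaler_sumr; apply: eq_bigr => i _; rewrite scalerA. Qed.

Lemma psumB N a b : psum N a - psum N b = psum N (fun i => a i - b i).
Proof.
rewrite addrC -scaleN1r -psum_linear; congr psum.
by apply/funext => i; rewrite mulN1r addrC.
Qed.

Lemma supp_cutE N a : supp N a -> cut N a = a.
Proof.
by move=> sa; apply/funext => i; rewrite /cut; case: ltnP => // /sa ->.
Qed.

Lemma norm_psum_fin N a : supp N a -> `|psum N a| = q a.
Proof. by move=> sa; rewrite norm_psum supp_cutE. Qed.

Lemma psum_dense x (e : R) : 0 < e -> exists a N, `|x - psum N a| < e.
Proof.
move=> e0; have [_ hd] := hT.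
have : closure [set x | exists (a : nat -> R) N, x = \sum_(i < N) a i *: t i] x by rewrite hd.
move=> /(_ _ (nbhsx_ballx x e e0))[y [[a [N ->]]]].
by rewrite -ball_normE => h; exists a, N.
Qed.

Lemma le_of_small (u v c : R) : (forall e, 0 < e -> u <= v + c * e) -> u <= v.
Proof.
move=> h; apply/ler_addgt0Pr => e e0.
have c0 : 0 < `|c| + 1 by rewrite ltr_wpDl.
apply: le_trans (h (e / (`|c| + 1)) (divr_gt0 e0 c0)) _.
rewrite lerD2l mulrA ler_pdivrMr // mulrC ler_pM2l //.
by apply: le_trans (ler_norm c) _; rewrite lerDl.
Qed.

(** The coordinate functionals of the span extend to [X] since they have norm at most 1; the
    supremum is the least 1-Lipschitz extension, as in McShane's formula. *)
Definition coord n x : R :=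
  sup [set cut z.2 z.1 n - `|x - psum z.2 z.1| | z in [set: (nat -> R) * nat]].

Lemma coord_psum_near n x N b : `|coord n x - cut N b n| <= `|x - psum N b|.
Proof.
have h a M a' M' : cut M a n - `|x - psum M a| <= cut M' a' n + `|x - psum M' a'|.
  rewrite lerBlDr -addrA -lerBlDl.
  have -> : cut M a n - cut M' a' n = (fun i => cut M a i - cut M' a' i) n by [].
  pose K := maxn M M'.
  have MK : (M <= K)%N by exact: leq_maxl.
  have M'K : (M' <= K)%N by exact: leq_maxr.
  have sK : supp K (fun i => cut M a i - cut M' a' i).
    by move=> i hi; rewrite !supp_cut ?subrr // (leq_trans _ hi).
  apply: le_trans (ler_norm _) _; apply: le_trans (tnorm_coord hfs alpha n sK) _.
  rewrite -(norm_psum_fin sK) -psumB (psum_cut _ MK) (psum_cut _ M'K).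
  by rewrite (distrC x (psum M a)) addrC; exact: ler_distD.
rewrite ler_distl; apply/andP; split.
  apply: (@le_supE R _ [set: (nat -> R) * nat]
    (fun z => cut z.2 z.1 n - `|x - psum z.2 z.1|) (cut N b n + `|x - psum N b|) (b, N)) => //.
apply: (@sup_leE R _ [set: (nat -> R) * nat]
    (fun z => cut z.2 z.1 n - `|x - psum z.2 z.1|)); first by exists (b, N).
by move=> [a M] _ /=; exact: h.
Qed.

Lemma coord_psum n N b : coord n (psum N b) = cut N b n.
Proof.
apply/eqP; rewrite -subr_eq0 -normr_le0; apply: le_trans (coord_psum_near _ _ N b) _.
by rewrite subrr normr0.
Qed.

Lemma psum_dense2 x y (e : R) : 0 < e -> exists a b N,
  `|x - psum N a| < e /\ `|y - psum N b| < e.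
Proof.
move=> e0; have [a [N ha]] := psum_dense x e0; have [b [M hb]] := psum_dense y e0.
exists (cut N a), (cut M b), (maxn N M).
by rewrite !psum_cut ?leq_maxl ?leq_maxr.
Qed.

Lemma coord_scalar n : scalar (coord n).
Proof.
move=> k x y; apply/eqP; rewrite -subr_eq0 -normr_le0.
apply: (@le_of_small _ _ (2 * (`|k| + 1))) => e e0.
have [a [b [N [ha hb]]]] := psum_dense2 x y e0.
pose c i := k * a i + b i.
have hc : `|k *: x + y - psum N c| <= (`|k| + 1) * e.
  rewrite /c psum_linear opprD addrACA -scalerBr mulrDl mul1r.
  apply: le_trans (ler_normD _ _) _; apply: lerD; last exact: ltW.
  by rewrite normrZ; apply: ler_wpM2l => //; exact: ltW.
have h1 := coord_psum_near n (k *: x + y) N c.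
have h2 := coord_psum_near n x N a; have h3 := coord_psum_near n y N b.
have cE : cut N c n = k * cut N a n + cut N b n.
  by rewrite /cut /c; case: ifP; rewrite ?mulr0 ?addr0.
have -> : coord n (k *: x + y) - (k * coord n x + coord n y) =
  (coord n (k *: x + y) - cut N c n) - k * (coord n x - cut N a n) - (coord n y - cut N b n).
  by rewrite cE; ring.
apply: le_trans (ler_normB _ _) _; apply: le_trans (lerD (ler_normB _ _) (lexx _)) _.
rewrite normrM; have := ler_wpM2l (normr_ge0 k) (le_trans h2 (ltW ha)).
have := le_trans h1 hc; have := le_trans h3 (ltW hb); lra.
Qed.

Lemma coord_le n x : `|coord n x| <= `|x|.
Proof.
have := coord_psum_near n x 0 (fun=> 0).
by rewrite /psum big_ord0 /cut !subr0.
Qed.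

Lemma scalar_funD (f : X -> R) : scalar f -> forall x y, f (x + y) = f x + f y.
Proof. by move=> hf x y; rewrite -[x]scale1r hf mul1r scale1r. Qed.

Lemma scalar_fun0 (f : X -> R) : scalar f -> f 0 = 0.
Proof. by move=> hf; have := scalar_funD hf 0 0; rewrite addr0; lra. Qed.

Lemma scalar_funZ (f : X -> R) : scalar f -> forall k x, f (k *: x) = k * f x.
Proof. by move=> hf k x; rewrite -[k *: x]addr0 hf (scalar_fun0 hf) addr0. Qed.

Lemma scalar_funB (f : X -> R) : scalar f -> forall x y, f (x - y) = f x - f y.
Proof. by move=> hf x y; rewrite (scalar_funD hf) -scaleN1r (scalar_funZ hf) mulN1r. Qed.

Lemma scalar_psum (f : X -> R) N a : scalar f -> f (psum N a) = \sum_(i < N) a i * f (t i).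
Proof.
move=> hf; rewrite /psum; elim: N => [|N IH]; first by rewrite !big_ord0 (scalar_fun0 hf).
by rewrite !big_ord_recr /= (scalar_funD hf) IH (scalar_funZ hf).
Qed.

Definition proj N x : X := psum N (coord^~ x).

Lemma proj_linear N (k : R) x y : proj N (k *: x + y) = k *: proj N x + proj N y.
Proof.
rewrite /proj -psum_linear; congr psum; apply/funext => i.
exact: coord_scalar.
Qed.

Lemma projB N x y : proj N (x - y) = proj N x - proj N y.
Proof. by rewrite addrC -scaleN1r proj_linear scaleN1r addrC. Qed.

Lemma proj_psum N M a : proj N (psum M a) = psum N (cut M a).
Proof. by congr psum; apply/funext => i; rewrite coord_psum. Qed.

Lemma proj_le N x : `|proj N x| <= `|x|.
Proof.
apply: (@le_of_small _ _ (1 + \sum_(i < N) `|t i|)) => e e0.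
have [a [M ha]] := psum_dense x e0; set y := psum M a in ha.
have h1 : `|proj N (x - y)| <= (\sum_(i < N) `|t i|) * e.
  rewrite /proj /psum; apply: le_trans (ler_norm_sum _ _ _) _; rewrite mulr_suml.
  apply: ler_sum => i _; rewrite normrZ mulrC; apply: ler_wpM2l => //.
  exact: le_trans (coord_le _ _) (ltW ha).
have h2 : `|proj N y| <= `|y|.
  rewrite proj_psum !norm_psum; have := good_cut (good_tnorm R hfs alpha) N (@supp_cut R M a).
  by [].
have h3 : `|y| <= `|x| + e.
  by rewrite -[y](subrK x); have := ler_normD (y - x) x; rewrite distrC; lra.
have -> : proj N x = proj N (x - y) + proj N y by rewrite projB subrK.
have := ler_normD (proj N (x - y)) (proj N y); lra.
Qed.

Lemma proj_near x (e : R) : 0 < e -> exists N, forall M, (N <= M)%N -> `|x - proj M x| <= e.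
Proof.
move=> e0; have e2 : 0 < e / 2 by rewrite divr_gt0.
have [a [N ha]] := psum_dense x e2; exists N => M NM.
have -> : x - proj M x = (x - psum N a) - proj M (x - psum N a).
  by rewrite projB proj_psum psum_cut // opprB subrKA.
have := ler_normB (x - psum N a) (proj M (x - psum N a)).
by have := proj_le M (x - psum N a); lra.
Qed.

Lemma norm_proj N x : `|proj N x| = q (cut N (coord^~ x)).
Proof. exact: norm_psum. Qed.

Lemma series_psum a : series (fun n => a n *: t n) = psum^~ a.
Proof. by apply/funext => N; rewrite /series /= big_mkord. Qed.

Lemma proj_cvg x : proj^~ x @ \oo --> x.
Proof.
apply/cvgrPdist_le => e e0; have [N hN] := proj_near x e0.
by exists N => // M; exact: hN.
Qed.

Lemma coord_cvg_psum a x : psum^~ a @ \oo --> x -> forall n, coord n x = a n.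
Proof.
move=> /cvgrPdist_le h n; apply/eqP; rewrite -subr_eq0 -normr_le0.
apply: (@le_of_small _ _ 1) => e e0; rewrite add0r mul1r.
have [N _ hN] := h e e0.
have := hN (maxn N n.+1) (leq_maxl _ _) => /= {}hN.
have := coord_psum_near n x (maxn N n.+1) a.
by rewrite {1}/cut leq_maxr => h'; exact: le_trans h' hN.
Qed.

Lemma basis_schauder : schauder_basis t.
Proof.
move=> x; exists (coord^~ x); split; first by rewrite series_psum; exact: proj_cvg.
by move=> a; rewrite series_psum => ha; apply/funext => n; exact: coord_cvg_psum.
Qed.

Definition cauchy_coef a := forall e : R, 0 < e -> exists N, forall M, q (cut M (tl N a)) <= e.

Lemma cut_tl N M a : psum M a - psum N a = psum M (tl N a) \/ (M < N)%N.
Proof.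
case: (ltnP M N) => NM; [by right|left].
rewrite -(psum_cut a NM) psumB; congr psum; apply/funext => i.
by rewrite /tl /cut; case: ifP; rewrite ?subrr ?subr0.
Qed.

Lemma cauchy_coef_cvg a : cauchy_coef a -> exists x, psum^~ a @ \oo --> x.
Proof.
move=> ha; suff : cvgn (psum^~ a) by move=> h; exists (lim (psum^~ a @ \oo)).
apply/cauchy_cvgP/cauchy_exP => e e0; have e2 : 0 < e / 2 by rewrite divr_gt0.
have [N hN] := ha _ e2; exists (psum N a), N => // M /= NM.
rewrite -ball_normE /ball_ /= distrC.
case: (cut_tl N M a) => [->|]; last by rewrite ltnNge NM.
by rewrite norm_psum; have := hN M; lra.
Qed.

Lemma cvg_cauchy_coef a : cvgn (psum^~ a) -> cauchy_coef a.
Proof.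
move=> /cvg_ex[x hx] e e0; have e2 : 0 < e / 2 by rewrite divr_gt0.
move: hx => /cvgrPdist_le/(_ _ e2)[N _ hN]; exists N => M.
case: (ltnP M N) => NM.
  have -> : cut M (tl N a) = cut 0 (tl N a).
    apply/funext => i; rewrite /cut /tl ltn0; case: ltnP => // iM.
    by rewrite (ltn_trans iM NM).
  by rewrite -norm_psum /psum big_ord0 normr0 ltW.
rewrite -norm_psum; case: (cut_tl N M a) => [<-|]; last by rewrite ltnNge NM.
have h1 := hN N (leqnn N); have h2 := hN M NM; simpl in h1, h2.
have := ler_distD x (psum M a) (psum N a); rewrite (distrC _ x); lra.
Qed.

Lemma le_tl a e N : (forall M, q (cut M (tl N a)) <= e) ->
  forall B M, supp M (trunc B a) -> (forall i, (i < N)%N -> i \notin B) -> q (trunc B a) <= e.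
Proof.
move=> h B M sM hB; apply: le_trans (h M).
have -> : trunc B a = trunc B (cut M (tl N a)).
  apply/funext => i; case: (ltnP i M) => iM.
    rewrite /trunc /cut /tl iM; case: ifPn => // iB.
    by case: ltnP => // /hB; rewrite iB.
  by rewrite sM // /trunc /cut ltnNge iM if_same.
by apply: (tnorm_trunc hfs); exact: supp_cut.
Qed.

(** Every tail of a rearranged series is a suppression of a tail of the series. *)
Lemma basis_unconditional : unconditional_basis t.
Proof.
split=> [|a]; first exact: basis_schauder.
rewrite series_psum => /cvg_cauchy_coef ha sigma bs.
apply/cauchy_cvgP/cauchy_exP => e e0; have e2 : 0 < e / 2 by rewrite divr_gt0.
have [N hN] := ha _ e2; have [tau sK tK] := bs.
pose n0 := (\max_(i < N) tau i).+1.
have far_sigma k : (n0 <= k)%N -> (N <= sigma k)%N.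
  move=> nk; rewrite leqNgt; apply/negP => kN; move: nk.
  rewrite /n0 ltnNge => /negP; apply; rewrite -{1}(sK k).
  exact: (@leq_bigmax _ (fun i : 'I_N => tau i) (Ordinal kN)).
exists (series (fun n => a (sigma n) *: t (sigma n)) n0), n0 => // n /= nn.
rewrite -ball_normE /ball_ /= distrC /series /= (big_cat_nat (leq0n n0) nn) /= addrAC subrr add0r.
pose B : set nat := [set i | (n0 <= tau i < n)%N].
pose M := (\max_(k < n) sigma k).+1.
have inB i : i \in B -> (n0 <= tau i < n)%N by move=> /set_mem.
have BM i : i \in B -> (i < M)%N.
  move=> /inB /andP[_ tn]; rewrite -{1}(tK i) /M ltnS.
  exact: (@leq_bigmax _ (fun k : 'I_n => sigma k) (Ordinal tn)).
have sM : supp M (trunc B a).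
  by move=> i iM; rewrite /trunc; case: ifPn => // /BM; rewrite ltnNge iM.
have -> : \sum_(n0 <= i < n) a (sigma i) *: t (sigma i) = psum M (trunc B a).
  rewrite /psum (eq_bigr (fun i : 'I_M => if (i : nat) \in B then a i *: t i else 0)); last first.
    by move=> i _; rewrite /trunc; case: ifP; rewrite ?scale0r.
  rewrite -big_mkcond -(big_mkord (fun i => i \in B) (fun i => a i *: t i)) -big_filter.
  rewrite -(big_map sigma xpredT (fun i => a i *: t i)); apply: perm_big; apply: uniq_perm.
  - by rewrite map_inj_uniq ?iota_uniq //; exact: can_inj sK.
  - by rewrite filter_uniq // iota_uniq.
  move=> i; rewrite mem_filter mem_index_iota /=; apply/mapP/andP => [[k]|[iB _]].
    rewrite mem_index_iota => hk ->; have kB : sigma k \in B by apply/mem_set; rewrite /B /= sK.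
    by split=> //; exact: BM.
  by exists (tau i); rewrite ?tK // mem_index_iota; exact: inB.
rewrite norm_psum_fin //; apply: le_lt_trans (le_tl hN sM _) _; last by lra.
by move=> i iN; apply/negP => /inB /andP[/far_sigma]; rewrite tK leqNgt iN.
Qed.

End Space.

(** * Reflexivity *)

Section DualSpace.
Variables (R : realType) (X : completeNormedModType R).
Implicit Types (f : X -> R) (x y : X).

Lemma dual_bounded f : dual_space X f -> exists2 C : R, 0 <= C & forall x, `|f x| <= C * `|x|.
Proof.
move=> [sf cf]; have := cf 0; move=> /cvgrPdist_lt/(_ 1 ltr01); rewrite (scalar_fun0 sf).
move=> /nbhs_ballP[d /= d0 hd]; exists (2 / d) => [|x]; first by rewrite divr_ge0 // ltW.
have [->|x0] := eqVneq x 0; first by rewrite (scalar_fun0 sf) !normr0 mulr0.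
have nx : 0 < `|x| by rewrite normr_gt0.
pose k := d / 2 / `|x|; have k0 : 0 < k by rewrite !divr_gt0.
have : ball 0 d (k *: x).
  rewrite -ball_normE /ball_ /= sub0r normrN normrZ gtr0_norm // /k divfK ?gt_eqF //; lra.
move=> /hd /=; rewrite sub0r normrN (scalar_funZ sf) normrM gtr0_norm // mulrC => /ltW.
rewrite -ler_pdivlMr // => /le_trans; apply.
rewrite /k le_eqVlt; apply/orP; left; apply/eqP; field.
by rewrite !gt_eqF.
Qed.

Lemma dual_norm_ge0 f : 0 <= dual_norm f.
Proof.
have [[C hC]|H] := pselect (exists C : R, forall x, `|x| <= 1 -> `|f x| <= C).
  have := @le_supE R _ [set x : X | `|x| <= 1] (fun x => `|f x|) C 0 hC.
  by rewrite /= normr0 ler01 => /(_ isT); apply: le_trans.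
rewrite /dual_norm sup_out // => -[_ [C hC]]; apply: H; exists C => x x1.
by apply: hC; exists x.
Qed.

Lemma dual_norm_ubound f x : dual_space X f -> `|f x| <= dual_norm f * `|x|.
Proof.
move=> df; have [sf _] := df; have [C C0 hC] := dual_bounded df.
have [->|x0] := eqVneq x 0; first by rewrite (scalar_fun0 sf) !normr0 mulr0.
have nx : 0 < `|x| by rewrite normr_gt0.
rewrite -ler_pdivrMr //.
have -> : `|f x| / `|x| = `|f (`|x|^-1 *: x)|.
  by rewrite (scalar_funZ sf) normrM normfV normr_id mulrC.
apply: (@le_supE R _ [set x : X | `|x| <= 1] (fun x => `|f x|) C).
  move=> y /= y1; apply: le_trans (hC y) _; by rewrite ler_piMr.
by rewrite /= normrZ normfV normr_id mulVf ?gt_eqF.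
Qed.

Lemma dual_norm_le f (C : R) : 0 <= C -> (forall x, `|f x| <= C * `|x|) -> dual_norm f <= C.
Proof.
move=> C0 h; apply: (@sup_leE R _ [set x : X | `|x| <= 1] (fun x => `|f x|)).
  by exists 0; rewrite /= normr0.
by move=> x /= x1; apply: le_trans (h x) _; rewrite ler_piMr.
Qed.

Lemma dual_intro f (C : R) : scalar f -> (forall x, `|f x| <= C * `|x|) -> dual_space X f.
Proof.
move=> sf h; split=> // x; apply/cvgrPdist_le => e e0.
have C0 : 0 < `|C| + 1 by rewrite ltr_wpDl.
apply/nbhs_ballP; exists (e / (`|C| + 1)); first exact: divr_gt0.
move=> y; rewrite -ball_normE /ball_ /= => xy.
rewrite -(scalar_funB sf); apply: le_trans (h _) _.
apply: (@le_trans _ _ ((`|C| + 1) * `|x - y|)).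
  by apply: ler_wpM2r => //; apply: le_trans (ler_norm C) _; rewrite lerDl.
by rewrite mulrC -ler_pdivlMr // ltW.
Qed.

End DualSpace.

Section Reflexivity.
Variables (R : realType) (W : omega1) (fs : W -> nat -> W).
Hypothesis hfs : fundamental_sequences fs.
Variable alpha : W.
Variables (X : completeNormedModType R) (t : nat -> X).
Hypothesis hT : is_T fs alpha t.
Implicit Types (a b k : nat -> R) (x y : X) (f : X -> R).

Local Notation q := (@tnorm R W fs alpha).

(** The vectors of norm at most 1 on which [f] is at least [e] form a convex set.  If they could be
    found arbitrarily far, some of them would have arbitrarily small norm. *)
Lemma shrinking f (e : R) : dual_space X f -> 0 < e ->
  exists N, forall M a, supported N M a -> `|f (psum t M a)| <= e * q a.
Proof.
move=> df e0; have [sf _] := df; apply: contrapT => H.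
pose C : set (nat -> R) :=
  [set a | (fin a /\ q a <= 1) /\ exists N, forall M, (N <= M)%N -> e <= f (psum t M a)].
have cC : convex_set C.
  apply: convexI; first exact: convex_tnorm.
  move=> a b l /andP[l0 l1] [N ha] [M hb]; exists (maxn N M) => K.
  rewrite geq_max => /andP[NK MK].
  rewrite psum_linear psumZ.
  rewrite sf (scalar_funZ sf); have l1' : 0 <= 1 - l by rewrite subr_ge0.
  have := ler_wpM2l l0 (ha K NK); have := ler_wpM2l l1' (hb K MK); lra.
have fC : far C.
  move=> N; have [M [a [sa hfa]]] : exists M a, supported N M a /\ e * q a < `|f (psum t M a)|.
    apply: contrapT => H'; apply: H; exists N => M a sa; rewrite leNgt; apply/negP => h.
    by apply: H'; exists M, a.
  have saM := supported_supp sa; have na := norm_psum_fin hT saM.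
  have qa : 0 < q a.
    rewrite lt_neqAle (good_ge0 (good_tnorm R hfs alpha) saM) andbT; apply/negP => /eqP qa0.
    have := dual_norm_ubound (psum t M a) df; rewrite na -qa0 mulr0.
    by move: hfa; rewrite -qa0 mulr0 => /lt_le_trans h /h; rewrite ltxx.
  pose k := Num.sg (f (psum t M a)) / q a.
  exists M, (fun i => k * a i); split; last by move=> i hi; rewrite sa ?mulr0.
  have sk : supp M (fun i => k * a i) by exact: suppZ.
  split; [split; first by exists M|].
    apply: le_trans (goodZ (good_tnorm R hfs alpha) k saM) _.
    rewrite /k normrM normfV (gtr0_norm qa) divfK ?gt_eqF // normr_sg.
    by case: eqP.
  exists M => K MK; rewrite -(supp_cutE sk) psum_cut //.
  rewrite psumZ.
  rewrite (scalar_funZ sf) /k mulrAC -normrEsg ler_pdivlMr //; exact: ltW.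
have D0 : 0 < dual_norm f + 1 by rewrite ltr_wpDl // dual_norm_ge0.
have d0 : 0 < e / 2 / (dual_norm f + 1) by rewrite divr_gt0 // divr_gt0.
have [M [a [[[_ [N ha]] [[K sa] qa]] _]]] := far_small hfs cC fC d0 (fun a ha => proj1 ha) 0.
have := ha (maxn N K) (leq_maxl _ _); apply/negP; rewrite -ltNge.
apply: le_lt_trans (ler_norm _) _; apply: le_lt_trans (dual_norm_ubound _ df) _.
have sa' : supp (maxn N K) a by move=> i hi; apply: sa; apply: leq_trans hi; exact: leq_maxr.
rewrite (norm_psum_fin hT sa').
have := ler_wpM2l (dual_norm_ge0 f) qa.
have : dual_norm f * (e / 2 / (dual_norm f + 1)) <= e / 2.
  rewrite mulrA ler_pdivrMr // mulrC; apply: ler_wpM2l; first lra.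
  by rewrite lerDl.
lra.
Qed.

(** The starting points of [n] successive intervals form an admissible set as soon as the first
    of them is large enough. *)
Lemma successive_lower (p : nat -> nat) n M a : (forall i, (p i < p i.+1)%N) ->
  (n <= (p 0).+1)%N -> supp M a ->
  2^-1 * \sum_(i < n) q (trunc [set m | (p i <= m < p i.+1)%N] a) <= q a.
Proof.
move=> pinc np sa.
pose P : {fset nat} := [fset i in [seq p i | i <- iota 0 n]]%fset.
have pmono i j : (i < j)%N -> (p i < p j)%N.
  by move=> ij; apply: leq_trans (pinc i) (increasing_leq pinc ij).
have pinj : injective p.
  move=> i j pij; case: (ltngtP i j) => // /pmono; by rewrite pij ltnn.
have us : uniq [seq p i | i <- iota 0 n] by rewrite map_inj_uniq // iota_uniq.
have sP : sort leq P = [seq p i | i <- iota 0 n].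
  apply: (@sorted_eq _ leq leq_trans anti_leq).
  - exact: (sort_sorted leq_total).
  - rewrite sorted_map; apply: (@sub_sorted _ leq); last exact: iota_sorted.
    by move=> i j; exact: increasing_leq.
  - rewrite perm_sort; apply: uniq_perm => //; first exact: fset_uniq.
    by move=> i; rewrite inE.
have cP : #|` P| = n by rewrite -(size_sort leq) sP size_map size_iota.
have nP i : (i < n)%N -> nth 0%N (sort leq P) i = p i.
  by move=> iN; rewrite sP (nth_map 0%N) ?size_iota // nth_iota.
have aP : admissible P.
  move=> i; rewrite cP !inE => /mapP[j _ ->].
  by apply: leq_trans np _; rewrite ltnS; exact: increasing_leq.
apply: le_trans (tnorm_step hfs alpha sa aP).
rewrite cP; apply: ler_wpM2l; first by rewrite invr_ge0.
apply: ler_sum => i _.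
have -> : trunc [set m | (p i <= m < p i.+1)%N] a =
   trunc [set m | (p i <= m < p i.+1)%N] (trunc (block P i) a).
  apply/funext => m; rewrite /trunc; case: ifPn => // /set_mem /= /andP[h1 h2].
  suff -> : (m : nat) \in block P i by [].
  apply/mem_set/andP; split; first by rewrite nP.
  by apply/implyP; rewrite cP => iN; rewrite nP.
by apply: (tnorm_trunc hfs); exact: supp_trunc sa.
Qed.

(** Otherwise there are successive blocks of norm greater than [e], and a sum of [n] of them far
    enough to the right has norm at least [n * e / 2]. *)
Lemma boundedly_complete a (C : R) : (forall N, q (cut N a) <= C) ->
  exists x, forall n, coord t n x = a n.
Proof.
move=> hC; suff : cauchy_coef fs alpha a.
  by move=> /(cauchy_coef_cvg hT)[x hx]; exists x; exact: (coord_cvg_psum hfs hT hx).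
move=> e e0; apply: contrapT => H.
pose Q N M b := b = trunc [set m | (N <= m < M)%N] a /\ e < q b.
have hQ N : exists M b, (N < M)%N /\ Q N M b.
  have [M hM] : exists M, e < q (cut M (tl N a)).
    apply: contrapT => H'; apply: H; exists N => M; rewrite leNgt; apply/negP => h.
    by apply: H'; exists M.
  have E : cut M (tl N a) = trunc [set m | (N <= m < M)%N] a.
    apply/funext => i; rewrite truncE /cut /tl.
    by case: (ltnP i M) => iM; case: (ltnP i N).
  exists M, (trunc [set m | (N <= m < M)%N] a); rewrite -E; split; last by split=> //.
  rewrite ltnNge; apply/negP => MN; move: hM; rewrite ltNge => /negP; apply.
  apply: le_trans (ltW e0).
  have s0 : supp 0 (cut M (tl N a)).
    move=> i _; rewrite /cut /tl; case: ltnP => // iM.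
    by rewrite (leq_trans iM MN).
  by apply: le_trans (good_l1 (good_tnorm R hfs alpha) s0) _; rewrite big_ord0.
have [n hn] := nat_upper_bound (2 * C / e + 1).
have [p [w [p0 hp]]] := choose_successive hQ n.
have pinc i : (p i < p i.+1)%N by have [] := hp i.
have np : (n <= (p 0).+1)%N by rewrite p0.
have := successive_lower pinc np (@supp_cut R (p n) a).
apply/negP; rewrite -ltNge; apply: le_lt_trans (hC (p n)) _.
apply: (@lt_le_trans _ _ (2^-1 * (n%:R * e))).
  move: hn; rewrite -lerBrDr ler_pdivrMr // mulrBl mul1r; lra.
apply: ler_wpM2l; first by rewrite invr_ge0.
rewrite mulr_natl -[n in X in X <= _]card_ord -sumr_const; apply: ler_sum => i _.
have [_ [wE ew]] := hp i.
have -> : trunc [set m | (p i <= m < p i.+1)%N] (cut (p n) a) = w i; last exact: ltW.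
rewrite wE; apply/funext => m; rewrite !truncE; case: ifP => // /andP[_ h].
by rewrite /cut (leq_trans h) // increasing_leq.
Qed.

(** Read off from the recursion that defines the norm, these finite combinations of coordinates do
    the work of the theorem of Hahn and Banach in the proof of reflexivity. *)
Lemma norming_functional N a (e : R) : supp N a -> 0 < e ->
  exists k, [/\ supp N k, forall b, fin b -> `|\sum_(i < N) k i * b i| <= q b &
    q a <= \sum_(i < N) k i * a i + e].
Proof.
have main m : forall a (e : R), supp N a -> 0 < e ->
  exists k, [/\ supp N k, forall b, fin b -> `|\sum_(i < N) k i * b i| <= q b &
    tnorm_ fs alpha m a <= \sum_(i < N) k i * a i + e].
  elim: m => [|m IH] {}a {}e sa e0 /=.
    have hs : has_sup [set `|fsum F a| | F in schreier fs alpha].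
      split; first by exists `|fsum fset0 a|, fset0 => //; exact: (schreier_empty hfs).
      by exists (\sum_(i < N) `|a i|) => _ [F hF <-]; exact: (fsum_bounded sa hF).
    have [_ [F hF <-] hFe] := sup_adherent e0 hs.
    pose G := [fset i in F | (i < N)%N]%fset.
    have hG : schreier fs alpha G by exact: schreier_filter.
    pose s := Num.sg (fsum F a).
    have kE b : \sum_(i < N) (if (i : nat) \in F then s else 0) * b i = s * fsum G b.
      rewrite /fsum mulr_sumr.
      rewrite (eq_bigr (fun i : 'I_N => if (i : nat) \in F then s * b i else 0)); last first.
        by move=> i _; case: ifP; rewrite ?mul0r.
      rewrite -big_mkcond -(big_mkord (fun i => i \in F) (fun i => s * b i)) -big_filter.
      apply: perm_big; apply: uniq_perm; rewrite ?filter_uniq ?iota_uniq ?fset_uniq //.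
      by move=> i; rewrite mem_filter mem_index_iota !inE.
    exists (fun i => if (i < N)%N && (i \in F) then s else 0); split.
    - by move=> i Ni; rewrite ltnNge Ni.
    - move=> b [M sb]; rewrite (eq_bigr (fun i : 'I_N => (if (i : nat) \in F then s else 0) * b i)).
        rewrite kE normrM; apply: le_trans (fsum_le_tnorm hfs sb hG).
        rewrite ler_piMl // /s normr_sg; by case: eqP.
      by move=> i _; rewrite ltn_ord.
    - rewrite (eq_bigr (fun i : 'I_N => (if (i : nat) \in F then s else 0) * a i)); last first.
        by move=> i _; rewrite ltn_ord.
      rewrite kE -(_ : fsum F a = fsum G a).
        by rewrite /s -normrEsg; move: hFe; rewrite /tnorm0 /fsum; lra.
      rewrite /fsum (bigID (fun i => (i < N)%N)) /= [X in _ + X]big1 ?addr0; last first.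
        by move=> i; rewrite -leqNgt; exact: sa.
      rewrite -big_filter; apply: perm_big; apply: uniq_perm; rewrite ?filter_uniq ?fset_uniq //.
      by move=> i; rewrite mem_filter !inE andbC.
  have [h|h] := leP (2^-1 * sup [set \sum_(i < #|` P|) tnorm_ fs alpha m (trunc (block P i) a)
                  | P in admissible]) (tnorm_ fs alpha m a); first exact: IH.
  have hs : has_sup [set \sum_(i < #|` P|) tnorm_ fs alpha m (trunc (block P i) a)
                  | P in admissible].
    split; last first.
      by exists (\sum_(n < N) `|a n|) => _ [P _ <-]; exact: (block_sum_le hfs).
    have aP0 : admissible fset0 by move=> i; rewrite inE.
    by eexists; exists fset0; first exact: aP0.
  have [_ [P aP <-] hP] := sup_adherent e0 hs.
  pose d : R := e / (#|` P|).+1%:R.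
  have d0 : 0 < d by rewrite divr_gt0 // ltr0n.
  have /choice[k hk] : forall i, exists k, [/\ supp N k,
      forall b, fin b -> `|\sum_(i < N) k i * b i| <= q b &
      tnorm_ fs alpha m (trunc (block P i) a) <= \sum_(j < N) k j * trunc (block P i) a j + d].
    by move=> i; apply: IH => //; exact: supp_trunc.
  pose K n := 2^-1 * \sum_(i < #|` P|) trunc (block P i) (k i) n.
  have KE b : \sum_(n < N) K n * b n =
      2^-1 * \sum_(i < #|` P|) \sum_(n < N) k i n * trunc (block P i) b n.
    rewrite exchange_big /= mulr_sumr; apply: eq_bigr => n _.
    rewrite /K -mulrA mulr_suml; congr (_ * _); apply: eq_bigr => i _.
    by rewrite /trunc; case: ifP; rewrite ?mulr0 ?mul0r.
  exists K; split.
  - move=> n Nn; rewrite /K big1 ?mulr0 // => i _; apply: supp_trunc Nn.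
    by have [] := hk i.
  - move=> b fb; rewrite KE normrM gtr0_norm ?invr_gt0 //; have [M sb] := fb.
    apply: le_trans (tnorm_step hfs alpha sb aP); apply: ler_wpM2l; first by rewrite invr_ge0.
    apply: le_trans (ler_norm_sum _ _ _) _; apply: ler_sum => i _.
    by have [_ h' _] := hk i; apply: h'; exact: fin_trunc.
  - rewrite KE.
    have : \sum_(i < #|` P|) tnorm_ fs alpha m (trunc (block P i) a) <=
       \sum_(i < #|` P|) \sum_(n < N) k i n * trunc (block P i) a n + e.
      apply: (@le_trans _ _ (\sum_(i < #|` P|) (\sum_(n < N) k i n * trunc (block P i) a n + d))).
        by apply: ler_sum => i _; have [] := hk i.
      rewrite big_split /= lerD2l sumr_const card_ord -[_ *+ _]mulr_natl /d.
      by rewrite mulrA ler_pdivrMr ?ltr0n // mulrC ler_pM2l // ler_nat.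
    lra.
move=> sa e0; have e2 : 0 < e / 2 by rewrite divr_gt0.
have [m hm] : exists m, q a <= tnorm_ fs alpha m a + e / 2.
  apply: contrapT => H; have : q a <= q a - e / 2; last lra.
  apply: (proj2 (tnorm_cvg hfs alpha sa)) => m.
  rewrite leNgt; apply/negP => h; apply: H; exists m; lra.
have [k [sk hk ak]] := main m a _ sa e2.
exists k; split=> //; lra.
Qed.

Lemma coord_dual n : dual_space X (coord t n).
Proof.
apply: (@dual_intro _ _ _ 1); first exact: (coord_scalar hfs hT).
by move=> x; rewrite mul1r; exact: (coord_le hfs hT).
Qed.

Definition functional N k x : R := \sum_(i < N) k i * coord t i x.

Lemma functional_scalar N k : scalar (functional N k).
Proof.
move=> l x y; rewrite /functional mulr_sumr -big_split; apply: eq_bigr => i _.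
by rewrite (coord_scalar hfs hT) /=; ring.
Qed.

Lemma functional_le N k x : (forall b, fin b -> `|\sum_(i < N) k i * b i| <= q b) ->
  `|functional N k x| <= `|x|.
Proof.
move=> hk; apply: le_trans (proj_le hfs hT N x).
rewrite (norm_proj hT); apply: le_trans (hk _ _); last by exists N; exact: supp_cut.
by rewrite /functional le_eqVlt; apply/orP; left; apply/eqP; congr `|_|;
  apply: eq_bigr => i _; rewrite /cut ltn_ord.
Qed.

Lemma functional_dual N k : dual_space X (functional N k).
Proof.
apply: (@dual_intro _ _ _ (\sum_(i < N) `|k i|)); first exact: functional_scalar.
move=> x; rewrite /functional; apply: le_trans (ler_norm_sum _ _ _) _; rewrite mulr_suml.
apply: ler_sum => i _; rewrite normrM; apply: ler_wpM2l => //; exact: (coord_le hfs hT).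
Qed.

Section Bidual.
Variable Phi : (X -> R) -> R.
Hypothesis Phi_linear : forall (k : R) (f g : X -> R), dual_space X f -> dual_space X g ->
  Phi (fun x => k * f x + g x) = k * Phi f + Phi g.

Lemma bidual_functional N k : Phi (functional N k) = \sum_(i < N) k i * Phi (coord t i).
Proof.
elim: N => [|N IH].
  have d0 : dual_space X (functional 0 k) by exact: functional_dual.
  have := Phi_linear 1 d0 d0; rewrite big_ord0.
  have -> : (fun x => 1 * functional 0 k x + functional 0 k x) = functional 0 k.
    by apply/funext => x; rewrite /functional !big_ord0 mulr0 addr0.
  by rewrite mul1r; lra.
have -> : functional N.+1 k = (fun x => k N * coord t N x + functional N k x).
  by apply/funext => x; rewrite /functional big_ord_recr addrC.
rewrite Phi_linear; [|exact: coord_dual|exact: functional_dual].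
by rewrite IH big_ord_recr addrC.
Qed.

End Bidual.

(** The basis is shrinking and boundedly complete.  An element [Phi] of the bidual is determined
    by its values at the coordinate functionals, as these span a dense subspace of the dual;
    and the series with these values as coefficients has bounded partial sums. *)
Lemma space_reflexive : reflexive_space X.
Proof.
move=> Phi Plin [C hC].
pose C' := Num.max C 0; have C'0 : 0 <= C' by rewrite le_max lexx orbT.
have hC' f : dual_space X f -> `|Phi f| <= C' * dual_norm f.
  move=> df; apply: le_trans (hC f df) _; apply: ler_wpM2r; first exact: dual_norm_ge0.
  by rewrite le_max lexx.
pose g n := Phi (coord t n).
have [x hx] : exists x, forall n, coord t n x = g n.
  apply: (@boundedly_complete g C') => N.
  apply: (@le_of_small R _ _ 1) => e e0; rewrite mul1r.
  have [k [sk hk ak]] := norming_functional (@supp_cut R N g) e0.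
  apply: le_trans ak _; rewrite lerD2r.
  have -> : \sum_(i < N) k i * cut N g i = Phi (functional N k).
    by rewrite bidual_functional //; apply: eq_bigr => i _; rewrite /cut ltn_ord.
  apply: le_trans (ler_norm _) _; apply: le_trans (hC' _ (functional_dual N k)) _.
  rewrite ler_piMr //; apply: dual_norm_le => // y; rewrite mul1r.
  exact: functional_le.
exists x => f df; have [sf _] := df.
apply/eqP; rewrite -subr_eq0 -normr_le0.
apply: (@le_of_small R _ _ (C' + dual_norm f)) => e e0; rewrite add0r.
have [N1 hN1] := shrinking df e0; have [N2 hN2] := proj_near hfs hT x e0.
pose N := maxn N1 N2.
have fproj y : f (proj t N y) = functional N (fun i => f (t i)) y.
  rewrite /proj (scalar_psum _ _ _ sf) /functional; apply: eq_bigr => i _; exact: mulrC.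
(* [r] only sees the part of [y] beyond [N], hence is small by the choice of [N1]. *)
pose r y := f y - functional N (fun i => f (t i)) y.
have rE y : r y = f (y - proj t N y) by rewrite (scalar_funB sf) fproj.
have sr : scalar r.
  by move=> k u v; rewrite /r sf (functional_scalar N (fun i => f (t i)) k u v); ring.
have hr y : `|r y| <= e * `|y|.
  apply: (@le_of_small R _ _ (dual_norm f)) => d d0.
  have [M1 hM1] := proj_near hfs hT y d0; pose M := maxn M1 N.
  have -> : r y = f (y - proj t M y) + f (psum t M (tl N (coord t^~ y))).
    have [E|] := cut_tl t N M (coord t^~ y); last by rewrite ltnNge leq_maxr.
    by rewrite rE -E -(scalar_funD sf) subrKA.
  rewrite addrC; apply: le_trans (ler_normD _ _) _; apply: lerD; last first.
    apply: le_trans (dual_norm_ubound _ df) _; apply: ler_wpM2l; first exact: dual_norm_ge0.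
    by apply: hM1; rewrite leq_maxl.
  rewrite -(psum_cut t _ (leqnn M)); apply: le_trans (hN1 M _ _) _.
    move=> i hi; rewrite /cut /tl; case: ltnP => // iM; case: ltnP => // Ni.
    by exfalso; move/negP: hi; apply; rewrite iM (leq_trans (leq_maxl _ _) Ni).
  apply: ler_wpM2l; first exact: ltW.
  apply: le_trans (proj_le hfs hT M y); rewrite (norm_proj hT).
  have -> : cut M (tl N (coord t^~ y)) = trunc [set i | (N <= i)%N] (cut M (coord t^~ y)).
    apply/funext => i; rewrite truncE /cut /tl.
    by case: (ltnP i M) => iM; case: (ltnP i N).
  by apply: (tnorm_trunc hfs); exact: supp_cut.
have dr : dual_space X r by exact: dual_intro sr hr.
have fE : f = (fun y => 1 * r y + functional N (fun i => f (t i)) y).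
  by apply/funext => y; rewrite /r mul1r subrK.
have -> : Phi f - f x = Phi r - f (x - proj t N x).
  rewrite [in Phi f]fE Plin //; last exact: functional_dual.
  rewrite mul1r bidual_functional // (scalar_funB sf) fproj /functional.
  rewrite (eq_bigr (fun i : 'I_N => f (t i) * coord t i x)); first by ring.
  by move=> i _; rewrite hx.
apply: le_trans (ler_normB _ _) _; rewrite mulrDl; apply: lerD.
  apply: le_trans (hC' _ dr) _; apply: ler_wpM2l => //.
  by apply: dual_norm_le hr; exact: ltW.
apply: le_trans (dual_norm_ubound _ df) _; apply: ler_wpM2l; first exact: dual_norm_ge0.
by apply: hN2; rewrite leq_maxr.
Qed.

End Reflexivity.

(** * Obstructions to copies of c0 and ell p *)

Section Subspaces.
Variables (R : realType) (W : omega1) (fs : W -> nat -> W).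
Hypothesis hfs : fundamental_sequences fs.
Variable alpha : W.
Variables (X : completeNormedModType R) (t : nat -> X).
Hypothesis hT : is_T fs alpha t.
Implicit Types (a b : nat -> R) (x : X) (y : nat -> X).

Local Notation q := (@tnorm R W fs alpha).

Lemma proj_small n (e : R) : 0 < e -> exists2 d : R, 0 < d &
  forall x, (forall i, (i < n)%N -> `|coord t i x| <= d) -> `|proj t n x| <= e.
Proof.
move=> e0; pose K := \sum_(i < n) `|t i| + 1.
have K0 : 0 < K by rewrite ltr_wpDl // sumr_ge0.
exists (e / K); first exact: divr_gt0.
move=> x hx; rewrite /proj /psum; apply: le_trans (ler_norm_sum _ _ _) _.
apply: (@le_trans _ _ (\sum_(i < n) e / K * `|t i|)).
  by apply: ler_sum => i _; rewrite normrZ; apply: ler_wpM2r => //; exact: hx.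
rewrite -mulr_sumr -mulrA ger_pMr // mulrC ler_pdivrMr // mul1r /K.
by rewrite lerDl.
Qed.

(** The step of a gliding hump argument, which replaces vectors that tend to 0 in each coordinate
    by vectors with successive supports. *)
Lemma near_block n (e : R) : 0 < e -> exists2 d : R, 0 < d &
  forall x, (forall i, (i < n)%N -> `|coord t i x| <= d) ->
  exists M, forall M', (M <= M')%N -> (n <= M')%N /\
    `|x - psum t M' (cut M' (tl n (coord t^~ x)))| <= e.
Proof.
move=> e0; have e2 : 0 < e / 2 by rewrite divr_gt0.
have [d d0 hd] := proj_small n e2; exists d => // x /hd hx.
have [M hM] := proj_near hfs hT x e2; exists (maxn M n) => M'.
rewrite geq_max => /andP[MM' nM']; split=> //.
rewrite psum_cut //; have [<-|] := cut_tl t n M' (coord t^~ x); last by rewrite ltnNge nM'.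
rewrite opprB addrCA addrC; apply: le_trans (ler_normD _ _) _.
by have := hM M' MM'; rewrite /proj in hx *; lra.
Qed.

Lemma psum_supp y N M a : (N <= M)%N -> supp N a -> psum y M a = psum y N a.
Proof. by move=> NM sa; rewrite -(psum_cut y a NM) supp_cutE. Qed.

Lemma supp_le N M a : (N <= M)%N -> supp N a -> supp M a.
Proof. by move=> NM sa i Mi; apply: sa; exact: leq_trans Mi. Qed.

(** Signed sums of [k] unit vectors, whose norm is 1 in [c0] and the [p]-th root of [k] in
    [ell p]. *)
Definition signs k M b :=
  [/\ supp M b, forall i, b i = 0 \/ `|b i| = 1 & \sum_(i < M) `|b i| = k%:R].

Lemma sum_supp N M (f : R -> R) a : (N <= M)%N -> supp N a -> f 0 = 0 ->
  \sum_(i < M) f (a i) = \sum_(i < N) f (a i).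
Proof.
move=> NM sa f0; rewrite (big_ord_widen M (fun i => f (a i)) NM) [RHS]big_mkcond.
by apply: eq_bigr => i _; case: ltnP => // /sa ->.
Qed.

Lemma signs_le k N M b : (N <= M)%N -> signs k N b -> signs k M b.
Proof.
move=> NM [sb hb kb]; split=> //; first exact: supp_le sb.
by rewrite (sum_supp (f := fun r => `|r|) NM sb) ?normr0.
Qed.

Lemma signs_add y k M b j (s : R) : signs k M b -> (M <= j)%N -> `|s| = 1 ->
  exists b', signs k.+1 j.+1 b' /\ psum y j.+1 b' = psum y M b + s *: y j.
Proof.
move=> hb Mj s1; have [sb b01 kb] := signs_le Mj hb.
pose b' i := if i == j then s else b i; exists b'.
have b'E (i : 'I_j) : b' i = b i by rewrite /b' ltn_eqF.
have b'j : b' j = s by rewrite /b' eqxx.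
split; first split.
- by move=> i ji; rewrite /b' gtn_eqF // sb // ltnW.
- by move=> i; rewrite /b'; case: eqP => _; [right|exact: b01].
- rewrite big_ord_recr /= b'j s1 -natr1 -kb; congr (_ + _).
  by apply: eq_bigr => i _; rewrite b'E.
- rewrite /psum big_ord_recr /= b'j; congr (_ + _).
  have [sbM _ _] := hb; rewrite -/(psum y M b) -(psum_supp y Mj sbM).
  by apply: eq_bigr => i _; rewrite b'E.
Qed.

Lemma signs0 : signs 0 0 (fun=> 0).
Proof. by split=> // [i|]; [left|rewrite big_ord0]. Qed.

(** If for suitable [k] all signed sums of [k] terms have norm at most [e * k], then each
    coordinate of [y j] tends to 0, since a suitable choice of signs adds up its absolute values.
    So the sequence contains almost successive vectors; but the sum of [k] of these far to the
    right has norm at least about [k / 2] times the lower bound [c]. *)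
Lemma sublinear_absurd y (c : R) : 0 < c -> (forall j, c <= `|y j|) ->
  (forall e : R, 0 < e -> exists2 k, (0 < k)%N &
     forall M b, signs k M b -> `|psum y M b| <= e * k%:R) -> False.
Proof.
move=> c0 hy hs.
have coord_null n (e : R) : 0 < e -> exists J, forall j, (J <= j)%N -> `|coord t n (y j)| <= e.
  move=> e0; apply: contrapT => H.
  have {}H J : exists2 j, (J <= j)%N & e < `|coord t n (y j)|.
    apply: contrapT => H'; apply: H; exists J => j Jj; rewrite leNgt; apply/negP => h.
    by apply: H'; exists j.
  have build k : exists M b, signs k M b /\ e * k%:R <= coord t n (psum y M b).
    elim: k => [|k [M [b [sb hb]]]].
      exists 0%N, (fun=> 0); split; first exact: signs0.
      by rewrite mulr0 /psum big_ord0 (scalar_fun0 (coord_scalar hfs hT n)).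
    have [j Mj hj] := H M; pose s := Num.sg (coord t n (y j)).
    have s1 : `|s| = 1.
      rewrite /s normr_sg; case: eqP => // E; move: hj; rewrite E normr0 => /(lt_trans e0).
      by rewrite ltxx.
    have [b' [sb' Eb']] := signs_add y sb Mj s1; exists j.+1, b'; split=> //.
    rewrite Eb' (scalar_funD (coord_scalar hfs hT n)) (scalar_funZ (coord_scalar hfs hT n)).
    by rewrite /s -normrEsg -natr1 mulrDr mulr1; apply: lerD => //; exact: ltW.
  have e2 : 0 < e / 2 by rewrite divr_gt0.
  have [k k0 hk] := hs _ e2; have [M [b [sb hb]]] := build k.
  have h1 := le_trans (ler_norm _) (coord_le hfs hT n (psum y M b)).
  have h2 := hk M b sb; have k0' : 0 < k%:R :> R by rewrite ltr0n.
  have := mulr_gt0 e0 k0'; lra.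
have coords_null N (e : R) : 0 < e ->
    exists J, forall j, (J <= j)%N -> forall i, (i < N)%N -> `|coord t i (y j)| <= e.
  move=> e0; elim: N => [|N [J hJ]]; first by exists 0%N.
  have [J' hJ'] := coord_null N e e0; exists (maxn J J') => j; rewrite geq_max => /andP[Jj J'j] i.
  by rewrite ltnS leq_eqVlt => /orP[/eqP ->|iN]; [exact: hJ'|exact: hJ].
have c8 : 0 < c / 8 by rewrite divr_gt0.
pose Q N M a := [/\ supported N M a & exists2 j, (N <= j < M)%N & `|y j - psum t M a| <= c / 8].
have hQ N : exists M a, (N < M)%N /\ Q N M a.
  have [d d0 hd] := near_block N c8; have [J hJ] := coords_null N d d0.
  pose j := maxn N J; have [M hM] := hd (y j) (hJ j (leq_maxr _ _)).
  pose M' := maxn M j.+1; have [NM' h] := hM M' (leq_maxl _ _).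
  have jM : (j < M')%N by rewrite leq_maxr.
  exists M', (cut M' (tl N (coord t^~ (y j)))); split.
    by apply: leq_trans jM; rewrite ltnS leq_maxl.
  split; last by exists j; rewrite ?jM ?leq_maxl.
  move=> i hi; rewrite /cut /tl; case: ltnP => // iM; case: ltnP => // Ni.
  by move: hi; rewrite Ni iM.
(* Starting the blocks at [k] makes [k] of them admissible. *)
have [k k0 hk] := hs _ c8.
have [p [w [p0 hp]]] := choose_successive hQ k.
have pinc i : (p i < p i.+1)%N by have [] := hp i.
have sw i : supported (p i) (p i.+1) (w i) by have [_ []] := hp i.
have sww i : supp (p i.+1) (w i) by exact: supported_supp (sw i).
have /choice[j hj] : forall i, exists j, (p i <= j < p i.+1)%N /\
    `|y j - psum t (p i.+1) (w i)| <= c / 8.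
  by move=> i; have [_ [_ [j ? ?]]] := hp i; exists j.
have build m : exists b, signs m (p m) b /\ psum y (p m) b = \sum_(i < m) y (j i).
  elim: m => [|m [b [sb Eb]]].
    exists (fun=> 0); split; first exact: signs_le signs0.
    by rewrite big_ord0 /psum big1 // => i _; rewrite scale0r.
  have [/andP[pj jp] _] := hj m.
  have [b' [sb' Eb']] := signs_add y sb pj (normr1 R).
  exists b'; split; first exact: signs_le sb'.
  have [sb'' _ _] := sb'; rewrite (psum_supp y jp sb'') Eb' Eb big_ord_recr /= scale1r.
  by [].
have [b [sb Eb]] := build k.
have up := hk _ _ sb; rewrite Eb in up.
pose A i := \sum_(l < k) w l i.
have sA : supp (p k) A.
  move=> i hi; rewrite /A big1 // => l _; apply: sww; apply: leq_trans hi.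
  exact: increasing_leq.
have np : (k <= (p 0).+1)%N by rewrite p0.
have low := successive_lower hfs alpha pinc np sA.
have tA (i : 'I_k) : trunc [set m | (p i <= m < p i.+1)%N] A = w i.
  apply/funext => m; rewrite truncE /A; case: ifPn => hm; last by rewrite sw.
  rewrite (bigD1 i) //= big1 ?addr0 // => l li; apply: sw; apply/negP => hl.
  case: (ltngtP i l) => [h|h|/val_inj E]; last by rewrite E eqxx in li.
    by have := increasing_leq pinc h; lia.
  by have := increasing_leq pinc h; lia.
have qw i : c - c / 8 <= q (w i).
  rewrite -(norm_psum_fin hT (sww i)); have [_ h] := hj i.
  have := ler_normD (y (j i) - psum t (p i.+1) (w i)) (psum t (p i.+1) (w i)).
  by rewrite subrK; have := hy (j i); lra.
have qA : q A <= `|\sum_(i < k) y (j i)| + k%:R * (c / 8).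
  rewrite -(norm_psum_fin hT sA).
  have -> : psum t (p k) A = \sum_(i < k) psum t (p i.+1) (w i).
    rewrite /psum /A; under eq_bigr do rewrite scaler_suml.
    rewrite exchange_big; apply: eq_bigr => i _ /=.
    by rewrite -/(psum t (p k) (w i)) (psum_supp t _ (sww i)) // increasing_leq.
  have -> : \sum_(i < k) psum t (p i.+1) (w i) =
     \sum_(i < k) y (j i) - \sum_(i < k) (y (j i) - psum t (p i.+1) (w i)).
    by rewrite -sumrB; apply: eq_bigr => i _; rewrite opprB addrC subrK.
  apply: le_trans (ler_normB _ _) _; rewrite lerD2l.
  apply: le_trans (ler_norm_sum _ _ _) _.
  rewrite mulr_natl -[k in X in _ <= X]card_ord -sumr_const; apply: ler_sum => i _.
  by have [] := hj i.
have lowk : k%:R * (c - c / 8) <= \sum_(i < k) q (trunc [set m | (p i <= m < p i.+1)%N] A).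
  rewrite mulr_natl -[k in X in X <= _]card_ord -sumr_const; apply: ler_sum => i _.
  by rewrite tA.
have k0' : 0 < k%:R :> R by rewrite ltr0n.
have := mulr_gt0 k0' c0; lra.
Qed.

End Subspaces.

Section EllOne.
Variables (R : realType) (W : omega1) (fs : W -> nat -> W).
Hypothesis hfs : fundamental_sequences fs.
Variable alpha : W.
Variables (X : completeNormedModType R) (t : nat -> X).
Hypothesis hT : is_T fs alpha t.
Implicit Types (a b : nat -> R) (x : X) (y : nat -> X).

Local Notation q := (@tnorm R W fs alpha).

(** By compactness of cubes a bounded sequence has a coordinatewise cluster point [g]; the partial
    sums of [g] are bounded, so [g] comes from a vector of [X]. *)
Lemma coord_cluster y (K : R) : (forall j, `|y j| <= K) ->
  exists x, forall (e : R) N J, 0 < e ->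
    exists2 j, (J <= j)%N & forall i, (i < N)%N -> `|coord t i (y j - x)| <= e.
Proof.
move=> hy.
pose F : set_system {ptws nat -> R} := fmap (fun j => (coord t^~ (y j) : {ptws nat -> R})) \oo.
have FF : ProperFilter F by exact: fmap_proper_filter.
have cA : compact [set f : {ptws nat -> R} | forall n, [set` `[- K, K]] (f n)].
  by apply: (@tychonoff nat (fun=> R) (fun=> [set` `[- K, K]])) => i; exact: segment_compact.
have FA : F [set f : {ptws nat -> R} | forall n, [set` `[- K, K]] (f n)].
  exists 0%N => // j _ n; rewrite /= in_itv /= -ler_norml.
  exact: le_trans (coord_le hfs hT _ _) (hy j).
have [g [_ cg]] := cA F FF FA.
have near_g (e : R) N J : 0 < e ->
    exists2 j, (J <= j)%N & forall i, (i < N)%N -> `|coord t i (y j) - g i| <= e.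
  move=> e0.
  have FJ : F [set f | exists2 j, (J <= j)%N & f = coord t^~ (y j)].
    by exists J => // j Jj; exists j.
  have ng : nbhs g [set f : {ptws nat -> R} | forall i : 'I_N, `|f i - g i| <= e].
    have ni (i : 'I_N) : nbhs g [set f : {ptws nat -> R} | `|f i - g i| <= e].
      have hi : nbhs (g i) [set r : R | `|r - g i| <= e].
        apply/nbhs_ballP; exists e => //= r; rewrite -ball_normE /ball_ /= distrC; exact: ltW.
      exact: (@proj_continuous nat (fun=> R) i g _ hi).
    exact: (@filter_forall {ptws nat -> R} 'I_N (fun i f => `|f i - g i| <= e) (nbhs g) _ ni).
  have [_ [[j Jj ->] hj]] := cg _ _ FJ ng; exists j => // i iN.
  exact: (hj (Ordinal iN)).
have gX N : q (cut N g) <= K.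
  apply: (@le_of_small _ _ _ N%:R) => e e0.
  have [j _ hj] := near_g e N 0%N e0.
  have -> : cut N g = (fun i => cut N (coord t^~ (y j)) i + cut N (fun i => g i - coord t i (y j)) i).
    by apply/funext => i; rewrite /cut; case: ifP; rewrite ?addr0 // addrC subrK.
  apply: le_trans (goodD (good_tnorm R hfs alpha) (@supp_cut _ N _) (@supp_cut _ N _)) _.
  apply: lerD; first by rewrite -(norm_proj hT); exact: le_trans (proj_le hfs hT _ _) (hy j).
  apply: le_trans (good_l1 (good_tnorm R hfs alpha) (@supp_cut _ N _)) _.
  rewrite mulr_natl -[N in X in _ <= X]card_ord -sumr_const; apply: ler_sum => i _.
  by rewrite /cut ltn_ord distrC; exact: hj.
have [x hx] := boundedly_complete hfs hT gX.
exists x => e N J e0; have [j Jj hj] := near_g e N J e0; exists j => // i iN.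
by rewrite (scalar_funB (coord_scalar hfs hT i)) hx; exact: hj.
Qed.

(** A coordinatewise cluster point [x] of [y] makes [y j - x] almost successive along
    subsequences, so some convex combination of far terms of [y - x] is small.  Two convex
    combinations with disjoint sets of indices are then both close to [x], while their
    difference has norm 2 in [ell 1]. *)
Lemma ell1_absurd y (c K : R) : 0 < c -> (forall j, `|y j| <= K) ->
  (forall M b, supp M b -> c * \sum_(i < M) `|b i| <= `|psum y M b|) -> False.
Proof.
move=> c0 hy low; have [x hx] := coord_cluster hy.
have K0 : 0 <= K by exact: le_trans (hy 0%N).
have c4 : 0 < c / 4 by rewrite divr_gt0.
pose weights J b M := [/\ supp M b, forall i, 0 <= b i, forall i, (i < J)%N -> b i = 0 &
  forall M', (M <= M')%N -> \sum_(i < M') b i = 1].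
have weights_le J b M : weights J b M -> forall M', (M <= M')%N -> `|psum y M' b| <= K.
  move=> [_ b0 _ b1] M' MM'; rewrite /psum; apply: le_trans (ler_norm_sum _ _ _) _.
  apply: (@le_trans _ _ (\sum_(i < M') b i * K)).
    apply: ler_sum => i _; rewrite normrZ ger0_norm //; exact: ler_wpM2l.
  by rewrite -mulr_suml b1 // mul1r.
have main J : exists b M, weights J b M /\ `|psum y M b - x| <= 2 * (c / 4).
  pose C : set (nat -> R) := [set a | fin a /\ exists b M, weights J b M /\
     forall M', (M <= M')%N -> `|psum y M' b - x - psum t M' a| <= c / 4].
  have cC : convex_set C.
    move=> a a' l /andP[l0 l1] [fa [b [M [[sb b0 bJ b1] hb]]]] [fa' [b' [M' [[sb' b'0 b'J b'1] hb']]]].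
    have l1' : 0 <= 1 - l by rewrite subr_ge0.
    split; first by apply: finD; exact: finZ.
    exists (fun i => l * b i + (1 - l) * b' i), (maxn M M'); split; first split.
    - by move=> i; rewrite geq_max => /andP[Mi M'i]; rewrite sb // sb' // !mulr0 addr0.
    - by move=> i; rewrite addr_ge0 // mulr_ge0.
    - by move=> i iJ; rewrite bJ // b'J // !mulr0 addr0.
    - move=> L; rewrite geq_max => /andP[ML M'L].
      by rewrite big_split /= -!mulr_sumr b1 // b'1 // !mulr1 addrC subrK.
    - move=> L; rewrite geq_max => /andP[ML M'L].
      have -> : psum y L (fun i => l * b i + (1 - l) * b' i) - x -
          psum t L (fun i => l * a i + (1 - l) * a' i) =
          l *: (psum y L b - x - psum t L a) + (1 - l) *: (psum y L b' - x - psum t L a').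
        have lx : x = l *: x + (1 - l) *: x by rewrite -scalerDl addrC subrK scale1r.
        have comb (u u' v v' : X) : l *: u + (1 - l) *: u' - (l *: v + (1 - l) *: v') =
            l *: (u - v) + (1 - l) *: (u' - v') by rewrite opprD addrACA -!scalerBr.
        by rewrite !psum_linear !psumZ {1}lx !comb.
      apply: le_trans (ler_normD _ _) _; rewrite !normrZ !ger0_norm //.
      have := ler_wpM2l l0 (hb L ML); have := ler_wpM2l l1' (hb' L M'L); lra.
  have fC : far C.
    move=> N; have [d d0 hd] := near_block hfs hT N c4.
    have [j Jj hj] := hx d N J d0; have [M hM] := hd _ hj.
    pose z := y j - x; pose L := maxn M j.+1.
    have jL : (j < L)%N by rewrite leq_maxr.
    exists L, (cut L (tl N (coord t^~ z))); split; last first.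
      move=> i hi; rewrite /cut /tl; case: ltnP => // iM; case: ltnP => // Ni.
      by move: hi; rewrite Ni iM.
    split; first by exists L; exact: supp_cut.
    exists (fun i => (i == j)%:R), L; split; first split.
    - by move=> i Li; rewrite gtn_eqF //; exact: leq_trans Li.
    - by move=> i.
    - by move=> i iJ; rewrite ltn_eqF //; exact: leq_trans Jj.
    - move=> L' LL'; have jL' := leq_trans jL LL'.
      rewrite (bigD1 (Ordinal jL')) //= eqxx big1 ?addr0 // => i ij.
      by case: eqP => // E; case/eqP: ij; apply/val_inj.
    - move=> L' LL'; have jL' := leq_trans jL LL'.
      rewrite [psum y _ _](_ : _ = y j); last first.
        rewrite /psum (bigD1 (Ordinal jL')) //= eqxx scale1r big1 ?addr0 // => i ij.
        case: eqP => [E|_]; last by rewrite scale0r.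
        by case/eqP: ij; apply/val_inj.
      rewrite (psum_supp t LL'); last exact: supp_cut.
      by have [_] := hM L (leq_maxl _ _).
  have hC a : C a -> fin a /\ q a <= c / 4 + K + `|x|.
    move=> [fa [b [M [wb hb]]]]; split=> //; have [L sa] := fa.
    pose L' := maxn L M; have ML' : (M <= L')%N by rewrite leq_maxr.
    rewrite -(norm_psum_fin hT (supp_le (leq_maxl L M) sa)).
    have := hb _ ML'; have := weights_le _ _ _ wb _ ML'.
    have := ler_normB (psum y L' b - x) (psum y L' b - x - psum t L' a).
    by rewrite opprB addrC subrK; have := ler_normB (psum y L' b) x; lra.
  have [_ [a [[[fa [b [M [wb hb]]]] [_ qa]] _]]] := far_small hfs cC fC c4 hC 0.
  have [L sa] := fa; have [sb b0 bJ b1] := wb.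
  pose L' := maxn L M; have ML' : (M <= L')%N by rewrite leq_maxr.
  exists b, M; split=> //; rewrite -(psum_supp y ML' sb).
  have := hb _ ML'; move: qa; rewrite -(norm_psum_fin hT (supp_le (leq_maxl L M) sa)).
  have := ler_normD (psum y L' b - x - psum t L' a) (psum t L' a).
  by rewrite subrK; lra.
(* The weights [b'] vanish where [b] lives, so [b - b'] has norm 2 in [ell 1]. *)
have [b [M [[sb b0 bJ b1] hb]]] := main 0%N.
have [b' [M' [[sb' b'0 b'J b'1] hb']]] := main M.
pose L := maxn M M'; have ML : (M <= L)%N by exact: leq_maxl.
have M'L : (M' <= L)%N by exact: leq_maxr.
have sL : supp L (fun i => b i - b' i).
  by move=> i; rewrite geq_max => /andP[Mi M'i]; rewrite sb // sb' // subrr.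
have := low L _ sL; rewrite -psumB (psum_supp y ML sb) (psum_supp y M'L sb').
have -> : \sum_(i < L) `|b i - b' i| = 2.
  transitivity (\sum_(i < L) (b i + b' i)); last by rewrite big_split /= b1 // b'1.
  apply: eq_bigr => i _; case: (ltnP i M) => iM.
    by rewrite b'J // subr0 addr0 ger0_norm.
  by rewrite sb // !add0r normrN ger0_norm.
have := ler_distD x (psum y M b) (psum y M' b'); rewrite (distrC x); lra.
Qed.

End EllOne.

(** * Copies of c0 and ell p *)

Section SequenceSpaces.
Variable R : realType.
Implicit Types (a b : nat -> R).

Lemma cvg_eventually (u : nat -> R) (l : R) N : (forall n, (N <= n)%N -> u n = l) ->
  u @ \oo --> l.
Proof.
move=> h; apply/cvgrPdist_le => e e0; exists N => // n /= Nn.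
by rewrite h // subrr normr0 ltW.
Qed.

Lemma series_supp (p : R) N b : p != 0 -> supp N b ->
  series (fun n => `|b n| `^ p) @ \oo --> \sum_(i < N) `|b i| `^ p.
Proof.
move=> p0 sb; apply: (@cvg_eventually _ _ N) => n Nn; rewrite /series /= big_mkord.
by apply: (sum_supp (f := fun r => `|r| `^ p) Nn sb); rewrite normr0 powR0.
Qed.

Lemma ell_supp (p : R) N b : p != 0 -> supp N b -> ell p b.
Proof. by move=> p0 sb; apply/cvg_ex; eexists; exact: series_supp sb. Qed.

Lemma ell_norm_supp (p : R) N b : p != 0 -> supp N b ->
  ell_norm p b = (\sum_(i < N) `|b i| `^ p) `^ p^-1.
Proof. by move=> p0 sb; rewrite /ell_norm (cvg_lim _ (series_supp p0 sb)). Qed.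

Lemma ell_norm_signs (p : R) k N b : p != 0 -> signs k N b -> ell_norm p b = k%:R `^ p^-1.
Proof.
move=> p0 [sb b01 <-]; rewrite (ell_norm_supp p0 sb); congr (_ `^ _).
apply: eq_bigr => i _; case: (b01 i) => [->|->]; first by rewrite normr0 powR0.
by rewrite powR1.
Qed.

Lemma c0_supp N b : supp N b -> @c0 R b.
Proof. by move=> sb; exact: (cvg_eventually sb). Qed.

Lemma c0_norm_signs k N b : (0 < k)%N -> signs k N b -> c0_norm b = 1.
Proof.
move=> k0 [sb b01 kb]; have bnd i : setT i -> `|b i| <= 1.
  by move=> _; case: (b01 i) => [->|->] //; rewrite normr0.
apply/eqP; rewrite eq_le; apply/andP; split.
  by apply: (@sup_leE R _ setT (fun n => `|b n|)) => //; exists 0%N.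
have [i bi] : exists i, `|b i| = 1.
  apply: contrapT => H; move: kb; rewrite big1 => [/eqP|i _].
    by rewrite eq_sym pnatr_eq0 gtn_eqF.
  by case: (b01 i) => [->|h]; [rewrite normr0|case: H; exists i].
by rewrite -{1}bi; exact: (@le_supE R _ setT (fun n => `|b n|) 1 i bnd).
Qed.

Definition unit_vector j : nat -> R := fun i => (i == j)%:R.

Lemma signs_unit_vector j : signs 1 j.+1 (unit_vector j).
Proof.
split.
- by move=> i ji; rewrite /unit_vector gtn_eqF.
- by move=> i; rewrite /unit_vector; case: eqP => _; [right; rewrite normr1|left].
- rewrite big_ord_recr /= /unit_vector eqxx normr1 big1 ?add0r // => i _.
  by rewrite ltn_eqF // normr0.
Qed.

Lemma embedding_psum (X : completeNormedModType R) (S : set (nat -> R)) (T : (nat -> R) -> X) :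
  (forall N b, supp N b -> S b) ->
  (forall (k : R) a b, S a -> S b -> T (fun n => k * a n + b n) = k *: T a + T b) ->
  forall N b, supp N b -> T b = psum (fun j => T (unit_vector j)) N b.
Proof.
move=> hS hT; have T0 : T (fun=> 0) = 0.
  have S0 : S (fun=> 0) by apply: (hS 0%N).
  have := hT 1 _ _ S0 S0; rewrite scale1r.
  have -> : (fun n : nat => 1 * 0 + 0) = (fun=> 0 : R) by apply/funext => n; rewrite mulr0 addr0.
  by move=> /eqP; rewrite -subr_eq0 opprD addrA subrr sub0r oppr_eq0 => /eqP.
elim=> [|N IH] b sb.
  have -> : b = (fun=> 0) by apply/funext => i; rewrite sb.
  by rewrite T0 /psum big_ord0.
have bE : b = (fun n => b N * unit_vector N n + cut N b n).
  apply/funext => i; rewrite /unit_vector /cut; case: (ltngtP i N) => [iN|iN|->].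
  - by rewrite mulr0 add0r.
  - by rewrite mulr0 add0r sb.
  - by rewrite mulr1 addr0.
have [sN _ _] := signs_unit_vector N.
have cN : supp N (cut N b) by exact: supp_cut.
rewrite {1}bE hT; [|exact: hS sN|exact: hS cN].
rewrite (IH _ cN) psum_cut // addrC /psum big_ord_recr /=.
by [].
Qed.

End SequenceSpaces.

Section NoSubspace.
Variables (R : realType) (W : omega1) (fs : W -> nat -> W).
Hypothesis hfs : fundamental_sequences fs.
Variable alpha : W.
Variables (X : completeNormedModType R) (t : nat -> X).
Hypothesis hT : is_T fs alpha t.

(** This covers [c0] and [ell p] for [p > 1], where the norms 1 and the [p]-th root of [k] of
    signed sums are [o(k)]; in [ell 1] they equal [k]. *)
Lemma no_sublinear_subspace (S : set (nat -> R)) (N : (nat -> R) -> R) :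
  (forall M b, supp M b -> S b) ->
  (forall M b, signs 1 M b -> 1 <= N b) ->
  (forall e : R, 0 < e -> exists2 k, (0 < k)%N & forall M b, signs k M b -> N b <= e * k%:R) ->
  ~ has_subspace_isomorphic X S N.
Proof.
move=> hS h1 hk [Y [_ [T [Tlin _ [c [C [c0 C0 hc]]]]]]].
have TE := embedding_psum hS Tlin.
apply: (sublinear_absurd hfs hT (y := fun j => T (unit_vector R j)) c0).
  move=> j; have sj := signs_unit_vector R j; have [suj _ _] := sj.
  have /andP[h _] := hc _ (hS _ _ suj); apply: le_trans h.
  by rewrite -{1}[c]mulr1; apply: ler_wpM2l; [exact: ltW|exact: h1 sj].
move=> e e0; have [k k0 hkN] := hk (e / C) (divr_gt0 e0 C0); exists k => // M b sb.
have [sbM _ _] := sb; rewrite -(TE _ _ sbM).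
have /andP[_ h] := hc _ (hS _ _ sbM); apply: le_trans h _.
by rewrite -ler_pdivlMl //; apply: le_trans (hkN _ _ sb) _; rewrite mulrA [C^-1 * e]mulrC.
Qed.

Lemma no_c0_subspace : ~ has_subspace_isomorphic X (@c0 R) (@c0_norm R).
Proof.
apply: no_sublinear_subspace.
- exact: c0_supp.
- by move=> M b /(c0_norm_signs (ltn0Sn 0)) ->.
- move=> e e0; have [k hk] := nat_upper_bound e^-1; exists k.+1 => // M b sb.
  rewrite (c0_norm_signs _ sb) // mulrC -ler_pdivrMr // div1r.
  by apply: le_trans hk _; rewrite ler_nat.
Qed.

Lemma no_ell1_subspace : ~ has_subspace_isomorphic X (ell (1 : R)) (ell_norm 1).
Proof.
move=> [Y [_ [T [Tlin _ [c [C [c0 C0 hc]]]]]]].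
have n1 : 1 != 0 :> R by exact: oner_neq0.
have hS N b : supp N b -> ell (1 : R) b by exact: ell_supp.
have TE := embedding_psum hS Tlin.
have nE N (b : nat -> R) : supp N b -> ell_norm 1 b = \sum_(i < N) `|b i|.
  move=> sb; rewrite (ell_norm_supp n1 sb) invr1 powRr1; last by apply: sumr_ge0 => i _; exact: powR_ge0.
  by apply: eq_bigr => i _; rewrite powRr1.
apply: (ell1_absurd hfs hT (y := fun j => T (unit_vector R j)) (K := C) c0).
  move=> j; have [suj _ sumj] := signs_unit_vector R j.
  have /andP[_ h] := hc _ (hS _ _ suj); apply: le_trans h _.
  by rewrite (nE _ _ suj) sumj mulr1.
move=> M b sb; rewrite -(TE _ _ sb) -(nE _ _ sb).
by have /andP[] := hc _ (hS _ _ sb).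
Qed.

Lemma no_ell_subspace (p : R) : 1 <= p -> ~ has_subspace_isomorphic X (ell p) (ell_norm p).
Proof.
rewrite le_eqVlt => /orP[/eqP <-|p1]; first exact: no_ell1_subspace.
have p_gt0 : 0 < p by exact: lt_trans p1.
have p0 : p != 0 by rewrite gt_eqF.
apply: no_sublinear_subspace.
- by move=> M b; exact: ell_supp.
- by move=> M b sb; rewrite (ell_norm_signs p0 sb) powR1.
move=> e e0; pose u := 1 - p^-1.
have u0 : 0 < u by rewrite subr_gt0 invf_lt1.
have [k hk] := nat_upper_bound (e^-1 `^ u^-1); exists k.+1 => // M b sb.
rewrite (ell_norm_signs p0 sb).
have k0 : k.+1%:R != 0 :> R by rewrite pnatr_eq0.
have kE : k.+1%:R = k.+1%:R `^ p^-1 * k.+1%:R `^ u :> R.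
  rewrite -powRD; last by rewrite k0 implybT.
  by rewrite /u addrC subrK powRr1.
rewrite [X in _ <= e * X]kE mulrCA -[X in X <= _]mulr1; apply: ler_wpM2l; first exact: powR_ge0.
rewrite -ler_pdivrMl // mulr1.
have -> : e^-1 = (e^-1 `^ u^-1) `^ u.
  by rewrite -powRrM mulVf ?gt_eqF // powRr1 // invr_ge0 ltW.
apply: ge0_ler_powR; rewrite ?nnegrE ?powR_ge0 //; first exact: ltW.
by apply: le_trans hk _; rewrite ler_nat.
Qed.

End NoSubspace.

(** * Oscillation indices *)

Section OscillationIndex.
Variables (R : realType) (W : omega1) (E : topologicalType) (eps : R) (f : nat -> E -> R).
Implicit Types (K A : set E) (a b c : W).

Local Notation osc := (@osc R E eps f W).
Local Notation D := (osc_derived eps f).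

Lemma osc0 K : osc K (ozero W) = K. Proof. exact: orec0. Qed.

Lemma oscS K a : osc K (osucc a) = D (osc K a). Proof. exact: orecS. Qed.

Lemma osc_limitP K b : olimit b -> forall x, osc K b x <-> forall c, (c < b)%O -> osc K c x.
Proof.
move=> lb x; rewrite /Defs.osc orec_limit //; split=> [h c cb|h A [c cb <-]].
  by apply: h; exists c.
exact: h.
Qed.

Lemma olimit_cases a : [\/ a = ozero W, exists b, a = osucc b | olimit a].
Proof.
have [->|a0] := pselect (a = ozero W); first by constructor 1.
have [h|h] := pselect (exists b, a = osucc b); first by constructor 2.
by constructor 3.
Qed.

Lemma lt_osucc a : (a < osucc a)%O. Proof. exact: (proj1 (osuccP a)). Qed.

Lemma le_osc K a b : (a <= b)%O -> osc K b `<=` osc K a.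
Proof.
elim/(well_founded_ind (@omega1_wf W)): b => b IH.
rewrite le_eqVlt => /orP[/eqP ->//|ab].
case: (olimit_cases b) => [b0|[c bc]|lb].
- by move: ab; rewrite b0 ltNge le0x.
- subst b => x; rewrite oscS => -[xc _]; apply: (IH c) xc; first exact: lt_osucc.
  by rewrite leNgt; apply/negP => /(proj2 (osuccP c)); rewrite leNgt ab.
- by move=> x /osc_limitP h; apply: h.
Qed.

Lemma osc_osup K (S : set W) x : countable S -> S !=set0 ->
  (forall c, S c -> osc K c x) -> osc K (osup S) x.
Proof.
move=> cS [c0 Sc0] h; have [ub lub] := osupP cS.
have below d : (d < osup S)%O -> exists2 c, S c & (d < c)%O.
  move=> dS; apply: contrapT => H; have : (osup S <= d)%O.
    apply: lub => c Sc; rewrite leNgt; apply/negP => dc; apply: H; by exists c.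
  by rewrite leNgt dS.
case: (olimit_cases (osup S)) => [b0|[d bd]|lb].
- rewrite b0; apply: (@le_osc K (ozero W) c0); first exact: le0x.
  exact: h.
- have [|c Sc dc] := below d; first by rewrite bd lt_osucc.
  suff -> : osup S = c by exact: h.
  by apply/eqP; rewrite eq_le (ub c Sc) bd andbT; exact: (proj2 (osuccP d)).
- apply/osc_limitP => // d /below[c Sc dc].
  by apply: (@le_osc K d c (ltW dc)); exact: h.
Qed.

Lemma countable_image_lt (g : W -> W) b : countable [set g c | c in [set c | (c < b)%O]].
Proof. exact: sub_countable (card_image_le _ _) (omega1_countable b). Qed.

Lemma osc_oadd K a b : osc (osc K a) b `<=` osc K (oadd a b).
Proof.
elim/(well_founded_ind (@omega1_wf W)): b => b IH x.
case: (olimit_cases b) => [b0|[c bc]|lb].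
- by subst b; rewrite osc0 /oadd orec0.
- subst b; rewrite oscS /oadd orecS oscS => -[xc hx].
  have sub := IH c (lt_osucc c); split; first exact: sub.
  move=> U /hx[N hN]; exists N => n /hN[M hM]; exists M.
  case: hM => -[y [[y1 y2] y3]]; [left|right]; exists y; split=> //; split=> //; exact: sub.
- move=> /osc_limitP h; rewrite /oadd orec_limit //.
  apply: osc_osup; first exact: countable_image_lt.
    by exists (oadd a (ozero W)), (ozero W) => //=; rewrite lt0x; apply/eqP; case: lb.
  by move=> _ [c cb <-]; apply: IH => //; exact: h.
Qed.

Lemma olimit_gt0 b : olimit b -> (ozero W < b)%O.
Proof. by move=> [b0 _]; rewrite lt0x; apply/eqP. Qed.

Lemma iter_osucc_lt n : (iter n (@osucc W) (ozero W) < iter n.+1 (@osucc W) (ozero W))%O.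
Proof. exact: lt_osucc. Qed.

Lemma oomega_spec : olimit (@oomega W) /\
  forall c, (c < oomega)%O -> exists n, c = iter n (@osucc W) (ozero W).
Proof.
have cS : countable (range (fun n => iter n (@osucc W) (ozero W))).
  exact: sub_countable (card_image_le _ _) (countableP _).
have [ub lub] := osupP cS.
have lt n : (iter n (@osucc W) (ozero W) < oomega)%O.
  by apply: lt_le_trans (iter_osucc_lt n) _; apply: ub; exists n.+1.
have h c : (c < oomega)%O -> exists n, c = iter n (@osucc W) (ozero W).
  move=> cw; have [n cn] : exists n, (c <= iter n (@osucc W) (ozero W))%O.
    apply: contrapT => H; have : (oomega <= c)%O.
      apply: lub => _ [n _ <-]; rewrite leNgt; apply/negP => cn; apply: H; exists n; exact: ltW.
    by rewrite leNgt cw.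
  elim: n cn => [|n IH].
    by rewrite /= => c0; exists 0%N; apply/eqP; rewrite eq_le c0 le0x.
  rewrite le_eqVlt => /orP[/eqP ->|cn]; first by exists n.+1.
  apply: IH; rewrite leNgt; apply/negP => /(proj2 (osuccP _)).
  by rewrite leNgt cn.
split=> //; split; first by move=> w0; have := lt 0%N; rewrite w0 ltxx.
move=> [b wb]; have [|n bn] := h b; first by rewrite wb lt_osucc.
by have := lt n.+1; rewrite wb bn /= ltxx.
Qed.

Lemma osc_omul_oomega K a x :
  (forall n, osc K (omul a (iter n (@osucc W) (ozero W))) x) -> osc K (omul a oomega) x.
Proof.
move=> h; have [lw hw] := oomega_spec; rewrite /omul orec_limit //.
apply: osc_osup; first exact: countable_image_lt.
  by exists (omul a (ozero W)), (ozero W) => //=; exact: olimit_gt0.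
by move=> _ [c /hw[n ->] <-]; exact: h.
Qed.

Variable fs : W -> nat -> W.
Hypothesis hfs : fundamental_sequences fs.

Variable chi : {fset nat} -> E.
Hypothesis chi_near : forall (H : {fset nat}) U, nbhs (chi H) U ->
  exists N, forall n, (N <= n)%N -> U (chi (H `|` [fset n])%fset).
Hypothesis f_chi : forall n H, f n (chi H) = (n \in H)%:R.
Hypothesis eps1 : eps < 1.

Definition above N (F : {fset nat}) := forall i, i \in F -> (N <= i)%N.

Lemma le_bigmax_fset (F : {fset nat}) n : n \in F -> (n <= \max_(i <- F) i)%N.
Proof. by move=> nF; rewrite (big_rem n nF) /= leq_maxl. Qed.

(** The points [chi (H `|` [fset n])] converge to [chi H], and [f n] is 1 at the [n]-th of them
    while [f m] vanishes there for large [m]. *)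
Lemma osc_derived_chi K H N : K (chi H) ->
  (forall n, (N <= n)%N -> K (chi (H `|` [fset n])%fset)) -> D K (chi H).
Proof.
move=> KH hK; split=> // U /chi_near[N' hU].
exists (maxn N N') => n; rewrite geq_max => /andP[Nn N'n].
pose G := (H `|` [fset n])%fset.
exists (\max_(i <- G) i).+1; left; exists (chi G); split; last exact: hU.
split; last exact: hK.
move=> m /= Gm; rewrite /osc_plus /= !f_chi.
have -> : n \in G by rewrite !inE eqxx orbT.
suff /negbTE -> : m \notin G by rewrite subr0.
apply/negP => mG; move: Gm; rewrite ltnNge => /negP; apply.
exact: le_bigmax_fset.
Qed.

Lemma oexp0 a : oexp a (ozero W) = oone W. Proof. exact: orec0. Qed.
Lemma oexpS a b : oexp a (osucc b) = omul (oexp a b) a. Proof. exact: orecS. Qed.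

Lemma omulS a b : omul a (osucc b) = oadd (omul a b) a. Proof. exact: orecS. Qed.

(** The exponent [c <= b] replaces [b] because the families attached to [b] need not include [F_c];
    they are indexed by ordinals that are cofinal below [b], which settles [c < b] by induction.
    For [c = b] a limit, [w^b] is the supremum of the [w^c], [c < b].  If [b] is the successor of
    [d], then [F_b] contains, far enough to the right, the unions of [n] successive sets of
    [F_d]; removing these sets one at a time, each gives [w^d] derivatives, hence [w^d * n] of
    them for all [n]. *)
Lemma osc_schreier b c K H N : (c <= b)%O ->
  (forall F, schreier fs b F -> above N F -> K (chi (H `|` F)%fset)) ->
  osc K (oexp oomega c) (chi H).
Proof.
elim/(well_founded_ind (@omega1_wf W)): b c K H N => b IH c0 K H N.
have b1P : (ozero W < b)%O -> b <> oone W -> (oone W < b)%O.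
  by move=> b0 b1; rewrite lt_neqAle; apply/andP; split;
    [apply/eqP => be; exact: b1|exact: (proj2 (osuccP (ozero W)))].
have below K' H' N' c : (c < b)%O ->
    (forall F, schreier fs b F -> above N' F -> K' (chi (H' `|` F)%fset)) ->
    osc K' (oexp oomega c) (chi H').
  move=> cb hK; have b0 : (ozero W < b)%O by exact: le_lt_trans (le0x c) cb.
  have [j cj] : exists j, (c <= fs1 fs b j)%O.
    rewrite /fs1; case: eqP => [b1|b1].
      by exists 0%N; rewrite leNgt; apply/negP => /(proj2 (osuccP _)); rewrite leNgt -/(oone W) -b1 cb.
    have [hS hL] := hfs (b1P b0 b1).
    case: (olimit_cases b) => [be|[d bd]|lb]; first by move: b0; rewrite be ltxx.
      exists 0%N; rewrite (hS _ bd) leNgt; apply/negP => /(proj2 (osuccP _)).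
      by rewrite leNgt -bd cb.
    by have [_ _ /(_ c cb)[i ci]] := hL lb; exists i; exact: ltW.
  apply: (IH _ (fs1_lt hfs j b0) _ _ _ (maxn N' j)) => // F hF Fabove; apply: hK.
    by apply: (schreier_tail hfs b0 hF) => l /Fabove; rewrite geq_max => /andP[].
  by move=> l /Fabove; rewrite geq_max => /andP[].
rewrite le_eqVlt => /orP[/eqP ->|cb]; last exact: below.
move=> hK; have KH : K (chi H).
  by have := hK fset0 (schreier_empty hfs b); rewrite fsetU0; apply=> i; rewrite inE.
case: (olimit_cases b) => [b0|[c bc]|lb].
- subst b; rewrite oexp0 /oone oscS osc0; apply: (osc_derived_chi (N := N)) => // n Nn.
  by apply: hK; [exact: Schreier0_single|move=> i; rewrite inE => /eqP ->].
- have b0 : (ozero W < b)%O by rewrite bc; exact: le_lt_trans (le0x c) (lt_osucc c).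
  have fsb j : fs1 fs b j = c.
    rewrite /fs1; case: eqP => [b1|b1]; first by move: bc; rewrite b1 => /osucc_inj.
    by have [h _] := hfs (b1P b0 b1); exact: h.
  rewrite bc oexpS; apply: osc_omul_oomega => n.
  have cb : (c < b)%O by rewrite bc lt_osucc.
  pose N' := maxn N n.
  (* After [w^c * m] derivatives, [k] of the [n] sets are still there. *)
  have : forall m k (G : nat -> {fset nat}), (m + k = n)%N -> successive k G ->
     (forall j, (j < k)%N -> schreier fs c (G j) /\ above N' (G j)) ->
     osc K (omul (oexp oomega c) (iter m (@osucc W) (ozero W)))
       (chi (H `|` \bigcup_(j <- iota 0 k) G j)%fset).
    elim=> [|m IHm] k G mk sG hG.
      rewrite /omul orec0 osc0; apply: hK.
        by apply: schreier_build => // j jk; rewrite fsb; case: (hG j jk).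
      move=> i /bigfcupP[j]; rewrite andbT mem_iota /= add0n => jk iG.
      have [_ /(_ i iG)] := hG j jk; apply: leq_trans; exact: leq_maxl.
    rewrite /= omulS; apply: osc_oadd.
    set U := (\bigcup_(j <- iota 0 k) G j)%fset.
    apply: (IH c cb _ _ _ (maxn N' (\max_(i <- U) i).+1)) => // F hF Fabove.
    pose G' j := if j == k then F else G j.
    have -> : (H `|` U `|` F)%fset = (H `|` \bigcup_(j <- iota 0 k.+1) G' j)%fset.
      rewrite -addn1 iotaD big_cat /= big_seq1 add0n /G' eqxx -fsetUA; congr (_ `|` (_ `|` _))%fset.
      rewrite /U !big_seq; apply: eq_bigr => j; rewrite mem_iota /= add0n => jk.
      by rewrite ltn_eqF.
    apply: IHm; first by lia.
      split=> [j i jk|j j' i i' jj' j'k]; rewrite /G'.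
        case: eqP => [_ /Fabove|jk' iG].
          by rewrite !geq_max => /andP[/andP[_ ni] _]; lia.
        have jk2 : (j < k)%N by lia.
        by have [_ /(_ i iG)] := hG j jk2; rewrite geq_max => /andP[_ ni]; lia.
      have [jk0|_] := eqVneq j k; first by exfalso; lia.
      have jk : (j < k)%N by lia.
      case: eqP => [_ iG|j'k' iG iG'].
        move=> /Fabove; rewrite geq_max => /andP[_]; apply: leq_trans; rewrite ltnS.
        apply: le_bigmax_fset.
        by apply/bigfcupP; exists j; rewrite ?andbT ?mem_iota.
      by case: sG => _ h; apply: (h j j') => //; lia.
    move=> j jk; rewrite /G'; case: eqP => [_|jk']; last by apply: hG; lia.
    by split=> // i /Fabove; rewrite geq_max => /andP[].
  move=> /(_ n 0%N (fun=> fset0)); rewrite big_nil fsetU0 addn0; by apply.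
- rewrite /oexp orec_limit //; apply: osc_osup; first exact: countable_image_lt.
    by exists (oexp oomega (ozero W)), (ozero W) => //=; exact: olimit_gt0.
  by move=> _ [c cb <-]; exact: (below _ _ N).
Qed.
End OscillationIndex.

(** * The oscillation index of the basis *)

Section BasisOscillation.
Variables (R : realType) (W : omega1) (fs : W -> nat -> W).
Hypothesis hfs : fundamental_sequences fs.
Variable alpha : W.
Variables (X : completeNormedModType R) (t : nat -> X).
Hypothesis hT : is_T fs alpha t.

Definition fsum_coord (F : {fset nat}) : {ptws X -> R} := fun x => fsum F (coord t^~ x).

Lemma fsum_coord_scalar F : scalar (fsum_coord F).
Proof.
move=> k x y; rewrite /fsum_coord /fsum mulr_sumr -big_split; apply: eq_bigr => i _.
exact: (coord_scalar hfs hT).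
Qed.

Lemma fsum_coord_basis n F : fsum_coord F (t n) = (n \in F)%:R.
Proof.
have tE : t n = psum t n.+1 (unit_vector R n).
  rewrite /psum big_ord_recr /= /unit_vector eqxx scale1r big1 ?add0r // => i _.
  by rewrite ltn_eqF // scale0r.
have [un _ _] := signs_unit_vector R n.
have cE i : coord t i (t n) = (i == n)%:R.
  by rewrite {1}tE (coord_psum hfs hT) supp_cutE.
rewrite /fsum_coord /fsum; case: (boolP (n \in F)) => nF.
  rewrite (big_rem n nF) /= cE eqxx big_seq big1 ?addr0 // => i.
  rewrite mem_rem_uniq ?fset_uniq // => /andP[/negbTE ni _].
  by rewrite cE ni.
rewrite big_seq big1 // => i iF; rewrite cE; case: eqP => // E.
by move: nF; rewrite -E iF.
Qed.

Lemma fsum_coord_ball F : schreier fs alpha F -> dual_ball X (fsum_coord F).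
Proof.
move=> hF; have h x : `|fsum_coord F x| <= 1 * `|x|.
  pose N := (\max_(i <- F) i).+1; rewrite mul1r; apply: le_trans (proj_le hfs hT N x).
  rewrite (norm_proj hT).
  have sN : supp N (cut N (coord t^~ x)) by exact: supp_cut.
  apply: le_trans (fsum_le_tnorm hfs sN hF).
  rewrite le_eqVlt; apply/orP; left; apply/eqP; congr `|_|.
  rewrite /fsum_coord /fsum [LHS]big_seq [RHS]big_seq; apply: eq_bigr => i iF.
  by rewrite /cut ltnS le_bigmax_fset.
split; first exact: dual_intro (fsum_coord_scalar F) h.
by apply: dual_norm_le h.
Qed.

Lemma fsum_coord_near (H : {fset nat}) (U : set {ptws X -> R}) : nbhs (fsum_coord H) U ->
  exists N, forall n, (N <= n)%N -> U (fsum_coord (H `|` [fset n])%fset).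
Proof.
move=> hU.
have cv : (fun n => fsum_coord (H `|` [fset n])%fset) @ \oo --> fsum_coord H.
  apply/(pointwise_cvgP (F := fmap (fun n => fsum_coord (H `|` [fset n])%fset) \oo)) => x.
  apply/cvgrPdist_le => e e0.
  have [N hN] := proj_near hfs hT x e0.
  exists (maxn N (\max_(i <- H) i).+1) => // n /=; rewrite geq_max => /andP[Nn Hn].
  have dis : [disjoint H & [fset n]]%fset.
    apply/fdisjointP => i /le_bigmax_fset iH; rewrite inE.
    by rewrite ltn_eqF // (leq_ltn_trans iH).
  rewrite /fsum_coord (fsumU _ dis) opprD addrA subrr sub0r normrN.
  rewrite {1}/fsum big_seq_fset1.
  have -> : coord t n x = coord t n (x - proj t n x).
    by rewrite (scalar_funB (coord_scalar hfs hT n)) /proj (coord_psum hfs hT) /cut ltnn subr0.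
  exact: le_trans (coord_le hfs hT _ _) (hN n Nn).
have [N _ hN] := cv _ hU; exists N => n Nn; exact: hN.
Qed.

Lemma basis_oscillation (eps : R) : 0 < eps < 1 ->
  osc eps (fun n (f : {ptws X -> R}) => f (t n)) (dual_ball X) (oexp oomega alpha) !=set0.
Proof.
move=> /andP[_ eps1]; exists (fsum_coord fset0).
apply: (osc_schreier hfs fsum_coord_near (fun n F => fsum_coord_basis n F) eps1 (N := 0)
  (lexx alpha)) => F hF _.
by rewrite fset0U; exact: fsum_coord_ball.
Qed.

End BasisOscillation.

Theorem proposition5p1 (R : realType) (W : omega1) (fs : W -> nat -> W)
    (hfs : fundamental_sequences fs) (alpha : W)
    (X : completeNormedModType R) (t : nat -> X) (hT : is_T fs alpha t) :
  reflexive_space X /\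
  (exists e : nat -> X, unconditional_basis e) /\
  (forall p : R, 1 <= p -> ~ has_subspace_isomorphic X (ell p) (ell_norm p)) /\
  ~ has_subspace_isomorphic X (@c0 R) (@c0_norm R) /\
  (forall eps : R, 0 < eps < 1 ->
     osc eps (fun n (f : {ptws X -> R}) => f (t n)) (dual_ball X)
       (oexp oomega alpha) !=set0).
Proof.
split; first exact: (space_reflexive hfs hT).
split; first by exists t; exact: (basis_unconditional hfs hT).
split; first exact: (no_ell_subspace hfs hT).
split; first exact: (no_c0_subspace hfs hT).
exact: (basis_oscillation hfs hT).
Qed.
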